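(* Let $d\ge 2$ and let $X_1,X_2,\dots$ be i.i.d. random points in $\mathbb{R}^d$ with a spherically symmetric density $f$; write $f(r):=f(r\theta)$ for $r\ge 0$, $\theta\in S^{d-1}$. Assume that there is $\alpha>d$ such that $$\lim_{r\to\infty}\frac{f(rt)}{f(r)}=t^{-\alpha}\quad\text{for all } t>0.$$ Let $(R_n)_{n\ge1}$ be a deterministic sequence with $R_n\to\infty$ and $nf(R_n)\to\xi$ as $n\to\infty$, for some $\xi\in(0,\infty)$. Let $h$ satisfy (H1)–(H4) (see context) and let $\chi_n(t)$ be the Euler characteristic process defined in the context. Then, as $n\to\infty$, $$\Big(\frac{\chi_n(t)}{R_n^d},\ t\ge0\Big)\to\Big(\sum_{k=0}^\infty(-1)^k s_k(t),\ t\ge 0\Big)\quad\text{almost surely in } D[0,\infty)$$ equipped with the uniform topology (i.e. almost surely $\sup_{t\in[0,T]}\big|R_n^{-d}\chi_n(t)-\sum_{k\ge0}(-1)^ks_k(t)\big|\to0$ for every $T<\infty$), where $s_0(t)\equiv s_{d-1}\xi/(\alpha-d)$ and for $k\ge1$ $$s_k(t):=\frac{s_{d-1}\,\xi^{k+1}}{(k+1)!\,\big(\alpha(k+1)-d\big)}\int_{(\mathbb{R}^d)^k}h_t(0,y_1,\dots,y_k)\,\mathrm{d}y_1\cdots\mathrm{d}y_k .$$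
   Context: Notation: $\|\cdot\|$ is the Euclidean norm, $B(x,r)$ the open Euclidean ball, $S^{d-1}$ the unit sphere, $\omega_d$ the Lebesgue measure of the unit ball and $s_{d-1}=d\omega_d$ the surface area of $S^{d-1}$. $\mathcal F(\mathbb{R}^d)$ is the collection of non-empty finite subsets of $\mathbb{R}^d$; for $\mathcal X=\{x_1,\dots,x_m\}$ write $h(\mathcal X)=h(x_1,\dots,x_m)$ and $a\mathcal X=\{ax_1,\dots,ax_m\}$. The function $h:\mathcal F(\mathbb{R}^d)\to\{0,1\}$ satisfies: (H1) $h(\mathcal X)\le h(\mathcal Y)$ whenever $\mathcal Y\subset\mathcal X$; (H2) $h(\mathcal X+y)=h(\mathcal X)$ for all $\mathcal X$ and $y\in\mathbb{R}^d$; (H3) there is $c>0$ such that $h(\mathcal X)=0$ whenever $\max_{x,y\in\mathcal X}\|x-y\|>c$; (H4) with $h_t(\mathcal X):=h(t^{-1}\mathcal X)$ for $t>0$, one has $h_s(\mathcal X)\le h_t(\mathcal X)$ for all $\mathcal X$ and $0< s\le t$; $h_0$ is the pointwise limit of $h_t$ as $t\downarrow 0$. Also (implicitly assumed in the paper) $h(\{x\})=1$ for every single point $x$. Examples: $h(\mathcal X)=\mathbf 1\{\mathrm{diam}(\mathcal X)\le1\}$ (Vietoris–Rips) and $h(\mathcal X)=\mathbf 1\{\bigcap_{x\in\mathcal X}\bar B(x,1/2)\ne\emptyset\}$ (Čech). With $\mathcal X_n=\{X_1,\dots,X_n\}$, the $k$-simplex count is $$S_{k,n}(t)=\sum_{\mathcal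 Y\subset\mathcal X_n,\ |\mathcal Y|=k+1}h_t(\mathcal Y)\,\mathbf 1\{\min_{y\in\mathcal Y}\|y\|\ge R_n\},$$ and the Euler characteristic process is $\chi_n(t)=\sum_{k=0}^\infty(-1)^kS_{k,n}(t)$, $t\ge0$ (a finite sum a.s.). $D[0,\infty)$ is the space of right-continuous functions with left limits on $[0,\infty)$. *)

(* Defs.v *)
From HB Require Import structures.
From mathcomp Require Import all_boot all_order all_algebra.
From mathcomp Require Import all_classical all_reals all_analysis.
Set Implicit Arguments. Unset Strict Implicit. Unset Printing Implicit Defensive.
Import Order.TTheory GRing.Theory Num.Theory.
Import numFieldNormedType.Exports.
Local Open Scope classical_set_scope.
Local Open Scope ring_scope.

Section Defs.
Context {R : realType} {d : nat}.
Local Notation P := (d.-tuple R).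

Definition tadd (x y : P) : P := [tuple tnth x i + tnth y i | i < d].
Definition tscale (a : R) (x : P) : P := [tuple a * tnth x i | i < d].
Definition tzero : P := [tuple (0:R) | i < d].
Definition enorm (x : P) : R := Num.sqrt (\sum_(i < d) tnth x i ^+ 2).
End Defs.

Fixpoint iter_int {R : realType} {T : Type} (I : (T -> \bar R) -> \bar R) (n : nat)
  : (n.-tuple T -> \bar R) -> \bar R :=
  match n with
  | 0 => fun F => F [tuple]
  | n'.+1 => fun F => I (fun y => iter_int I (fun ys => F [tuple of y :: ys]))
  end.

Definition leb_int {R : realType} (d : nat) (F : d.-tuple R -> \bar R) : \bar R :=
  iter_int (fun g => (\int[@lebesgue_measure R]_x g x)%E) F.

Definition pts_of {T : Type} {n : nat} (I : {set 'I_n}) (x : 'I_n -> T) : set T :=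
  fun z => exists i, i \in I /\ z = x i.

Definition ht {R : realType} {d : nat} (h : set (d.-tuple R) -> bool) (t : R)
  (X : set (d.-tuple R)) : bool :=
  if t == 0 then `[< forall s : R, 0 < s -> h (tscale s^-1 @` X) >]
  else h (tscale t^-1 @` X).

Definition tuple_pts {T : Type} {n : nat} (x : n.-tuple T) : set T :=
  fun z => exists i, z = tnth x i.

Section Euler.
Context {R : realType} {d : nat}.
Local Open Scope classical_set_scope.
Local Open Scope ring_scope.

Definition omega_d : R :=
  fine (leb_int (fun x : d.-tuple R => (\1_[set y | enorm y < 1] x)%:E)).

(** s_{d-1} = d * omega_d : surface area of S^{d-1} *)
Definition surf : R := d%:R * omega_d.

Definition int_ht (h : set (d.-tuple R) -> bool) (k : nat) (t : R) : \bar R :=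
  iter_int (@leb_int R d)
    (fun ys : k.-tuple (d.-tuple R) =>
       ((ht h t ([set tzero] `|` tuple_pts ys))%:R : R)%:E).

Definition s_k (h : set (d.-tuple R) -> bool) (alpha xi : R) (k : nat) (t : R) : R :=
  match k with
  | 0 => surf * xi / (alpha - d%:R)
  | k'.+1 => surf * xi ^+ k.+1 / (k.+1`!%:R * (alpha * k.+1%:R - d%:R))
               * fine (int_ht h k t)
  end.

Definition euler_limit (h : set (d.-tuple R) -> bool) (alpha xi t : R) : R :=
  limn (fun N => \sum_(k < N) (-1) ^+ k * s_k h alpha xi k t).

Definition S_kn (h : set (d.-tuple R) -> bool) (X : nat -> d.-tuple R) (Rn : R)
  (k n : nat) (t : R) : R :=
  \sum_(I : {set 'I_n} | #|I| == k.+1)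
     ((ht h t (pts_of I (fun i : 'I_n => X i))
        && [forall i in I, Rn <= enorm (X i)])%:R).

Definition euler_char (h : set (d.-tuple R) -> bool) (X : nat -> d.-tuple R) (Rn : R)
  (n : nat) (t : R) : R :=
  \sum_(k < n) (-1) ^+ k * S_kn h X Rn k n t.
End Euler.

(* Main.v *)
(* Split the Euler characteristic as A_1 - A_0, where A_q counts the simplices
   with odd (q = 1) or even (q = 0) number of vertices outside the ball of radius
   R_n: unlike chi_n, each A_q is monotone in the sample size, in the radius and
   in t.  When n fr(rho) -> xi, E A_q / rho^d tends to the sum of the s_k with k of
   the matching parity (Potter bounds and Tannery's theorem), while
   Var A_q = O(rho^d), because only pairs of simplices with a common vertex
   contribute.  Along the polynomial blocks [(j + J)^(2p), (j + 1 + J)^(2p)],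
   p > alpha, the series of the R^-d converges, hence so does that of the variances
   of A_q / R^d, which gives almost sure convergence; there R_n is replaced by its
   extrema over a block, whose ratio tends to 1 since fr (a_n) / fr (b_n) -> 1
   forces a_n / b_n -> 1.  Monotonicity then fills in the blocks, and Polya's
   argument makes the convergence uniform in t. *)
Require Import Defs.
From HB Require Import structures.
From mathcomp Require Import all_boot all_order all_algebra.
From mathcomp Require Import all_classical all_reals all_analysis.
From mathcomp Require Import measurable_realfun ring lra.
Set Implicit Arguments. Unset Strict Implicit. Unset Printing Implicit Defensive.
Import Order.TTheory GRing.Theory Num.Theory.
Import numFieldNormedType.Exports.
Local Open Scope classical_set_scope.
Local Open Scope ring_scope.

(** [fr] is merely measurable, with no monotonicity or local boundedness assumed, so Potter's bounds
    rest on a uniform convergence theorem in logarithmic coordinates, proved by measure theory.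
    Every domination uses one exponent b with d < b < alpha: |x|^-b is integrable at infinity
    because b > d, and Potter's bound leaves room for it because b < alpha. In the variance, two
    simplices with a common vertex lie in a ball around it; at most 4^u pairs have a given union of
    u vertices and the binomial coefficients bring 1/u!, so the bounds add up to rho^d times an
    exponential. The exponent 2p has this origin: fr (r) >= C r^-p and n fr (R_n) -> xi force R_n >=
    c n^(1/p), so that at n of order j^(2p) the inverse radius is at most of order j^-2, summable
    already to the power one. Convergence along the blocks then follows without Borel-Cantelli,
    since the sum of the squared deviations has finite expectation. The limit is Lipschitz on
    compacts because s_k (t) = s_k (1) t^(dk). *)

Lemma tnth_cons_lift (T : Type) n (y : T) (ys : n.-tuple T) i :
  tnth [tuple of y :: ys] (lift ord0 i) = tnth ys i.
Proof. by rewrite !(tnth_nth y). Qed.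

(** * Finite powers of a sigma-finite measure *)

Definition push d d' (T1 : measurableType d) (T2 : measurableType d')
    (R : realFieldType) (m : {measure set T1 -> \bar R}) (f : T1 -> T2)
    (mf : measurable_fun setT f) : {measure set T2 -> \bar R} :=
  measure_function_pushforward__canonical__measure_function_Measure m mf.

Lemma int_push d d' (T1 : measurableType d) (T2 : measurableType d')
    (R : realType) (m : {measure set T1 -> \bar R}) (f : T1 -> T2)
    (mf : measurable_fun setT f) (F : T2 -> \bar R) :
  measurable_fun setT F -> (forall x, 0 <= F x)%E ->
  (\int[push m mf]_y F y = \int[m]_x F (f x))%E.
Proof. by move=> mF F0; rewrite [LHS](ge0_integral_pushforward mf). Qed.

Section pow_measure.
Context d (T : measurableType d) (R : realType).
Implicit Types n : nat.

Lemma measurable_tuple_cons n :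
  measurable_fun setT (fun p : T * n.-tuple T => [tuple of p.1 :: p.2]).
Proof. by apply: measurable_cons. Qed.

Lemma measurable_tuple_cons1 n (y : T) :
  measurable_fun setT (fun ys : n.-tuple T => [tuple of y :: ys]).
Proof. by apply: measurable_cons => //; exact: measurable_cst. Qed.

Lemma measurable_fun_cons n (F : n.+1.-tuple T -> \bar R) (y : T) :
  measurable_fun [set: n.+1.-tuple T] F ->
  measurable_fun [set: n.-tuple T] (fun ys => F [tuple of y :: ys]).
Proof.
move=> mF; by apply: (@measurableT_comp _ _ _ _ _ _ F) => //; exact: measurable_tuple_cons1.
Qed.

Context (mu : {sigma_finite_measure set T -> \bar R}).

Lemma prod_sigma_finite d' (U : measurableType d')
    (nu : {sigma_finite_measure set U -> \bar R}) :
  sigma_finite setT (mu \x nu)%E.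
Proof.
have /sigma_finiteP[F [TF ndF Foo]] := sigma_finiteT mu.
have /sigma_finiteP[G [TG ndG Goo]] := sigma_finiteT nu.
exists (fun n => F n `*` G n).
  rewrite -setXTT TF TG predeqE => -[x y]; split.
    move=> [/= [n _ Fnx] [k _ Gky]]; exists (maxn n k) => //; split.
    - by move: x Fnx; exact/subsetPset/ndF/leq_maxl.
    - by move: y Gky; exact/subsetPset/ndG/leq_maxr.
  by move=> [n _ []/= ? ?]; split; exists n.
move=> k; have [? ?] := Foo k; have [? ?] := Goo k.
split; first exact: measurableX.
by rewrite product_measure1E// lte_mul_pinfty// ge0_fin_numE.
Qed.

(** The iterated integrals of the statement become integrals against one measure, which opens
    Tonelli and the convergence theorems. On [n.+1]-tuples it is the image of [mu \x nu] under
    [cons], a bijection measurable both ways, so that sigma-finiteness passes to the image. *)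
Lemma tuple_measure_ex n :
  exists nu : {sigma_finite_measure set (n.-tuple T) -> \bar R},
    forall F, measurable_fun [set: n.-tuple T] F -> (forall x, 0 <= F x)%E ->
      (\int[nu]_x F x = iter_int (fun g => \int[mu]_x g x) F)%E.
Proof.
elim: n => [|n [nu nuE]].
  exists (\d_([tuple] : 0.-tuple T)) => F mF F0.
  by rewrite integral_dirac//= diracT mul1e.
pose cns := fun p : T * n.-tuple T => [tuple of p.1 :: p.2].
have mc : measurable_fun setT cns := @measurable_tuple_cons n.
pose m := push (mu \x nu)%E mc.
have sf : sigma_finite setT m.
  have [F TF Foo] := prod_sigma_finite nu.
  exists (fun i => cns @` F i).
    rewrite -image_bigcup -TF; apply/seteqP; split=> // x _.
    exists (thead x, [tuple of behead x]) => //.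
    by rewrite /cns/= -tuple_eta.
  have cinj : injective cns.
    by move=> [x xs] [y ys] /(congr1 val)/= [-> /val_inj ->].
  have pre i : cns @^-1` (cns @` F i) = F i.
    by apply/seteqP; split=> [x [y Fy /cinj <-]|x Fx]//; exists x.
  move=> i; have [mFi Fioo] := Foo i; split; last first.
    by have -> : m (cns @` F i) = (mu \x nu)%E (F i) by rewrite -[in RHS](pre i).
  (* The image under [cns] is the preimage under its inverse, head and tail, hence measurable. *)
  rewrite (_ : _ @` _ =
     (fun x : n.+1.-tuple T => (thead x, [tuple of behead x])) @^-1` (F i)).
    rewrite -[X in measurable X]setTI.
    have : measurable_fun [set: n.+1.-tuple T] (fun x => (thead x, [tuple of behead x])).
      by apply: measurable_fun_pair; [exact: measurable_tnth|exact: measurable_behead].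
    by apply.
  apply/seteqP; split=> [x [[y ys] Fy <-]|x Fx]/=.
    have -> : thead (cns (y, ys)) = y by [].
    by have -> : [tuple of behead (cns (y, ys))] = ys by exact: val_inj.
  exists (thead x, [tuple of behead x]) => //.
  by rewrite /cns/= -tuple_eta.
pose m' : {sigma_finite_measure set (n.+1.-tuple T) -> \bar R} :=
  HB.pack (Measure.sort m) (Measure_isSigmaFinite.Build _ _ _ m sf).
exists m' => F mF F0.
rewrite [LHS]ge0_integral_pushforward//=.
rewrite (fubini_tonelli1 (F \o cns))//=; last exact: measurableT_comp.
by apply: eq_integral => x _; rewrite /fubini_F -nuE//; exact: measurable_fun_cons.
Qed.

Definition pow_measure n : {sigma_finite_measure set (n.-tuple T) -> \bar R} :=
  sval (cid (tuple_measure_ex n)).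

Lemma pow_measureE n F : measurable_fun [set: n.-tuple T] F -> (forall x, 0 <= F x)%E ->
  (\int[pow_measure n]_x F x = iter_int (fun g => \int[mu]_x g x) F)%E.
Proof. by rewrite /pow_measure; case: cid => nu nuE; exact: nuE. Qed.

Lemma int_pow0 (F : 0.-tuple T -> \bar R) :
  measurable_fun [set: 0.-tuple T] F -> (forall x, 0 <= F x)%E ->
  (\int[pow_measure 0]_x F x = F [tuple])%E.
Proof. by move=> mF F0; rewrite pow_measureE. Qed.

Lemma int_powS n (F : n.+1.-tuple T -> \bar R) :
  measurable_fun [set: n.+1.-tuple T] F -> (forall x, 0 <= F x)%E ->
  (\int[pow_measure n.+1]_x F x =
   \int[mu]_y \int[pow_measure n]_ys F [tuple of y :: ys])%E.
Proof.
move=> mF F0; rewrite pow_measureE//=; apply: eq_integral => y _.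
by rewrite pow_measureE//; exact: measurable_fun_cons.
Qed.

Lemma measurable_prod_tnth n (phi : 'I_n -> T -> R) :
  (forall i, measurable_fun setT (phi i)) ->
  measurable_fun setT (fun x : n.-tuple T => \prod_(i < n) phi i (tnth x i)).
Proof.
move=> mphi; apply: measurable_prod => i _.
by apply: measurableT_comp => //; exact: measurable_tnth.
Qed.

Lemma measurable_Eprod_tnth n (phi : 'I_n -> T -> R) :
  (forall i, measurable_fun setT (phi i)) ->
  measurable_fun [set: n.-tuple T] (fun x => (\prod_(i < n) phi i (tnth x i))%:E).
Proof. by move=> mphi; apply/measurable_EFinP; exact: measurable_prod_tnth. Qed.

Lemma int_pow_prod n (phi : 'I_n -> T -> R) :
  (forall i, measurable_fun setT (phi i)) -> (forall i x, 0 <= phi i x) ->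
  (\int[pow_measure n]_x (\prod_(i < n) phi i (tnth x i))%:E =
   \prod_(i < n) \int[mu]_x (phi i x)%:E)%E.
Proof.
elim: n phi => [|n IH] phi mphi phi0.
  rewrite int_pow0 ?big_ord0//; last by move=> x; rewrite big_ord0.
  exact: measurable_Eprod_tnth.
rewrite int_powS; last 2 first.
- exact: measurable_Eprod_tnth.
- by move=> x; rewrite lee_fin prodr_ge0.
rewrite big_ord_recl.
under eq_integral => y _.
  under eq_integral => ys _.
    rewrite big_ord_recl tnth0 EFinM.
    under eq_bigr do rewrite tnth_cons_lift.
    over.
  rewrite ge0_integralZl//; last 3 first.
  - exact: (@measurable_Eprod_tnth _ (fun i => phi (lift ord0 i))).
  - by move=> ys _; rewrite lee_fin prodr_ge0.
  - by rewrite lee_fin.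
  rewrite (IH (fun i => phi (lift ord0 i)))// muleC.
  over.
rewrite ge0_integralZl//=; last 3 first.
- by apply/measurable_EFinP; exact: mphi.
- by move=> y _; rewrite lee_fin.
- by apply: prode_ge0 => i _; apply: integral_ge0 => x _; rewrite lee_fin.
by rewrite muleC.
Qed.

(** Tonelli peels off one coordinate, and with it one factor [c]. It serves translations ([c] = 1)
    and dilations, first from R to R^d, then from R^d to tuples of points. *)
Lemma int_pow_map n (psi : 'I_n -> T -> T) (c : R) :
  0 <= c ->
  (forall i, measurable_fun setT (psi i)) ->
  (forall i (F : T -> \bar R), measurable_fun setT F -> (forall x, 0 <= F x)%E ->
     \int[mu]_x F (psi i x) = c%:E * \int[mu]_x F x)%E ->
  forall F, measurable_fun [set: n.-tuple T] F -> (forall x, 0 <= F x)%E ->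
  (\int[pow_measure n]_x F [tuple psi i (tnth x i) | i < n] =
   (c ^+ n)%:E * \int[pow_measure n]_x F x)%E.
Proof.
move=> c0; elim: n psi => [|n IH] psi mpsi psiE F mF F0.
  rewrite expr0 mul1e; apply: eq_integral => x _; congr F.
  by apply: eq_from_tnth => -[].
have mmap m (p : 'I_m -> T -> T) : (forall i, measurable_fun setT (p i)) ->
    measurable_fun setT (fun x : m.-tuple T => [tuple p i (tnth x i) | i < m]).
  move=> mp; apply/measurable_fun_tnthP => i.
  rewrite (_ : _ \o _ = p i \o (@tnth _ T ^~ i)).
    by apply: measurableT_comp => //; exact: measurable_tnth.
  by apply/funext => x /=; rewrite tnth_mktuple.
rewrite int_powS//; last by apply: (@measurableT_comp _ _ _ _ _ _ F) => //; exact: mmap.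
rewrite int_powS//.
have E (y : T) (ys : n.-tuple T) : [tuple psi i (tnth [tuple of y :: ys] i) | i < n.+1] =
   [tuple of psi ord0 y :: [tuple psi (lift ord0 i) (tnth ys i) | i < n]].
  apply: eq_from_tnth => i; rewrite tnth_mktuple.
  by case: (unliftP ord0 i) => [j|] ->; rewrite ?tnth_cons_lift ?tnth_mktuple.
have IHy (y : T) : (\int[pow_measure n]_ys F [tuple psi i (tnth [tuple of y :: ys] i) | i < n.+1] =
    (c ^+ n)%:E * \int[pow_measure n]_ys F [tuple of psi ord0 y :: ys])%E.
  under eq_integral do rewrite E.
  apply: (IH (fun i => psi (lift ord0 i)) _ _
    (fun ys : n.-tuple T => F [tuple of psi ord0 y :: ys])) => //.
    by move=> i; exact: psiE.
  exact: measurable_fun_cons.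
under eq_integral do rewrite IHy.
have mG : measurable_fun setT (fun y => \int[pow_measure n]_ys F [tuple of y :: ys])%E.
  apply: (@measurable_fun_fubini_tonelli_F _ _ _ _ _ (pow_measure n)
    (fun p : T * n.-tuple T => F [tuple of p.1 :: p.2])) => //.
  by apply: (@measurableT_comp _ _ _ _ _ _ F) => //; exact: measurable_tuple_cons.
have G0 y : (0 <= \int[pow_measure n]_ys F [tuple of y :: ys])%E.
  exact: integral_ge0.
rewrite ge0_integralZl//=; last 2 first.
- exact: measurableT_comp mG (mpsi ord0).
- by rewrite lee_fin exprn_ge0.
rewrite (psiE ord0 (fun y => \int[pow_measure n]_ys F [tuple of y :: ys])%E)//.
by rewrite muleA -EFinM exprSr.
Qed.

End pow_measure.

(** * Uniqueness of finite measures on tuples *)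

Section tuple_uniq.
Context d (T : measurableType d) (R : realType) (n : nat).
Local Open Scope ereal_scope.

Definition tuple_rect (A : 'I_n -> set T) : set (n.-tuple T) :=
  [set x | forall i, A i (tnth x i)].

Lemma measurable_tuple_rect A : (forall i, measurable (A i)) ->
  measurable (tuple_rect A).
Proof.
move=> mA; rewrite (_ : tuple_rect A =
    \bigcap_(i in [set: 'I_n]) ((@tnth _ T ^~ i) @^-1` A i)).
  apply: fin_bigcap_measurable => [|i _]; first exact: finite_finset.
  by rewrite -[X in measurable X]setTI; exact: measurable_tnth.
by apply/seteqP; split=> x h i; [move=> _; exact: h|exact: (h i)].
Qed.

(** Rectangles are stable under intersection and generate the product sigma-algebra; [m1] being
    finite, the constant sequence [setT] is exhausting. *)
Lemma tuple_measure_unique (m1 m2 : {measure set (n.-tuple T) -> \bar R}) :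
  m1 setT < +oo ->
  (forall A : 'I_n -> set T, (forall i, measurable (A i)) ->
     m1 (tuple_rect A) = m2 (tuple_rect A)) ->
  forall B, measurable B -> m1 B = m2 B.
Proof.
move=> m1oo m12 B mB.
pose G := [set X | exists2 A : 'I_n -> set T, (forall i, measurable (A i))
   & X = tuple_rect A].
have GT : setT = tuple_rect (fun=> setT) by apply/seteqP; split.
apply: (@measure_unique _ R _ G (fun=> setT)) => //.
- apply/seteqP; split; last first.
    apply: smallest_sub; first exact: sigma_algebra_measurable.
    by move=> _ [A mA ->]; exact: measurable_tuple_rect.
  apply: smallest_sub; first exact: smallest_sigma_algebra.
  rewrite -bigcup_seq; apply: bigcup_sub => i _ _ [Y mY <-].
  (* A generator constrains coordinate [i] only; the other sides are full. *)
  apply: sub_gen_smallest; exists (fun j => if j == i then Y else setT).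
    by move=> j; case: ifP.
  rewrite setTI; apply/seteqP; split=> x /=; last by move/(_ i); rewrite eqxx.
  by move=> Yx j; case: ifP => // /eqP ->.
- move=> _ _ [A mA ->] [A' mA' ->]; exists (fun i => A i `&` A' i).
    by move=> i; exact: measurableI.
  by apply/seteqP; split=> x /= => [[h1 h2] i|h]; [|split=> i; case: (h i)].
- by move=> _; exists (fun=> setT).
- by apply/seteqP; split=> // x _; exists 0%N.
- by move=> _ [A mA ->]; exact: m12.
Qed.

End tuple_uniq.

(** * Lebesgue measure on R^d: translations and dilations *)

Section lebesgue.
Context (R : realType).
Local Open Scope ereal_scope.

Lemma measurable_idTR : measurable_fun [set: measurableTypeR R] (idfun : measurableTypeR R -> R).
Proof. exact: measurable_id. Qed.

Lemma lebesgue_sigma_finite :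
  sigma_finite setT (push (@lebesgue_measure R) measurable_idTR).
Proof. exact: (sigma_finiteT (@lebesgue_measure R)). Qed.

(* [lebesgue_measure] lives on [measurableTypeR R], whose measurable sets are
   those of [R] but whose display differs. *)
Lemma lebR_ex : exists m : {sigma_finite_measure set R -> \bar R},
  forall A, m A = lebesgue_measure A.
Proof.
pose m : {sigma_finite_measure set R -> \bar R} :=
  HB.pack (Measure.sort (push (@lebesgue_measure R) measurable_idTR))
    (Measure_isSigmaFinite.Build _ _ _ (push (@lebesgue_measure R) measurable_idTR)
       lebesgue_sigma_finite).
by exists m.
Qed.

Definition lebR : {sigma_finite_measure set R -> \bar R} := sval (cid lebR_ex).

Lemma lebRE A : lebR A = lebesgue_measure A.
Proof. by rewrite /lebR; case: cid => m mE; exact: mE. Qed.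

Lemma int_lebR (F : R -> \bar R) : measurable_fun setT F -> (forall x, 0 <= F x) ->
  \int[lebR]_x F x = \int[@lebesgue_measure R]_x F x.
Proof.
move=> mF F0; transitivity (\int[push (@lebesgue_measure R) measurable_idTR]_x F x).
  by apply: eq_measure_integral => A mA _; exact: lebRE.
by rewrite int_push.
Qed.

Lemma lebR_unique (m : {measure set R -> \bar R}) :
  (forall a b : R, (a < b)%R -> m `]a, b]%classic = (b - a)%:E) ->
  forall A, measurable A -> m A = lebR A.
Proof.
move=> mE A mA; rewrite lebRE; apply/esym.
have mid : measurable_fun [set: R] (idfun : R -> measurableTypeR R).
  exact: measurable_id.
apply: (@lebesgue_measure_unique R (push m mid)) => // _ [[a b] _ <-].
rewrite lebesgue_measure_itv/= lte_fin; case: ltP => ab; first by rewrite -EFinB -mE.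
have -> : push m mid `]a, b]%classic = m `]a, b]%classic by [].
by rewrite set_itv_ge ?measure0// bnd_simp -leNgt.
Qed.

Lemma int_lebR_shift (y : R) (F : R -> \bar R) :
  measurable_fun setT F -> (forall x, 0 <= F x) ->
  \int[lebR]_x F (y + x)%R = \int[lebR]_x F x.
Proof.
move=> mF F0.
have my : measurable_fun [set: R] (+%R y) by exact: measurable_funD.
transitivity (\int[push lebR my]_x F x); last first.
  apply: eq_measure_integral => A mA _; apply: lebR_unique mA => a b ab.
  have -> : push lebR my `]a, b]%classic = lebR `](a - y)%R, (b - y)%R]%classic.
    congr (lebR _); apply/seteqP; split=> x; rewrite /= !in_itv/=;
    by rewrite ltrBlDl lerBrDl.
  rewrite lebRE.
  by rewrite lebesgue_measure_itv/= lte_fin ltrD2r ab -EFinB; congr EFin; ring.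
by rewrite (int_push _ my).
Qed.

Lemma int_lebR_scale (a : R) (F : R -> \bar R) : (0 < a)%R ->
  measurable_fun setT F -> (forall x, 0 <= F x) ->
  \int[lebR]_x F (a * x)%R = (a^-1)%:E * \int[lebR]_x F x.
Proof.
move=> a0 mF F0.
have ma : measurable_fun [set: R] ( *%R a) by exact: measurable_funM.
have a0' : (0 <= a)%R by exact: ltW.
have -> : \int[lebR]_x F x = \int[mscale (NngNum a0') (push lebR ma)]_x F x.
  apply: eq_measure_integral => A mA _; apply/esym; apply: lebR_unique mA => u v uv.
  have E : push lebR ma `]u, v]%classic = ((v - u) / a)%:E.
    have -> : push lebR ma `]u, v]%classic = lebR `](u / a)%R, (v / a)%R]%classic.
      congr (lebR _); apply/seteqP; split=> x; rewrite /= !in_itv/=;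
      by rewrite ltr_pdivrMr// ler_pdivlMr// mulrC.
    rewrite lebRE.
    by rewrite lebesgue_measure_itv/= lte_fin ltr_pM2r ?invr_gt0// uv -EFinB mulrBl.
  change (a%:E * push lebR ma `]u, v]%classic = (v - u)%:E).
  by rewrite E -EFinM; congr EFin; field; rewrite gt_eqF.
rewrite ge0_integral_mscale//= muleA -EFinM mulVf ?gt_eqF// mul1e.
by rewrite (int_push _ ma).
Qed.

Context (d : nat).
Local Notation P := (d.-tuple R).

Definition lebP : {sigma_finite_measure set P -> \bar R} := pow_measure lebR d.

(** [leb_int] iterates [lebesgue_measure], while [lebP] is built on its copy [lebR]; the two are
    exchanged layer by layer, each time using that the inner integral is measurable. *)
Lemma int_iter_lebR n (F : n.-tuple R -> \bar R) :
  measurable_fun [set: n.-tuple R] F -> (forall x, 0 <= F x) ->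
  iter_int (fun g => \int[lebR]_x g x) F =
  iter_int (fun g => \int[@lebesgue_measure R]_x g x) F.
Proof.
elim: n F => [|n IH] F mF F0//=.
rewrite -int_lebR.
- by apply: eq_integral => y _; apply: IH => //; exact: measurable_fun_cons.
- apply: (eq_measurable_fun (fun y => \int[pow_measure lebR n]_ys F [tuple of y :: ys])).
    move=> y _; rewrite pow_measureE//; last exact: measurable_fun_cons.
    by apply: IH => //; exact: measurable_fun_cons.
  apply: (@measurable_fun_fubini_tonelli_F _ _ _ _ _ (pow_measure lebR n)
    (fun p : R * n.-tuple R => F [tuple of p.1 :: p.2])) => //.
  by apply: (@measurableT_comp _ _ _ _ _ _ F) => //; exact: measurable_tuple_cons.
- move=> y; rewrite -IH//; last exact: measurable_fun_cons.
  by rewrite -pow_measureE ?integral_ge0//; exact: measurable_fun_cons.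
Qed.

Lemma int_lebP (F : P -> \bar R) :
  measurable_fun [set: P] F -> (forall x, 0 <= F x) ->
  \int[lebP]_x F x = leb_int F.
Proof. by move=> mF F0; rewrite pow_measureE// int_iter_lebR. Qed.

Lemma iter_int_lebP k (F : k.-tuple P -> \bar R) :
  measurable_fun [set: k.-tuple P] F -> (forall x, 0 <= F x) ->
  \int[pow_measure lebP k]_x F x = iter_int (@leb_int R d) F.
Proof.
elim: k F => [|k IH] F mF F0; first by rewrite int_pow0.
rewrite int_powS//= int_lebP.
- by congr leb_int; apply/funext => y; rewrite IH//; exact: measurable_fun_cons.
- apply: (@measurable_fun_fubini_tonelli_F _ _ _ _ _ (pow_measure lebP k)
    (fun p : P * k.-tuple P => F [tuple of p.1 :: p.2])) => //.
  by apply: (@measurableT_comp _ _ _ _ _ _ F) => //; exact: measurable_tuple_cons.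
- by move=> y; exact: integral_ge0.
Qed.

Lemma measurable_tadd (y : P) : measurable_fun [set: P] (tadd y).
Proof.
apply/measurable_fun_tnthP => i.
rewrite (_ : _ \o _ = fun x => tnth y i + tnth x i)%R.
  by apply: measurable_funD => //; exact: measurable_tnth.
by apply/funext => x /=; rewrite tnth_mktuple.
Qed.

Lemma measurable_tscale (a : R) : measurable_fun [set: P] (tscale a).
Proof.
apply/measurable_fun_tnthP => i.
rewrite (_ : _ \o _ = fun x => a * tnth x i)%R.
  by apply: measurable_funM => //; exact: measurable_tnth.
by apply/funext => x /=; rewrite tnth_mktuple.
Qed.

Lemma measurable_enorm : measurable_fun [set: P] (@enorm R d).
Proof.
apply: (measurableT_comp (continuous_measurable_fun (@sqrt_continuous R))).
apply: measurable_sum => i; apply: measurable_funX; exact: measurable_tnth.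
Qed.

Lemma int_lebP_shift (y : P) (F : P -> \bar R) :
  measurable_fun [set: P] F -> (forall x, 0 <= F x) ->
  \int[lebP]_x F (tadd y x) = \int[lebP]_x F x.
Proof.
move=> mF F0; rewrite -[RHS]mul1e -[in RHS](expr1n R d).
rewrite -(@int_pow_map _ _ _ lebR d (fun i x => tnth y i + x)%R 1%R)//.
  by move=> i; exact: measurable_funD.
by move=> i G mG G0; rewrite int_lebR_shift ?mul1e.
Qed.

Lemma int_lebP_scale (a : R) (F : P -> \bar R) : (0 < a)%R ->
  measurable_fun [set: P] F -> (forall x, 0 <= F x) ->
  \int[lebP]_x F (tscale a x) = (a^-1 ^+ d)%:E * \int[lebP]_x F x.
Proof.
move=> a0 mF F0.
rewrite -(@int_pow_map _ _ _ lebR d (fun i x => a * x)%R a^-1%R)//.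
- by rewrite invr_ge0 ltW.
- by move=> i; exact: measurable_funM.
- by move=> i G mG G0; exact: int_lebR_scale.
Qed.

Lemma int_lebPk_shift k (y : P) (F : k.-tuple P -> \bar R) :
  measurable_fun [set: k.-tuple P] F -> (forall x, 0 <= F x) ->
  \int[pow_measure lebP k]_x F [tuple tadd y (tnth x i) | i < k] =
  \int[pow_measure lebP k]_x F x.
Proof.
move=> mF F0; rewrite -[RHS]mul1e -[in RHS](expr1n R k).
rewrite -(@int_pow_map _ _ _ lebP k (fun i => tadd y) 1%R)//.
  by move=> i; exact: measurable_tadd.
by move=> i G mG G0; rewrite int_lebP_shift ?mul1e.
Qed.

Lemma int_lebPk_scale k (a : R) (F : k.-tuple P -> \bar R) : (0 < a)%R ->
  measurable_fun [set: k.-tuple P] F -> (forall x, 0 <= F x) ->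
  \int[pow_measure lebP k]_x F [tuple tscale a (tnth x i) | i < k] =
  (a^-1 ^+ (d * k))%:E * \int[pow_measure lebP k]_x F x.
Proof.
move=> a0 mF F0; rewrite exprM.
rewrite -(@int_pow_map _ _ _ lebP k (fun i => tscale a) (a^-1 ^+ d)%R)//.
- by rewrite exprn_ge0// invr_ge0 ltW.
- by move=> i; exact: measurable_tscale.
- by move=> i G mG G0; exact: int_lebP_scale.
Qed.

Lemma enorm_ge0 (x : P) : (0 <= enorm x)%R.
Proof. exact: sqrtr_ge0. Qed.

Lemma enorm_tscale (a : R) (x : P) : (0 <= a)%R -> enorm (tscale a x) = (a * enorm x)%R.
Proof.
move=> a0; rewrite /enorm -[in RHS](ger0_norm a0) -sqrtr_sqr -sqrtrM ?sqr_ge0//.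
congr Num.sqrt; rewrite mulr_sumr; apply: eq_bigr => i _.
by rewrite tnth_mktuple exprMn.
Qed.

Lemma le_tnth_enorm (x : P) i : (`|tnth x i| <= enorm x)%R.
Proof.
rewrite -sqrtr_sqr ler_sqrt; last by rewrite sumr_ge0// => j _; exact: sqr_ge0.
by rewrite (bigD1 i)//= lerDl sumr_ge0// => j _; exact: sqr_ge0.
Qed.

End lebesgue.

(** * Dominated convergence and the uniform convergence theorem for slow variation *)

Lemma ge0_integral_fin d (T : measurableType d) (R : realType)
    (mu : {measure set T -> \bar R}) (f : T -> \bar R) :
  (forall x, 0 <= f x)%E -> (\int[mu]_x f x < +oo)%E ->
  (\int[mu]_x f x)%E \is a fin_num.
Proof. by move=> f0 foo; rewrite ge0_fin_numE// integral_ge0. Qed.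

Lemma ge0_dominated_cvg d (T : measurableType d) (R : realType)
    (mu : {measure set T -> \bar R}) (f_ : nat -> T -> R) (f g : T -> R) :
  (forall n, measurable_fun setT (f_ n)) -> measurable_fun setT f ->
  measurable_fun setT g -> (\int[mu]_x (g x)%:E < +oo)%E ->
  (forall n x, 0 <= f_ n x <= g x) ->
  {ae mu, forall x, f_ n x @[n --> \oo] --> f x} ->
  (\int[mu]_x (f x)%:E)%E \is a fin_num /\
  fine (\int[mu]_x (f_ n x)%:E)%E @[n --> \oo] --> fine (\int[mu]_x (f x)%:E)%E.
Proof.
move=> mf_ mf mg goo f_g f_f.
have g0 x : 0 <= g x by have /andP[a b] := f_g 0%N x; exact: le_trans b.
have ig : mu.-integrable setT (EFin \o g).
  apply/integrableP; split; first exact/measurable_EFinP.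
  by under eq_integral do rewrite /= ger0_norm//.
have c1 : {ae mu, forall x, [set: T] x -> (f_ n x)%:E @[n --> \oo] --> (f x)%:E}.
  by apply: filterS f_f => x fx _; apply: cvg_EFin; [exact: nearW|exact: fx].
have c2 : {ae mu, forall x n, [set: T] x -> (`|(f_ n x)%:E| <= (EFin \o g) x)%E}.
  by apply: aeW => x n _ /=; rewrite lee_fin ger0_norm; have /andP[] := f_g n x.
have [|| iF _ cF] := dominated_convergence measurableT _ _ c1 ig c2.
- by move=> n; exact/measurable_EFinP.
- exact/measurable_EFinP.
have fin : (\int[mu]_x (f x)%:E)%E \is a fin_num by exact: integrable_fin_num.
by split=> //; apply: fine_cvg; rewrite fineK//; exact: cF.
Qed.

Section uniform_convergence.
Context (R : realType) (G : R -> R).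
Hypothesis mG : measurable_fun setT G.
Hypothesis G0 : forall u, G (x + u) - G x @[x --> +oo] --> (0 : R).

(** A truncated absolute value: bounded, so that dominated convergence applies to any measurable
    [G], and still even and subadditive. *)
Let phi (z : R) := Num.min 1 `|z|.

Let phi_le1 z : phi z <= 1. Proof. by rewrite /phi ge_min lexx. Qed.
Let phi_ge0 z : 0 <= phi z. Proof. by rewrite /phi le_min ler01/=. Qed.
Let phiN z : phi (- z) = phi z. Proof. by rewrite /phi normrN. Qed.
Let phiD x y : phi (x + y) <= phi x + phi y.
Proof.
rewrite /phi; have := ler_normD x y; have := normr_ge0 x; have := normr_ge0 y.
by rewrite !minEle; do 3 case: ifP => ?; lra.
Qed.

Let mphi (f : R -> R) : measurable_fun setT f -> measurable_fun setT (phi \o f).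
Proof.
move=> mf; apply: measurable_minr; first exact: measurable_cst.
exact: measurableT_comp.
Qed.

(* Steinhaus-type argument: the integral of [phi (G (x + l) - G x)] over
   [l \in [0, a]] tends to 0, by dominated convergence. *)
Let Psi (a x l : R) := \1_`[0, a] l * phi (G (x + l) - G x).

Let mPsi a x : measurable_fun setT (Psi a x).
Proof.
apply: measurable_funM; first exact: measurable_indic.
apply: mphi; apply: measurable_funB => //.
apply: (measurableT_comp mG); exact: measurable_funD.
Qed.

Let Psi_ge0 a x l : 0 <= Psi a x l.
Proof. by rewrite mulr_ge0// indicE ler0n. Qed.

Let int_Psi_fin (a x : R) : 0 <= a -> (\int[lebR R]_l (Psi a x l)%:E)%E \is a fin_num.
Proof.
move=> a0; apply: ge0_integral_fin => [l|]; first by rewrite lee_fin.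
apply: (@le_lt_trans _ _ (\int[lebR R]_l (\1_`[0, a] l)%:E)%E).
  apply: ge0_le_integral => //.
  - by move=> l _; rewrite lee_fin.
  - exact/measurable_EFinP.
  - by apply/measurable_EFinP; exact: measurable_indic.
  - by move=> l _; rewrite lee_fin ler_piMr// indicE ler0n.
rewrite integral_indic//= setIT lebRE lebesgue_measure_itv/=.
by case: ifP => _; rewrite ?ltry// -EFinB ltry.
Qed.

Let int_Psi_cvg (a : R) (x_ : nat -> R) : 0 <= a -> x_ n @[n --> \oo] --> +oo ->
  fine (\int[lebR R]_l (Psi a (x_ n) l)%:E)%E @[n --> \oo] --> (0 : R).
Proof.
move=> a0 xoo.
have goo : (\int[lebR R]_l (\1_`[0%R, a] l)%:E < +oo)%E.
  rewrite integral_indic//= setIT lebRE lebesgue_measure_itv/=.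
  by case: ifP => _; rewrite ?ltry// -EFinB ltry.
have := @ge0_dominated_cvg _ _ _ (lebR R) (fun n => Psi a (x_ n)) (cst 0) (\1_`[0, a])
  (fun n => @mPsi a (x_ n)) (measurable_cst _) (measurable_indic (measurable_itv _)) goo.
rewrite integral0/=; case=> //.
- by move=> n l; rewrite Psi_ge0/= ler_piMr// indicE ler0n.
- apply: aeW => l.
  apply: (@squeeze_cvgr _ _ _ _ (cst 0) (fun n => `|G (x_ n + l) - G (x_ n)|)).
  + apply: nearW => n; rewrite Psi_ge0/=.
    apply: (@le_trans _ _ (phi (G (x_ n + l) - G (x_ n)))).
      by rewrite ler_piMl// indicE lern1 leq_b1.
    by rewrite /phi ge_min lexx orbT.
  + exact: cvg_cst.
  + rewrite -(normr0 R); apply: cvg_norm.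
    exact: (cvg_comp _ _ xoo (G0 l)).
Qed.

(** Were it false, there would be x_n -> +oo and u_n in [0, 1] with increments above [eps]. Put y_n
    = x_n + u_n. For each l in [0, 1], subadditivity gives min (1, eps) <= phi (G (y_n + l) - G x_n)
    + phi (G (y_n + l) - G y_n), and integrating in l contradicts the convergence of both integrals
    to 0. *)
Lemma uniform_slow_variation (eps : R) : 0 < eps ->
  exists X : R, forall x u, X <= x -> 0 <= u <= 1 -> `|G (x + u) - G x| <= eps.
Proof.
move=> eps0; apply/not_existsP => H.
have {H} /choice[xu xuP] : forall n : nat, exists p : R * R,
    [/\ n%:R <= p.1, 0 <= p.2 <= 1 & eps < `|G (p.1 + p.2) - G p.1|].
  move=> n; have /existsNP[x /existsNP[u]] := H n%:R.
  move=> /not_implyP[nx /not_implyP[u01 /negP]]; rewrite -ltNge => h.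
  by exists (x, u).
pose x_ n := (xu n).1; pose y_ n := (xu n).1 + (xu n).2.
have xoo : x_ n @[n --> \oo] --> +oo.
  apply/cvgryPge => A; near=> n.
  have [nx _ _] := xuP n; apply: le_trans nx.
  by near: n; exact: nbhs_infty_ger.
have yoo : y_ n @[n --> \oo] --> +oo.
  apply/cvgryPge => A; near=> n.
  have [nx /andP[u0 _] _] := xuP n; rewrite /y_.
  have An : A <= n%:R by near: n; exact: nbhs_infty_ger.
  by move: nx u0 An; lra.
(* [phi] never exceeds 1, hence the truncation of [eps]. *)
pose e := Num.min 1 eps.
have e0 : 0 < e by rewrite lt_min ltr01.
have c1 := @int_Psi_cvg 2 _ (ler0n _ _) xoo.
have c2 := @int_Psi_cvg 1 _ ler01 yoo.
have e20 : 0 < e / 2 by rewrite divr_gt0.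
have h1 : \forall n \near \oo, fine (\int[lebR R]_l (Psi 2 (x_ n) l)%:E)%E < e / 2.
  exact: (cvgr_lt 0).
have h2 : \forall n \near \oo, fine (\int[lebR R]_l (Psi 1 (y_ n) l)%:E)%E < e / 2.
  exact: (cvgr_lt 0).
have [n [n1 n2]] := filter_ex (filterI h1 h2).
have [_ /andP[u0 u1] xue] := xuP n.
(* After the translation by u_n the first integrand is evaluated at u_n + l, which stays in [0, 2]
   for l in [0, 1]; hence [Psi 2]. *)
have shiftE : (\int[lebR R]_l (Psi 2 (x_ n) l)%:E =
    \int[lebR R]_l (Psi 2 (x_ n) ((xu n).2 + l))%:E)%E.
  rewrite (@int_lebR_shift _ _ (fun l => (Psi 2 (x_ n) l)%:E))//.
    exact/measurable_EFinP.
  by move=> l; rewrite lee_fin.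
suff : (e%:E <= \int[lebR R]_l (Psi 2 (x_ n) l)%:E + \int[lebR R]_l (Psi 1 (y_ n) l)%:E)%E.
  rewrite -[X in (_ <= X + _)%E]fineK ?int_Psi_fin// -[X in (_ <= _ + X)%E]fineK ?int_Psi_fin//.
  by rewrite -EFinD lee_fin; move: n1 n2; lra.
rewrite shiftE -ge0_integralD//; last 4 first.
- by move=> l _; rewrite lee_fin.
- apply/measurable_EFinP; apply: (measurableT_comp (mPsi _ _)); exact: measurable_funD.
- by move=> l _; rewrite lee_fin.
- exact/measurable_EFinP.
have <- : (\int[lebR R]_l (e * \1_`[0, 1] l)%:E = e%:E)%E.
  under eq_integral do rewrite EFinM.
  rewrite ge0_integralZl//; last 2 first.
  - by apply/measurable_EFinP; exact: measurable_indic.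
  - by rewrite lee_fin ltW.
  rewrite integral_indic//= setIT lebRE lebesgue_measure_itv/= lte_fin ltr01.
  by rewrite -EFinB subr0 mule1.
apply: ge0_le_integral => //.
- by move=> l _; rewrite lee_fin mulr_ge0 ?indicE ?ler0n// ltW.
- apply/measurable_EFinP; apply: measurable_funM => //; exact: measurable_indic.
- apply: emeasurable_funD; apply/measurable_EFinP => //.
  by apply: (measurableT_comp (mPsi _ _)); exact: measurable_funD.
- move=> l _; rewrite -EFinD lee_fin /Psi !indicE !mem_setE.
  have [/= l01|l01] := boolP (l \in `[0, 1]); last first.
    by rewrite mulr0 mul0r addr0 mulr_ge0 ?ler0n.
  move: l01; rewrite in_itv/= => /andP[l0 l1].
  have -> : (xu n).2 + l \in `[0, 2] by rewrite in_itv/=; apply/andP; split; lra.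
  rewrite !mul1r mulr1.
  apply: (@le_trans _ _ (phi (G (y_ n) - G (x_ n)))).
    rewrite /e /phi le_min ge_min lexx/= ge_min; apply/orP; right.
    by rewrite ltW.
  have E : G (y_ n) - G (x_ n) = (G (x_ n + ((xu n).2 + l)) - G (x_ n)) +
      - (G (y_ n + l) - G (y_ n)) by rewrite /y_ /x_ addrA; ring.
  by rewrite E; apply: (le_trans (phiD _ _)); rewrite phiN.
Unshelve. all: by end_near.
Qed.

End uniform_convergence.

(** * Regular variation: Potter's bounds and their consequences *)

Lemma cvgry_near_ge (R : realType) (T : Type) (F : set_system T) {FF : Filter F}
    (f : T -> R) : f x @[x --> F] --> +oo -> forall A, \forall x \near F, A <= f x.
Proof. by move/cvgryPge. Qed.

Lemma cvgr_near_dist (R : realType) (T : Type) (F : set_system T) {FF : Filter F}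
    (f : T -> R) (l : R) : f x @[x --> F] --> l ->
  forall e, 0 < e -> \forall x \near F, `|f x - l| <= e.
Proof.
move=> /cvgrPdist_le fl e /fl; apply: filterS => x; by rewrite distrC.
Qed.

Section potter.
Context (R : realType) (fr : R -> R) (alpha : R).
Hypothesis mfr : measurable_fun setT fr.
Hypothesis fr_ge0 : forall r, 0 <= r -> 0 <= fr r.
Hypothesis fr_rv : forall t, 0 < t ->
  (fun r => fr (r * t) / fr r) r @[r --> +oo] --> t `^ (- alpha).

(** The ratio at t = 1 tends to 1, whereas it is 0 at every zero of [fr], since division by 0 yields
    0. *)
Lemma rv_gt0 : exists2 r0 : R, 0 < r0 & forall r, r0 <= r -> 0 < fr r.
Proof.
have := fr_rv ltr01; rewrite powR1 => /cvgrPdist_lt/(_ _ ltr01)[M [_ MP]].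
exists (Num.max 1 (M + 1)); first by rewrite lt_max ltr01.
move=> r; rewrite ge_max => /andP[r1 rM].
rewrite lt_neqAle fr_ge0 ?andbT; last by rewrite (le_trans ler01).
apply/eqP => f0; have := MP r; rewrite -f0 invr0 mulr0 subr0 normr1 ltxx.
by move=> H; have : false by apply: H; move: rM; lra.
Qed.

(** In logarithmic coordinates, with the power r^-alpha divided out, regular variation of [fr] says
    that the increments of [G] over fixed distances tend to 0. *)
Let G x := ln (fr (expR x)) + alpha * x.

Let mG : measurable_fun setT G.
Proof.
apply: measurable_funD; last exact: measurable_funM.
apply: (measurableT_comp (@measurable_ln R)).
exact: (measurableT_comp mfr (@measurable_expR R)).
Qed.

Lemma cvgy_expR : expR x @[x --> (+oo : set_system R)] --> (+oo : set_system R).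
Proof.
apply/cvgryPge => A; near=> x.
have Ax : A <= x by near: x; apply: nbhs_pinfty_ge; exact: num_real.
by have := expR_ge1Dx x; move: Ax; lra.
Unshelve. all: by end_near.
Qed.

Let G0 u : G (x + u) - G x @[x --> +oo] --> (0 : R).
Proof.
have [r0 r00 fpos] := rv_gt0.
have c1 : fr (expR x * expR u) / fr (expR x) @[x --> +oo] --> expR u `^ (- alpha).
  exact: (cvg_comp _ _ cvgy_expR (fr_rv (expR_gt0 u))).
have c2 : ln (fr (expR x * expR u) / fr (expR x)) + alpha * u @[x --> +oo] -->
    ln (expR u `^ (- alpha)) + alpha * u.
  apply: cvgD; last exact: cvg_cst.
  by apply: (continuous_cvg _ _ c1); apply: continuous_ln; rewrite powR_gt0// expR_gt0.
have E : ln (expR u `^ (- alpha)) + alpha * u = 0.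
  by rewrite ln_powR expRK; ring.
rewrite E in c2; apply: cvg_trans c2; apply: near_eq_cvg; near=> x.
have f1 : 0 < fr (expR x).
  apply: fpos; near: x; exact: cvgry_near_ge cvgy_expR r0.
have f2 : 0 < fr (expR x * expR u).
  apply: fpos; rewrite -ler_pdivrMr ?expR_gt0//.
  near: x; exact: cvgry_near_ge cvgy_expR (r0 / expR u).
rewrite ln_div// /G expRD; ring.
Unshelve. all: by end_near.
Qed.

(** A distance u on the logarithmic scale is covered by at most u + 1 steps of length at most 1,
    each costing at most [delta]. The bound is symmetric in [r] and [r'], so their order does not
    matter. *)
Lemma potter_bound (delta : R) : 0 < delta -> exists r0 : R, [/\ 0 < r0,
  (forall r, r0 <= r -> 0 < fr r) &
  forall r r', r0 <= r -> r0 <= r' ->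
    `|ln (fr r') - ln (fr r) + alpha * (ln r' - ln r)|
      <= delta * (`|ln r' - ln r| + 1)].
Proof.
move=> d0; have [X XP] := uniform_slow_variation mG G0 d0.
have [r1 r10 fpos] := rv_gt0.
have step (n : nat) x u : X <= x -> n%:R <= u <= n.+1%:R ->
    `|G (x + u) - G x| <= delta * n.+1%:R.
  elim: n x u => [|n IH] x u Xx /andP[nu un].
    by rewrite mulr1; apply: XP => //; rewrite nu un.
  have e1 : n.+1%:R = n%:R + 1 :> R by rewrite natr1.
  have e2 : n.+2%:R = n.+1%:R + 1 :> R by rewrite natr1.
  have h1 : `|G (x + 1) - G x| <= delta by apply: XP => //; rewrite ler01 lexx.
  have h2 : `|G ((x + 1) + (u - 1)) - G (x + 1)| <= delta * n.+1%:R.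
    apply: IH; first by move: Xx; lra.
    by move: nu un; rewrite e2 e1 => a b; apply/andP; split; lra.
  have E : G (x + u) - G x = (G ((x + 1) + (u - 1)) - G (x + 1)) + (G (x + 1) - G x).
    have -> : (x + 1) + (u - 1) = x + u by ring.
    by ring.
  rewrite E; apply: (le_trans (ler_normD _ _)).
  by rewrite e2 mulrDr mulr1 lerD.
have key x u : X <= x -> 0 <= u -> `|G (x + u) - G x| <= delta * (u + 1).
  move=> Xx u0.
  have /andP[t1 t2] := truncn_itv u0.
  apply: (le_trans (step (Num.truncn u) x u Xx _)); first by rewrite t1 ltW.
  by rewrite ler_pM2l// -natr1 lerD2r.
pose r0 := Num.max r1 (expR X).
have r0P r : r0 <= r -> [/\ 0 < r, 0 < fr r & X <= ln r].
  rewrite ge_max => /andP[a b]; have rp : 0 < r by exact: lt_le_trans a.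
  split=> //; first exact: fpos.
  by rewrite -ler_expR lnK.
have main r r' : r0 <= r -> r0 <= r' -> r <= r' ->
    `|ln (fr r') - ln (fr r) + alpha * (ln r' - ln r)| <= delta * (`|ln r' - ln r| + 1).
  move=> /r0P[p f X1] /r0P[p' f' X1'] rr'.
  have l : 0 <= ln r' - ln r by rewrite subr_ge0 ler_ln.
  rewrite (ger0_norm l); have := key _ _ X1 l.
  rewrite (addrC (ln r)) subrK /G !lnK//.
  by congr (`|_| <= _); ring.
exists r0; split; first by rewrite lt_max r10.
  by move=> r /r0P[].
move=> r r' h h'; case: (leP r r') => [|/ltW] rr'; first exact: main.
rewrite (distrC (ln r')).
have -> : ln (fr r') - ln (fr r) + alpha * (ln r' - ln r) =
  - (ln (fr r) - ln (fr r') + alpha * (ln r - ln r')) by ring.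
by rewrite normrN; exact: main.
Qed.

Lemma ln_cvg1 (x_ : nat -> R) : x_ n @[n --> \oo] --> (1 : R) ->
  ln (x_ n) @[n --> \oo] --> (0 : R).
Proof.
move=> c; rewrite -(@ln1 R).
by apply: (continuous_cvg _ _ c); exact: continuous_ln.
Qed.

(** The hypothesis of regular variation concerns a fixed [t]. Along t_n -> t, Potter's bound still
    controls the ratio, because |ln t_n| stays bounded. *)
Lemma rv_ratio_cvg (rho t_ : nat -> R) (t : R) : rho n @[n --> \oo] --> +oo ->
  0 < t -> t_ n @[n --> \oo] --> t ->
  fr (rho n * t_ n) / fr (rho n) @[n --> \oo] --> t `^ (- alpha).
Proof.
move=> roo t0 ct.
have clt : ln (t_ n) @[n --> \oo] --> ln t.
  by apply: (continuous_cvg _ _ ct); exact: continuous_ln.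
have tpos : \forall n \near \oo, t / 2 < t_ n.
  by apply: (cvgr_gt t) => //; move: t0; lra.
have c1 : ln (fr (rho n * t_ n) / fr (rho n)) + alpha * ln (t_ n) @[n --> \oo] --> (0 : R).
  apply/cvgrPdist_le => e e0.
  (* [B + 1] dominates the factor |ln t_n| + 1 of Potter's bound, whence the choice delta = e / (B +
     1). *)
  pose B := `|ln t| + 1.
  have B0 : 0 < B + 1 by rewrite /B; have := normr_ge0 (ln t); lra.
  have [r0 [r00 fp P]] := potter_bound (divr_gt0 e0 B0).
  have lnB : \forall n \near \oo, `|ln (t_ n)| < B.
    by apply: (cvgr_lt `|ln t|); [exact: cvg_norm|rewrite /B ltrDl].
  near=> n.
  have t2 : t / 2 < t_ n by near: n.
  have tn0 : 0 < t_ n by move: t0 t2; lra.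
  have h1 : r0 <= rho n by near: n; exact: cvgry_near_ge roo r0.
  have rp : 0 < rho n by exact: lt_le_trans h1.
  have h2 : r0 <= rho n * t_ n.
    have : r0 / (t / 2) <= rho n by near: n; exact: cvgry_near_ge roo _.
    rewrite ler_pdivrMr ?divr_gt0// => h; apply: (le_trans h).
    by rewrite ler_pM2l// ltW.
  have := P _ _ h1 h2; rewrite lnM// (addrC (ln (rho n))) addrK.
  rewrite sub0r normrN -ln_div ?posrE ?fp//.
  move=> /le_trans; apply.
  rewrite -[leRHS](@divfK _ (B + 1)) ?gt_eqF// ler_pM2l ?divr_gt0//.
  by rewrite lerD2r ltW//; near: n.
have c2 : ln (fr (rho n * t_ n) / fr (rho n)) @[n --> \oo] --> - alpha * ln t.
  have -> : - alpha * ln t = 0 - alpha * ln t by ring.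
  rewrite (_ : (fun n => ln (_ / _)) = fun n =>
    (ln (fr (rho n * t_ n) / fr (rho n)) + alpha * ln (t_ n)) - alpha * ln (t_ n)).
    by apply: cvgB => //; apply: cvgM => //; exact: cvg_cst.
  by apply/funext => n; ring.
rewrite -(lnK (_ : t `^ (- alpha) \in Num.pos)) ?posrE ?powR_gt0//.
rewrite ln_powR.
have c3 : expR (ln (fr (rho n * t_ n) / fr (rho n))) @[n --> \oo] --> expR (- alpha * ln t).
  by apply: (continuous_cvg _ _ c2); exact: continuous_expR.
apply: cvg_trans c3; apply: near_eq_cvg.
have [r0 r00 fp] := rv_gt0; near=> n.
have h1 : r0 <= rho n by near: n; exact: cvgry_near_ge roo r0.
have rp : 0 < rho n by exact: lt_le_trans h1.
have t2 : t / 2 < t_ n by near: n.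
have h2 : r0 <= rho n * t_ n.
  have : r0 / (t / 2) <= rho n by near: n; exact: cvgry_near_ge roo _.
  rewrite ler_pdivrMr ?divr_gt0// => h; apply: (le_trans h).
  by rewrite ler_pM2l// ltW.
by rewrite lnK// posrE divr_gt0// fp.
Unshelve. all: by end_near.
Qed.

(** Potter's bound with delta = alpha - b, at the cost of the constant exp (alpha - b). It supplies
    the dominating functions. *)
Lemma rv_upper_bound (b : R) : b < alpha -> exists r0 C : R, [/\ 0 < r0, 0 < C,
  (forall r, r0 <= r -> 0 < fr r) &
  forall r t, r0 <= r -> 1 <= t -> fr (r * t) / fr r <= C * t `^ (- b)].
Proof.
move=> ba; have d0 : 0 < alpha - b by rewrite subr_gt0.
have [r0 [r00 fp P]] := potter_bound d0.
exists r0, (expR (alpha - b)); split => //; first exact: expR_gt0.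
move=> r t rr t1; have t0 : 0 < t by exact: lt_le_trans t1.
have rp : 0 < r by exact: lt_le_trans rr.
have rrt : r0 <= r * t by rewrite (le_trans rr)// ler_peMr// ltW.
have := P _ _ rr rrt; rewrite lnM// (addrC (ln r)) addrK.
rewrite -ln_div ?posrE ?fp// (ger0_norm (ln_ge0 t1)).
rewrite ler_norml => /andP[_ h].
have f1 : 0 < fr (r * t) / fr r by rewrite divr_gt0// fp.
rewrite -[leLHS]lnK ?posrE// -[t `^ _]lnK ?posrE ?powR_gt0// -expRD ler_expR ln_powR.
by move: h; lra.
Qed.

(** Potter's bound with delta = p - alpha, taken between the fixed radius [r0] and [r]. It will
    force the radii R_n to grow at least like a power of n. *)
Lemma rv_lower_bound (p : R) : alpha < p -> exists r0 C : R, [/\ 0 < r0, 0 < C &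
  forall r, r0 <= r -> C <= fr r * r `^ p].
Proof.
move=> ap; have d0 : 0 < p - alpha by rewrite subr_gt0.
have [r0 [r00 fp P]] := potter_bound d0.
exists r0, (expR (ln (fr r0) + p * ln r0 - (p - alpha))); split => //.
  exact: expR_gt0.
move=> r rr; have rp : 0 < r by exact: lt_le_trans rr.
have := P _ _ (lexx r0) rr; have l : 0 <= ln r - ln r0 by rewrite subr_ge0 ler_ln.
rewrite (ger0_norm l) ler_norml => /andP[h _].
have f1 : 0 < fr r by exact: fp.
rewrite -[fr r]lnK ?posrE// -[r `^ _]lnK ?posrE ?powR_gt0// -expRD ler_expR ln_powR.
by move: h; lra.
Qed.

(** [fr] need not be monotone, but it behaves like a power with the nonzero exponent -alpha, so in
    the limit ratios of values determine ratios of arguments. *)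
Lemma rv_ratio_inj (a_ b_ : nat -> R) : 0 < alpha ->
  a_ n @[n --> \oo] --> +oo -> b_ n @[n --> \oo] --> +oo ->
  fr (a_ n) / fr (b_ n) @[n --> \oo] --> (1 : R) ->
  a_ n / b_ n @[n --> \oo] --> (1 : R).
Proof.
move=> a0 aoo boo c.
have cl : ln (a_ n / b_ n) @[n --> \oo] --> (0 : R).
  apply/cvgrPdist_le => e e0.
  (* With D = ln (a / b) and L = ln (fr a / fr b), Potter gives alpha |D| <= d (|D| + 1) + |L|. The
     bound d <= alpha / 2 absorbs |D| on the left; d and |L| below alpha e / 4 then leave |D| <=
     e. *)
  pose d := Num.min (alpha / 2) (alpha * e / 4).
  have d0 : 0 < d by rewrite lt_min !divr_gt0// mulr_gt0.
  have [r0 [r00 fp P]] := potter_bound d0.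
  have ae : 0 < alpha * e / 4 by rewrite divr_gt0// mulr_gt0.
  near=> n.
  have h1 : r0 <= a_ n by near: n; exact: cvgry_near_ge aoo r0.
  have h2 : r0 <= b_ n by near: n; exact: cvgry_near_ge boo r0.
  have := P _ _ h2 h1.
  have ap : 0 < a_ n by exact: lt_le_trans h1.
  have bp : 0 < b_ n by exact: lt_le_trans h2.
  rewrite -!ln_div ?posrE ?fp//.
  have : `|ln (fr (a_ n) / fr (b_ n))| <= alpha * e / 4.
    rewrite -[X in `|X|]subr0; near: n.
    exact: cvgr_near_dist (ln_cvg1 c) _ ae.
  rewrite sub0r normrN; set L := ln (_ / _); set D := ln (_ / _) => hL hLD.
  have hD : alpha * `|D| <= `|L + alpha * D| + `|L|.
    rewrite -[alpha in leLHS]gtr0_norm// -normrM.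
    apply: le_trans (ler_normB _ _); rewrite (addrC L) addrK.
    exact: lexx.
  have d1 : d * (`|D| + 1) <= alpha / 2 * `|D| + alpha * e / 4.
    rewrite mulrDr mulr1 lerD// ?ge_min ?lexx ?orbT//.
    by rewrite ler_wpM2r// ge_min lexx.
  rewrite -(ler_pM2l a0); move: hL hLD hD d1; lra.
rewrite -(@expR0 R); have c3 : expR (ln (a_ n / b_ n)) @[n --> \oo] --> expR (0 : R).
  by apply: (continuous_cvg _ _ cl); exact: continuous_expR.
apply: cvg_trans c3; apply: near_eq_cvg; near=> n.
have ap : 0 < a_ n by apply: (lt_le_trans ltr01); near: n; exact: cvgry_near_ge aoo 1.
have bp : 0 < b_ n by apply: (lt_le_trans ltr01); near: n; exact: cvgry_near_ge boo 1.
by rewrite lnK// posrE divr_gt0.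
Unshelve. all: by end_near.
Qed.

End potter.

(** * Volumes of balls and the integral of a radial power *)

(** Let x tend to 0. Exact integrals are obtained below by dilating with [expR x], whose
    multiplicative error disappears in this way. *)
Lemma le_expR_lim (R : realType) (A B C : R) :
  (forall x, 0 < x -> A <= B * expR (C * x)) -> A <= B.
Proof.
move=> h.
have c : B * expR (C * n.+1%:R^-1) @[n --> \oo] --> B.
  have e : B = B * expR (C * 0) by rewrite mulr0 expR0 mulr1.
  rewrite [X in _ --> X]e.
  have c0 : C * n.+1%:R^-1 @[n --> \oo] --> C * 0.
    by apply: cvgM; [exact: cvg_cst|exact: cvg_harmonic].
  apply: cvgM; first exact: cvg_cst.
  by apply: (continuous_cvg _ _ c0); exact: continuous_expR.
apply: (cvgr_to_ge c); apply: nearW => n; apply: h.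
by rewrite invr_gt0.
Qed.

Section balls.
Context (R : realType) (d : nat).
Local Notation P := (d.-tuple R).
Local Notation mu := (lebP R d).

Lemma measurable_radial (S : set R) : measurable S ->
  measurable [set x : P | S (enorm x)].
Proof.
by move=> mS; rewrite -[X in measurable X]setTI; exact: measurable_enorm.
Qed.

Lemma measurable_ball (r : R) : measurable [set x : P | (enorm x < r)%R].
Proof.
have -> : [set x : P | (enorm x < r)%R] = [set x : P | `]-oo, r[%classic (enorm x)].
  by apply/seteqP; split=> x /=; rewrite in_itv.
exact: measurable_radial.
Qed.

Lemma integralT_indic d' (T : measurableType d') (m : {measure set T -> \bar R})
    (A : set T) : measurable A -> (\int[m]_x (\1_A x)%:E = m A)%E.
Proof. by move=> mA; rewrite integral_indic// setIT. Qed.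

Lemma int_lebP_indic (A : set P) : measurable A ->
  (\int[mu]_x (\1_A x)%:E = mu A)%E.
Proof. exact: integralT_indic. Qed.

Lemma unit_ball_fin : (mu [set x : P | (enorm x < 1)%R] < +oo)%E.
Proof.
pose I1 : set R := `[-1, 1]%classic.
have mI : measurable I1 by exact: measurable_itv.
have mi : measurable_fun [set: R] (\1_I1 : R -> R) by exact: measurable_indic.
rewrite -integralT_indic; last exact: measurable_ball.
apply: (@le_lt_trans _ _ (\int[mu]_x (\prod_(i < d) \1_I1 (tnth x i))%:E)%E).
  apply: ge0_le_integral => //.
  - by apply/measurable_EFinP; apply: measurable_indic; exact: measurable_ball.
  - exact: (@measurable_Eprod_tnth _ _ R d (fun=> \1_I1)).
  - move=> x _; rewrite lee_fin indicE; have [|_] := boolP (x \in [set x : P | (enorm x < 1)%R]); last first.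
      by rewrite prodr_ge0// => i _; rewrite indicE ler0n.
    rewrite inE/= => x1; rewrite big1// => i _; rewrite indicE mem_set// /I1/=.
    have := le_tnth_enorm x i; rewrite ler_norml in_itv/= => /andP[h1 h2].
    by apply/andP; split; move: h1 h2 x1; lra.
rewrite (@int_pow_prod _ _ _ (lebR R) d (fun=> \1_I1))//.
rewrite (eq_bigr (fun=> (2:R)%:E)) ?prodEFin ?ltry// => i _.
transitivity (lebR R I1); first exact: integralT_indic.
rewrite lebRE /I1 lebesgue_measure_itv/= lte_fin ifT; last by lra.
by rewrite -EFinB; congr EFin; ring.
Qed.

Local Notation omega := (@omega_d R d).

Lemma unit_ballE : mu [set x : P | (enorm x < 1)%R] = omega%:E.
Proof.
rewrite /omega_d -int_lebP; last 2 first.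
- by apply/measurable_EFinP; apply: measurable_indic; exact: measurable_ball.
- by move=> x; rewrite lee_fin indicE ler0n.
rewrite int_lebP_indic; last exact: measurable_ball.
by rewrite fineK// ge0_fin_numE// unit_ball_fin.
Qed.

Lemma omega_ge0 : 0 <= omega.
Proof. by rewrite -lee_fin -unit_ballE. Qed.

Lemma ball_volE (r : R) : 0 < r -> mu [set x : P | (enorm x < r)%R] = (r ^+ d * omega)%:E.
Proof.
move=> r0; have := @int_lebP_scale R d r (fun x => (\1_[set x : P | (enorm x < r)%R] x)%:E) r0.
have -> : (fun x : P => (\1_[set x | (enorm x < r)%R] (tscale r x) : R)%:E) =
    (fun x => (\1_[set x : P | (enorm x < 1)%R] x)%:E).
  apply/funext => x; rewrite !indicE; congr (_%:R%:E); congr nat_of_bool.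
  by apply/idP/idP; rewrite !inE/= enorm_tscale ?ltW// gtr_pMr.
rewrite !int_lebP_indic; [|exact: measurable_ball|exact: measurable_ball].
rewrite unit_ballE => h; rewrite EFinM h; last 2 first.
- by apply/measurable_EFinP; apply: measurable_indic; exact: measurable_ball.
- by move=> x; rewrite lee_fin indicE ler0n.
by rewrite muleA -EFinM -exprMn divff ?expr1n ?mul1e// gt_eqF.
Qed.

Lemma ball_fin (r : R) : (mu [set x : P | (enorm x <= r)%R] < +oo)%E.
Proof.
apply: (@le_lt_trans _ _ (mu [set x : P | (enorm x < `|r| + 1)%R])).
  apply: le_measure; rewrite ?inE; [|exact: measurable_ball|].
    have -> : [set x : P | (enorm x <= r)%R] = [set x : P | `]-oo, r]%classic (enorm x)].
      by apply/seteqP; split=> x /=; rewrite in_itv.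
    exact: measurable_radial.
  by move=> x /=; have := ler_norm r; lra.
by rewrite ball_volE ?ltry//; have := normr_ge0 r; lra.
Qed.

Lemma annulus_volE (a : R) : 1 < a ->
  mu [set x : P | (1 <= enorm x < a)%R] = ((a ^+ d - 1) * omega)%:E.
Proof.
move=> a1; have a0 : 0 < a by lra.
have -> : [set x : P | (1 <= enorm x < a)%R] =
    [set x : P | (enorm x < a)%R] `\` [set x | (enorm x < 1)%R].
  apply/seteqP; split => x /=.
    by move=> /andP[h ->]; split=> //; apply/negP; rewrite -leNgt.
  by move=> [-> /negP]; rewrite -leNgt => ->.
have fa : (mu [set x : P | (enorm x < a)%R] < +oo)%E by rewrite ball_volE// ltry.
have -> : mu ([set x : P | (enorm x < a)%R] `\` [set x | (enorm x < 1)%R]) =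
    (mu [set x : P | (enorm x < a)%R] - mu [set x : P | (enorm x < 1)%R])%E.
  rewrite [LHS]measureD//; [|exact: measurable_ball|exact: measurable_ball].
  congr (_ - mu _)%E; apply/seteqP; split => x /= [] //; split => //; lra.
by rewrite ball_volE// unit_ballE -EFinB; congr EFin; ring.
Qed.

(** The sphere lies in the annulus between the radii 1 and e^x, of volume (e^(dx) - 1) omega, for
    every x > 0. *)
Lemma sphere_null : mu [set x : P | (enorm x = 1)%R] = 0%E.
Proof.
have mS : measurable [set x : P | (enorm x = 1)%R].
  exact: (@measurable_radial [set 1]).
have bd (x : R) : 0 < x -> (mu [set x : P | (enorm x = 1)%R] <=
    ((expR (d%:R * x) - 1) * omega)%:E)%E.
  move=> x0; have e1 : 1 < expR x by rewrite expR_gt1.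
  rewrite expRM_natl -annulus_volE//.
  apply: le_measure; rewrite ?inE//.
    have -> : [set x0 : P | (1 <= enorm x0 < expR x)%R] =
        [set x0 : P | `[1, expR x[%classic (enorm x0)].
      by apply/seteqP; split=> y /=; rewrite in_itv.
    exact: measurable_radial.
  by move=> y /= ->; rewrite lexx.
have fin : mu [set x : P | (enorm x = 1)%R] \is a fin_num.
  by rewrite ge0_fin_numE//; apply: (le_lt_trans (bd 1 ltr01)); rewrite ltry.
(* Adding [omega] on both sides gives the bound the multiplicative form that [le_expR_lim]
   expects. *)
have h : fine (mu [set x : P | (enorm x = 1)%R]) + omega <= omega.
  apply: (@le_expR_lim _ _ _ d%:R) => x x0.
  have := bd _ x0; rewrite -[X in (X <= _)%E]fineK// lee_fin; lra.
apply/eqP; rewrite eq_le measure_ge0 andbT -[X in (X <= _)%E]fineK// lee_fin.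
by move: h; lra.
Qed.

Section radial_power.
Variable b : R.
Hypothesis bd : d%:R < b.

Let b0 : 0 < b. Proof. by rewrite (le_lt_trans _ bd)// ler0n. Qed.

Let F (S : set R) (x : P) : R := \1_S (enorm x) * enorm x `^ (- b).

Let mF S : measurable S -> measurable_fun setT (F S).
Proof.
move=> mS; apply: measurable_funM.
  by apply: (measurableT_comp (measurable_indic mS)); exact: measurable_enorm.
by apply: (measurableT_comp (measurable_powR _)); exact: measurable_enorm.
Qed.

Let F0 S x : 0 <= F S x.
Proof. by rewrite mulr_ge0 ?powR_ge0// indicE ler0n. Qed.

Let I S := (\int[mu]_x (F S x)%:E)%E.

Let I_ge0 S : (0 <= I S)%E.
Proof. by apply: integral_ge0 => x _; rewrite lee_fin. Qed.

Let I_le S S' : measurable S -> measurable S' -> S `<=` S' -> (I S <= I S')%E.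
Proof.
move=> mS mS' SS'; apply: ge0_le_integral => //.
- by move=> x _; rewrite lee_fin.
- by apply/measurable_EFinP; exact: mF.
- by apply/measurable_EFinP; exact: mF.
- move=> x _; rewrite lee_fin ler_wpM2r ?powR_ge0// !indicE ler_nat.
  by case: (boolP (_ \in S)) => //; rewrite inE => /SS' h; rewrite mem_set.
Qed.

Let IU S S' : measurable S -> measurable S' -> S `&` S' = set0 ->
  I (S `|` S') = (I S + I S')%E.
Proof.
move=> mS mS' SS'; rewrite /I -ge0_integralD//.
- apply: eq_integral => x _; rewrite -EFinD /F -mulrDl; congr (_ * _)%:E.
  rewrite !indicE in_setU; have := in_setI (enorm x) S S'; rewrite SS' in_set0.
  by case: (_ \in S); case: (_ \in S') => //= _; rewrite ?addr0 ?add0r.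
- by move=> x _; rewrite lee_fin.
- by apply/measurable_EFinP; exact: mF.
- by move=> x _; rewrite lee_fin.
- by apply/measurable_EFinP; exact: mF.
Qed.

(** Dilating by e^x multiplies the volume by e^(dx) and the integrand by e^(-bx). This
    self-similarity takes the place of polar coordinates. *)
Let Iscale (x : R) (i : interval R) : 
  I ([set r | r / expR x \in i]) = ((expR ((d%:R - b) * x))%:E * I [set` i])%E.
Proof.
have e0 := expR_gt0 x; set S := [set r | _].
have mS : measurable S.
  have : measurable_fun [set: R] (fun r => r / expR x) by exact: measurable_funM.
  by move=> /(_ measurableT [set` i] (measurable_itv _)); rewrite setTI.
have := @int_lebP_scale R d (expR x) (fun y => (F S y)%:E) e0.
have -> : (fun y : P => (F S (tscale (expR x) y))%:E) =
    (fun y => (expR (- b * x))%:E * (F [set` i] y)%:E)%E.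
  apply/funext => y; rewrite -EFinM /F enorm_tscale ?ltW//.
  rewrite powRM ?enorm_ge0 ?ltW// !indicE.
  have -> : (expR x * enorm y \in S) = (enorm y \in [set` i]).
    have e : expR x * enorm y / expR x = enorm y by field; rewrite gt_eqF.
    by apply/idP/idP; rewrite !inE /S/= e.
  by rewrite -expRM (mulrC x); congr EFin; ring.
rewrite ge0_integralZl//; last 2 first.
- by apply/measurable_EFinP; exact: mF.
- by move=> y _; rewrite lee_fin.
move=> h; have {h} h : ((expR (- b * x))%:E * I [set` i] =
    ((expR x)^-1 ^+ d)%:E * I S)%E.
  apply: h; first by apply/measurable_EFinP; exact: mF.
  by move=> y; rewrite lee_fin.
rewrite mulrBl expRD expRM_natl -mulNr EFinM -muleA h muleA -EFinM -exprMn.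
by rewrite divff ?expr1n ?mul1e// gt_eqF.
Qed.

Let K u := I `[1, u[%classic.

Let omega0 := omega_ge0.

Let Kbounds (a : R) : 1 < a ->
  ((a `^ (- b) * ((a ^+ d - 1) * omega))%:E <= K a <= ((a ^+ d - 1) * omega)%:E)%E.
Proof.
move=> a1; have mA : measurable [set x : P | (1 <= enorm x < a)%R].
  have -> : [set x : P | (1 <= enorm x < a)%R] = [set x : P | `[1%R, a[%classic (enorm x)].
    by apply/seteqP; split=> y /=; rewrite in_itv.
  exact: measurable_radial.
have iE x : \1_[set x : P | (1 <= enorm x < a)%R] x = \1_`[1%R, a[ (enorm x) :> R.
  by rewrite !indicE; congr (nat_of_bool _)%:R.
rewrite EFinM -annulus_volE// -int_lebP_indic//; apply/andP; split.
- rewrite -ge0_integralZl//; last 2 first.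
  + by apply/measurable_EFinP; exact: measurable_indic.
  + by rewrite lee_fin powR_ge0.
  apply: ge0_le_integral => //.
  + by move=> x _; rewrite -EFinM lee_fin mulr_ge0 ?powR_ge0// indicE ler0n.
  + by apply/measurable_EFinP; apply: measurable_funM => //; exact: measurable_indic.
  + by apply/measurable_EFinP; exact: mF.
  + move=> x _; rewrite -EFinM lee_fin iE /F mulrC indicE.
    have [|_] := boolP (_ \in _); last by rewrite !mul0r.
    rewrite inE/= in_itv/= => /andP[x1 xa]; rewrite !mul1r.
    have x0 : 0 < enorm x by exact: lt_le_trans x1.
    have a0 : 0 < a by exact: lt_trans xa.
    rewrite !powRN lef_pV2 ?posrE ?powR_gt0//.
    by rewrite ge0_ler_powR ?nnegrE// ltW.
- apply: ge0_le_integral => //.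
  + by move=> x _; rewrite lee_fin.
  + by apply/measurable_EFinP; exact: mF.
  + by apply/measurable_EFinP; exact: measurable_indic.
  + move=> x _; rewrite lee_fin iE /F indicE.
    have [|_] := boolP (_ \in _); last by rewrite !mul0r.
    rewrite inE/= in_itv/= => /andP[x1 xa]; rewrite !mul1r.
    have x0 : 0 < enorm x by exact: lt_le_trans x1.
    rewrite powRN invf_le1 ?powR_gt0//.
    apply: (@le_trans _ _ (1 `^ b)); first by rewrite powR1.
    by rewrite ge0_ler_powR ?nnegrE// ltW.
Qed.

Let c := b - d%:R.
Let c0 : 0 < c. Proof. by rewrite /c subr_gt0. Qed.

Let Isplit x (i j : interval R) : 0 < x ->
  [set` j] = `[1, expR x[%classic `|` [set r | r / expR x \in i] ->
  (forall r, r \in i -> 1 <= r) ->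
  I [set` j] = (K (expR x) + (expR (- c * x))%:E * I [set` i])%E.
Proof.
move=> x0 -> i1; rewrite IU; first 1 last.
- exact: measurable_itv.
- have : measurable_fun [set: R] (fun r => r / expR x) by exact: measurable_funM.
  by move=> /(_ measurableT [set` i] (measurable_itv _)); rewrite setTI.
- apply/seteqP; split=> r //= []; rewrite in_itv/= => /andP[_ r1] /i1.
  by rewrite ler_pdivlMr ?expR_gt0// mul1r leNgt r1.
by rewrite Iscale; congr (_ + (expR _)%:E * _)%E; rewrite /c; ring.
Qed.

Let e1 (x : R) : 0 < x -> 1 < expR x. Proof. by move=> x0; rewrite expR_gt1. Qed.

Let Kfin a : 1 < a -> K a \is a fin_num.
Proof.
move=> a1; rewrite ge0_fin_numE ?I_ge0//.
by have /andP[_ h] := Kbounds a1; apply: (le_lt_trans h); rewrite ltry.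
Qed.

Let A := d%:R * omega / c.

(** Bounded shells come first because [J] is not yet known to be finite. Splitting [1, u e^x) at e^x
    gives K u <= K (u e^x) = K (e^x) + e^(-cx) K u, where K (e^x) is at most the volume of its
    shell. *)
Let K_le (u : R) : 1 < u -> (K u <= A%:E)%E.
Proof.
move=> u1; rewrite -(fineK (Kfin u1)) lee_fin; apply: (@le_expR_lim _ _ _ b) => x x0.
have e0 := expR_gt0 x; have ex1 := e1 x0.
have S : K (u * expR x) = (K (expR x) + (expR (- c * x))%:E * K u)%E.
  apply: Isplit => //; last by move=> r; rewrite in_itv/= => /andP[].
  apply/seteqP; split=> r /=; rewrite !in_itv/= ler_pdivlMr// mul1r ltr_pdivrMr//.
    by case: (ltP r (expR x)) => h /andP[r1 r2]; [left|right]; rewrite ?r1 ?h.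
  by case=> /andP[h1 h2]; apply/andP; split => //; nra.
have le : (K u <= K (u * expR x))%E.
  apply: I_le; try exact: measurable_itv.
  by move=> r /=; rewrite !in_itv/= => /andP[-> h]/=; nra.
have /andP[_ Kx] := Kbounds ex1.
move: le; rewrite S => le.
have {le Kx} : (K u <= ((expR x ^+ d - 1) * omega)%:E + (expR (- c * x))%:E * K u)%E.
  by apply: (le_trans le); rewrite leeD2r.
rewrite -(fineK (Kfin u1)) -EFinM -EFinD lee_fin -expRM_natl.
set k := fine _ => h.
have k0 : 0 <= k by rewrite fine_ge0 ?I_ge0.
have h1 : expR (d%:R * x) - 1 <= d%:R * x * expR (d%:R * x).
  have := expR_ge1Dx (- (d%:R * x)); rewrite expRN.
  have := expR_gt0 (d%:R * x); set E := expR _ => E0.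
  move=> /(ler_wpM2r (ltW E0)); rewrite mulVf ?gt_eqF//; lra.
have h2 : c * x * expR (- c * x) <= 1 - expR (- c * x).
  have := expR_ge1Dx (c * x); rewrite mulNr expRN.
  have := expR_gt0 (c * x); set E := expR _ => E0 h2.
  have e : (1 - E^-1) - c * x * E^-1 = (E - 1 - c * x) / E by field; rewrite gt_eqF.
  by rewrite -subr_ge0 e divr_ge0 ?(ltW E0)//; move: h2; lra.
(* By e^y - 1 <= y e^y and y e^(-y) <= 1 - e^(-y), the total error is the factor e^(dx) e^(cx) =
   e^(bx). *)
have -> : b * x = d%:R * x + c * x by rewrite /c; ring.
have cx0 : 0 < c * x by exact: mulr_gt0.
rewrite expRD /A.
have E1 := expR_gt0 (d%:R * x).
have E3 : k * (c * x * expR (- c * x)) <= d%:R * x * expR (d%:R * x) * omega.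
  apply: (@le_trans _ _ ((expR (d%:R * x) - 1) * omega)); last by rewrite ler_wpM2r.
  by apply: (le_trans (ler_wpM2l k0 h2)); move: h; lra.
have E2 := expR_gt0 (c * x).
rewrite mulNr expRN in E3.
rewrite -(ler_pM2r (_ : 0 < c * x * (expR (c * x))^-1)); last by rewrite mulr_gt0 ?invr_gt0.
apply: (le_trans E3); rewrite le_eqVlt; apply/orP; left; apply/eqP.
by field; rewrite !gt_eqF.
Qed.

Let J := I `[1, +oo[%classic.

Let JA : (J <= A%:E)%E.
Proof.
have mA (n : nat) : measurable (`[1%R, n.+2%:R[%classic : set R) by exact: measurable_itv.
have cJ : (fun n => \int[mu]_x (F `[1, n.+2%:R[%classic x)%:E)%E @ \oo --> J.
  rewrite (_ : J = \int[mu]_x limn (fun n => (F `[1, n.+2%:R[%classic x)%:E))%E.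
    apply: cvg_monotone_convergence => //.
    - by move=> n; apply/measurable_EFinP; exact: mF.
    - by move=> n x _; rewrite lee_fin.
    - move=> x _ m n mn; rewrite lee_fin ler_wpM2r ?powR_ge0// !indicE ler_nat.
      case: (boolP (_ \in `[1, m.+2%:R[%classic)) => //; rewrite inE/= in_itv/= => /andP[h1 h2].
      rewrite mem_set//= in_itv/= h1/=; apply: (lt_le_trans h2); by rewrite ler_nat.
  apply: eq_integral => x _; apply/esym/cvg_lim => //.
  apply: cvg_near_cst; near=> n; congr (_ * _)%:E; rewrite !indicE; congr (nat_of_bool _)%:R.
  have xn : enorm x < n.+2%:R.
    have : enorm x <= n%:R by near: n; exact: nbhs_infty_ger.
    by move=> /le_lt_trans; apply; rewrite ltr_nat.
  by apply/idP/idP => /set_mem/=; rewrite in_itv/= => h; apply/mem_set; rewrite /= in_itv/= ?xn;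
     move: h; rewrite ?andbT ?xn // => /andP[].
apply: (cvge_to_le cJ); apply: nearW => n; apply: K_le.
by rewrite ltr1n.
Unshelve. all: by end_near.
Qed.

(** The converse inequality comes from the same equation, J = K (e^x) + e^(-cx) J, now with the
    lower bound e^(-bx) (e^(dx) - 1) omega on K (e^x), as x tends to 0. *)
Lemma int_radial_power :
  (\int[mu]_x (\1_`[1, +oo[%classic (enorm x) * enorm x `^ (- b))%:E = A%:E)%E.
Proof.
rewrite -[LHS]/J; apply/eqP; rewrite eq_le JA/=.
have Jfin : J \is a fin_num.
  by rewrite ge0_fin_numE ?I_ge0//; apply: (le_lt_trans JA); rewrite ltry.
rewrite -(fineK Jfin) lee_fin; apply: (@le_expR_lim _ _ _ b) => x x0.
have ex1 := e1 x0; have e0 := expR_gt0 x.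
have S : J = (K (expR x) + (expR (- c * x))%:E * J)%E.
  apply: Isplit => //; last by move=> r; rewrite in_itv/= => /andP[].
  apply/seteqP; split=> r /=; rewrite !in_itv/= ler_pdivlMr// mul1r !andbT.
    by case: (ltP r (expR x)) => h r1; [left|right]; rewrite ?r1 ?h.
  by case=> [/andP[]//|h]; apply: (le_trans _ h); exact: ltW.
have /andP[Kx _] := Kbounds ex1.
have {Kx} : ((expR x `^ (- b) * ((expR x ^+ d - 1) * omega))%:E +
   (expR (- c * x))%:E * J <= J)%E by rewrite {2}S leeD2r.
rewrite -(fineK Jfin) -EFinM -EFinD lee_fin -expRM_natl.
set j := fine _ => h.
have j0 : 0 <= j by rewrite fine_ge0 ?I_ge0.
rewrite powRN -[expR x `^ b]lnK ?posrE ?powR_gt0// ln_powR expRK in h.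
have h1 : d%:R * x <= expR (d%:R * x) - 1.
  by have := expR_ge1Dx (d%:R * x); lra.
have h2 : 1 - expR (- c * x) <= c * x.
  by have := expR_ge1Dx (- c * x); lra.
have E0 := expR_gt0 (b * x).
have E3 : (expR (b * x))^-1 * (d%:R * x * omega) <= j * (c * x).
  apply: (@le_trans _ _ (j * (1 - expR (- c * x)))); last by rewrite ler_wpM2l.
  apply: (@le_trans _ _ ((expR (b * x))^-1 * ((expR (d%:R * x) - 1) * omega))).
    by rewrite ler_wpM2l ?invr_ge0 ?(ltW E0)// ler_wpM2r.
  by move: h; lra.
have cx0 : 0 < c * x by exact: mulr_gt0.
rewrite -(ler_pM2r (_ : 0 < c * x * (expR (b * x))^-1)); last by rewrite mulr_gt0 ?invr_gt0.
have -> : A * (c * x / expR (b * x)) = (expR (b * x))^-1 * (d%:R * x * omega).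
  by rewrite /A; field; rewrite !gt_eqF.
by rewrite mulrACA divff ?mulr1// gt_eqF.
Qed.

Lemma surf_ge0 : 0 <= @surf R d.
Proof. by rewrite mulr_ge0. Qed.

End radial_power.
End balls.

(** * Blocks of i.i.d. points with a density *)

Section density_measure.
Context d (T : measurableType d) (R : realType) (mu : {measure set T -> \bar R}).
Variable g : T -> \bar R.
Hypothesis mg : measurable_fun setT g.
Hypothesis g0 : forall x, (0 <= g x)%E.

Lemma density_measure_ex : exists nu : {measure set T -> \bar R},
  forall A, nu A = (\int[mu]_(x in A) g x)%E.
Proof.
pose nu A := (\int[mu]_(x in A) g x)%E.
have nu0 : nu set0 = 0%E by exact: integral_set0.
have nu_ge0 A : (0 <= nu A)%E by apply: integral_ge0.
have nu_add : semi_sigma_additive nu.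
  move=> F mF tF mUF; rewrite /nu ge0_integral_bigcup//; last first.
    exact: measurable_funTS.
  by apply: is_cvg_nneseries => n _ _; apply: integral_ge0.
pose nu' : {measure set T -> \bar R} :=
  HB.pack nu (isMeasure.Build _ _ _ nu nu0 nu_ge0 nu_add).
by exists nu'.
Qed.

End density_measure.

(** [m1] and [m2] only certify that the plain set functions [f1] and [f2], in which the equations
    are written, are measures. *)
Lemma tuple_set_function_unique d (T : measurableType d) (R : realType) (n : nat)
    (m1 m2 : {measure set (n.-tuple T) -> \bar R})
    (f1 f2 : set (n.-tuple T) -> \bar R) :
  (forall D, m1 D = f1 D) -> (forall D, m2 D = f2 D) -> (f1 setT < +oo)%E ->
  (forall A : 'I_n -> set T, (forall i, measurable (A i)) ->
     f1 (tuple_rect A) = f2 (tuple_rect A)) ->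
  forall B, measurable B -> f1 B = f2 B.
Proof.
move=> E1 E2 foo f12 B mB; rewrite -E1 -E2.
apply: tuple_measure_unique mB; first by rewrite E1.
by move=> A mA; rewrite E1 E2 f12.
Qed.

Section iid_blocks.
Context dO (Omega : measurableType dO) (R : realType) (Pr : probability Omega R).
Context d (T : measurableType d) (mu : {sigma_finite_measure set T -> \bar R}).
Variables (X : nat -> Omega -> T) (g : T -> R).
Hypothesis mX : forall i, measurable_fun setT (X i).
Hypothesis indep : forall (I : seq nat) (A : nat -> set T),
  uniq I -> (forall i, measurable (A i)) ->
  Pr (\bigcap_(i in [set` I]) (X i @^-1` A i)) =
  (\prod_(i <- I) Pr (X i @^-1` A i))%E.
Hypothesis mg : measurable_fun setT g.
Hypothesis g0 : forall x, 0 <= g x.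
Hypothesis law : forall i (A : set T), measurable A ->
  Pr (X i @^-1` A) = (\int[mu]_x (\1_A x * g x)%:E)%E.

Definition block (s : seq nat) (w : Omega) : (size s).-tuple T :=
  map_tuple (fun i => X i w) (in_tuple s).

Lemma tnth_block s w i : tnth (block s w) i = X (tnth (in_tuple s) i) w.
Proof. by rewrite tnth_map. Qed.

Lemma measurable_block s : measurable_fun setT (block s).
Proof.
apply/measurable_fun_tnthP => i.
rewrite (_ : _ \o _ = X (tnth (in_tuple s) i)); first exact: mX.
by apply/funext => w /=; rewrite tnth_block.
Qed.

(** Independence is stated for sets indexed by sample indices, rectangles by positions in [s]. This
    translates between them; indices outside [s] have position [size s] and receive the full
    space. *)
Definition block_rect (s : seq nat) (A : 'I_(size s) -> set T) (j : nat) : set T :=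
  if insub (index j s) is Some i then A i else setT.

Lemma measurable_block_rect s A : (forall i, measurable (A i)) ->
  forall j, measurable (@block_rect s A j).
Proof. by move=> mA j; rewrite /block_rect; case: insub. Qed.

Lemma block_rect_tnth s A i : uniq s -> @block_rect s A (tnth (in_tuple s) i) = A i.
Proof.
move=> us; rewrite /block_rect (tnth_nth 0%N)/= index_uniq//.
by rewrite insubT//= => h; congr A; exact: val_inj.
Qed.

Lemma block_rect_preimage s A : uniq s ->
  block s @^-1` tuple_rect A =
  \bigcap_(j in [set` s]) (X j @^-1` @block_rect s A j).
Proof.
move=> us; apply/seteqP; split=> w /=.
  move=> h j /= js; have jlt : (index j s < size s)%N by rewrite index_mem.
  have := h (Ordinal jlt); rewrite tnth_block -(block_rect_tnth A _ us).
  by rewrite (tnth_nth 0%N)/= nth_index.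
move=> h i; rewrite tnth_block -(block_rect_tnth A _ us); apply: h => /=.
exact: mem_tnth.
Qed.

(** Both sides are measures in [B], and on rectangles independence factors both into the same
    product of integrals over single points. *)
Lemma block_law s (B : set ((size s).-tuple T)) : uniq s -> measurable B ->
  Pr (block s @^-1` B) =
  (\int[pow_measure mu (size s)]_(x in B) (\prod_(i < size s) g (tnth x i))%:E)%E.
Proof.
move=> us mB.
have mG : measurable_fun [set: (size s).-tuple T]
   (fun x => (\prod_(i < size s) g (tnth x i))%:E).
  exact: (@measurable_Eprod_tnth _ _ _ _ (fun=> g)).
have G0 (x : (size s).-tuple T) : (0 <= (\prod_(i < size s) g (tnth x i))%:E)%E.
  by rewrite lee_fin prodr_ge0.
have [nu nuE] := density_measure_ex (pow_measure mu (size s)) mG G0.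
have E1 D : push Pr (@measurable_block s) D = Pr (block s @^-1` D) by [].
rewrite -nuE -E1; apply: tuple_measure_unique mB; rewrite ?E1.
  by rewrite preimage_setT probability_setT ltry.
move=> A mA; rewrite E1.
rewrite block_rect_preimage// indep//; last exact: measurable_block_rect.
rewrite big_tnth nuE integral_mkcond.
rewrite (eq_integral (fun x : (size s).-tuple T =>
    (\prod_(i < size s) (\1_(A i) (tnth x i) * g (tnth x i)))%:E)).
  rewrite (@int_pow_prod _ _ _ mu (size s) (fun i x => \1_(A i) x * g x)).
  - apply: eq_bigr => i _; rewrite (block_rect_tnth A i us) law//.
  - by move=> i; apply: measurable_funM => //; exact: measurable_indic.
  - by move=> i x; rewrite mulr_ge0// indicE ler0n.
move=> x _; rewrite patchE big_split/=.
have [|] := boolP (x \in _).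
  move=> /set_mem h; rewrite [X in X * _]big1 ?mul1r// => i _.
  by rewrite indicE mem_set.
move=> xA; suff [i hi] : exists i, ~ A i (tnth x i).
  by rewrite (bigD1 i)//= indicE memNset// !mul0r.
apply/existsNP => h; move/negP: xA; apply; exact/mem_set.
Qed.

(** Two rectangles are handled by independence over the concatenated indices. Then one event is
    generalised at a time: with the other fixed, both sides are finite measures, a restriction of
    [Pr] pushed forward and a multiple of the law of a block. *)
Lemma block_indep s1 s2 (B : set ((size s1).-tuple T)) (C : set ((size s2).-tuple T)) :
  uniq (s1 ++ s2) -> measurable B -> measurable C ->
  Pr (block s1 @^-1` B `&` block s2 @^-1` C) =
  (Pr (block s1 @^-1` B) * Pr (block s2 @^-1` C))%E.
Proof.
rewrite cat_uniq => /and3P[u1 /hasPn dis u2] mB mC.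
have mb s (D : set ((size s).-tuple T)) : measurable D -> measurable (block s @^-1` D).
  by move=> mD; rewrite -[X in measurable X]setTI; exact: measurable_block.
have fin D : measurable D -> Pr D \is a fin_num.
  by move=> mD; rewrite fin_num_measure.
have rr (A1 : 'I_(size s1) -> set T) (A2 : 'I_(size s2) -> set T) :
    (forall i, measurable (A1 i)) -> (forall i, measurable (A2 i)) ->
    Pr (block s1 @^-1` tuple_rect A1 `&` block s2 @^-1` tuple_rect A2) =
    (Pr (block s1 @^-1` tuple_rect A1) * Pr (block s2 @^-1` tuple_rect A2))%E.
  move=> mA1 mA2.
  pose A j := if j \in s1 then block_rect A1 j else block_rect A2 j.
  have mA j : measurable (A j).
    by rewrite /A; case: ifP => _; exact: measurable_block_rect.
  have -> : block s1 @^-1` tuple_rect A1 `&` block s2 @^-1` tuple_rect A2 =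
      \bigcap_(j in [set` s1 ++ s2]) (X j @^-1` A j).
    rewrite !block_rect_preimage//; apply/seteqP; split=> w.
      move=> [h1 h2] j /=; rewrite mem_cat /A.
      by case: ifP => [js1 _|_ /= js2]; [exact: h1|exact: h2].
    move=> h; split=> j js.
      by have := h j; rewrite /= mem_cat /A [j \in s1]js => /(_ isT).
    by have := h j; rewrite /= mem_cat /A [j \in s2]js orbT (negbTE (dis _ js)) => /(_ isT).
  rewrite indep//; last by rewrite cat_uniq u1 u2 andbT; apply/hasPn.
  rewrite big_cat/= !block_rect_preimage// !indep//; try exact: measurable_block_rect.
  congr (_ * _)%E; rewrite [LHS]big_seq [RHS]big_seq; apply: eq_bigr => j js.
    by rewrite /A js.
  by rewrite /A (negbTE (dis _ js)).
have step2 (A1 : 'I_(size s1) -> set T) : (forall i, measurable (A1 i)) ->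
    Pr (block s1 @^-1` tuple_rect A1 `&` block s2 @^-1` C) =
    (Pr (block s1 @^-1` tuple_rect A1) * Pr (block s2 @^-1` C))%E.
  move=> mA1; have mE := mb _ _ (measurable_tuple_rect mA1).
  have n0 : 0 <= fine (Pr (block s1 @^-1` tuple_rect A1)) by exact: fine_ge0.
  pose f1 D := Pr (block s1 @^-1` tuple_rect A1 `&` block s2 @^-1` D).
  pose f2 D := (Pr (block s1 @^-1` tuple_rect A1) * Pr (block s2 @^-1` D))%E.
  apply: (@tuple_set_function_unique _ _ R _
    (push (mrestr Pr mE) (@measurable_block s2))
    (mscale (NngNum n0) (push Pr (@measurable_block s2))) f1 f2) => //.
  - by move=> D; rewrite /f1 setIC.
  - by move=> D; rewrite /f2 -[X in (X * _)%E]fineK ?fin.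
  - rewrite /f1 (@le_lt_trans _ _ 1%E) ?ltry//.
    by apply: probability_le1; apply: measurableI => //; exact: mb.
  - by move=> A2 mA2; exact: rr.
have mE := mb _ _ mC.
have n0 : 0 <= fine (Pr (block s2 @^-1` C)) by exact: fine_ge0.
pose f1 D := Pr (block s1 @^-1` D `&` block s2 @^-1` C).
pose f2 D := (Pr (block s1 @^-1` D) * Pr (block s2 @^-1` C))%E.
apply: (@tuple_set_function_unique _ _ R _
  (push (mrestr Pr mE) (@measurable_block s1))
  (mscale (NngNum n0) (push Pr (@measurable_block s1))) f1 f2) => //.
- by move=> D; rewrite /f2 muleC -[X in (X * _)%E]fineK ?fin.
- rewrite /f1 (@le_lt_trans _ _ 1%E) ?ltry//.
  by apply: probability_le1; apply: measurableI => //; exact: mb.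
Qed.

End iid_blocks.

(** * Integrals of translation-invariant kernels beyond a large radius *)

Lemma indic_itv_ge (R : realType) (a y : R) :
  \1_`[a, +oo[%classic y = (a <= y)%R%:R :> R.
Proof.
rewrite indicE; congr (nat_of_bool _)%:R.
by apply/idP/idP => [/set_mem|h]; [|apply/mem_set]; rewrite /= in_itv/= andbT.
Qed.

Section tail_integrals.
Context (R : realType) (d : nat) (fr : R -> R) (alpha : R).
Hypothesis mfr : measurable_fun setT fr.
Hypothesis fr_ge0 : forall r, 0 <= r -> 0 <= fr r.
Hypothesis fr_rv : forall t, 0 < t ->
  (fun r => fr (r * t) / fr r) r @[r --> +oo] --> t `^ (- alpha).
Hypothesis alphad : d%:R < alpha.
Local Notation P := (d.-tuple R).
Local Notation mu := (lebP R d).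

Definition tail_density (rho : R) (x : P) : R :=
  \1_`[rho, +oo[%classic (enorm x) * fr (enorm x).

Lemma measurable_tail_density rho : measurable_fun setT (tail_density rho).
Proof.
apply: measurable_funM.
  apply: (measurableT_comp (measurable_indic (measurable_itv _))).
  exact: measurable_enorm.
by apply: (measurableT_comp mfr); exact: measurable_enorm.
Qed.

Lemma tail_density_ge0 rho x : 0 <= tail_density rho x.
Proof. by rewrite mulr_ge0 ?fr_ge0 ?enorm_ge0// indicE ler0n. Qed.

Definition tail_prod (rho : R) (m : nat) (z : m.-tuple P) : R :=
  \prod_(i < m) tail_density rho (tnth z i).

Lemma measurable_tail_prod rho m : measurable_fun setT (@tail_prod rho m).
Proof.
apply: (@measurable_prod_tnth _ _ _ _ (fun=> tail_density rho)) => _.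
exact: measurable_tail_density.
Qed.

Lemma tail_prod_ge0 rho m z : 0 <= @tail_prod rho m z.
Proof. by rewrite prodr_ge0// => i _; exact: tail_density_ge0. Qed.

(** The first vertex is in absolute position, the others are relative to it, so that a
    translation-invariant kernel depends on [ys] alone. *)
Definition centered (x : P) k (ys : k.-tuple P) : k.+1.-tuple P :=
  [tuple of x :: [tuple tadd x (tnth ys i) | i < k]].

Lemma measurable_centered k :
  measurable_fun setT (fun p : P * k.-tuple P => centered p.1 p.2).
Proof.
apply: measurable_cons => //.
apply/measurable_fun_tnthP => i.
apply/measurable_fun_tnthP => j.
rewrite (_ : _ \o _ = fun p : P * k.-tuple P => tnth p.1 j + tnth (tnth p.2 i) j).
  apply: measurable_funD.
    by apply: (measurableT_comp (@measurable_tnth _ _ _ j)).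
  apply: (measurableT_comp (@measurable_tnth _ _ _ j)).
  by apply: (measurableT_comp (@measurable_tnth _ _ _ i)).
by apply/funext => p /=; rewrite !tnth_mktuple.
Qed.

Lemma int_centered k (Phi : k.+1.-tuple P -> \bar R) :
  measurable_fun [set: k.+1.-tuple P] Phi -> (forall z, 0 <= Phi z)%E ->
  (\int[pow_measure mu k.+1]_z Phi z =
   \int[mu]_x \int[pow_measure mu k]_ys Phi (centered x ys))%E.
Proof.
move=> mPhi Phi0; rewrite int_powS//; apply: eq_integral => x _.
rewrite -(@int_lebPk_shift R d k x (fun ys => Phi [tuple of x :: ys]))//.
exact: measurable_fun_cons.
Qed.

Section kernel.
Variables (k : nat) (K : k.+1.-tuple P -> R) (phi : k.-tuple P -> R).
Hypothesis mK : measurable_fun setT K.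
Hypothesis mphi : measurable_fun setT phi.
Hypothesis phi_ge0 : forall ys, 0 <= phi ys.
Hypothesis K_ge0 : forall z, 0 <= K z.
Hypothesis Kphi : forall x ys, K (centered x ys) = phi ys.

Let m2 : {measure set (P * k.-tuple P) -> \bar R} := (mu \x pow_measure mu k)%E.

(** Only the first point is scaled by [rho], which yields the factor rho^d; the relative positions
    stay of order 1, where [phi] lives. *)
Definition rescaled (rho : R) (p : P * k.-tuple P) : R :=
  phi p.2 * @tail_prod rho k.+1 (centered (tscale rho p.1) p.2).

Lemma measurable_rescaled rho : measurable_fun setT (rescaled rho).
Proof.
apply: measurable_funM; first by apply: (measurableT_comp mphi).
apply: (measurableT_comp (@measurable_tail_prod rho k.+1)).
apply: (@measurableT_comp _ _ _ _ _ _ (fun p : P * k.-tuple P => centered p.1 p.2)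
  _ (fun p : P * k.-tuple P => (tscale rho p.1, p.2))).
  exact: measurable_centered.
apply: measurable_fun_pair => //.
by apply: (measurableT_comp (@measurable_tscale R d rho)).
Qed.

Lemma rescaled_ge0 rho p : 0 <= rescaled rho p.
Proof. by rewrite mulr_ge0// tail_prod_ge0. Qed.

Lemma int_rescaled rho : 0 < rho ->
  (\int[pow_measure mu k.+1]_z (K z * tail_prod rho z)%:E =
   (rho ^+ d)%:E * \int[m2]_p (rescaled rho p)%:E)%E.
Proof.
move=> r0.
have mKt : measurable_fun [set: k.+1.-tuple P] (fun z => (K z * tail_prod rho z)%:E).
  by apply/measurable_EFinP; apply: measurable_funM => //; exact: measurable_tail_prod.
rewrite int_centered//; last by move=> z; rewrite lee_fin mulr_ge0// tail_prod_ge0.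
rewrite (fubini_tonelli1 (fun p => (rescaled rho p)%:E)); first last.
- by move=> p; rewrite lee_fin rescaled_ge0.
- by apply/measurable_EFinP; exact: measurable_rescaled.
pose G (x : P) := (\int[pow_measure mu k]_ys (phi ys * tail_prod rho (centered x ys))%:E)%E.
have G0 x : (0 <= G x)%E.
  by apply: integral_ge0 => ys _; rewrite lee_fin mulr_ge0// tail_prod_ge0.
have mG : measurable_fun setT G.
  apply: (@measurable_fun_fubini_tonelli_F _ _ _ _ _ (pow_measure mu k)
    (fun p : P * k.-tuple P => (phi p.2 * tail_prod rho (centered p.1 p.2))%:E)).
    apply/measurable_EFinP; apply: measurable_funM.
      by apply: (measurableT_comp mphi).
    by apply: (measurableT_comp (@measurable_tail_prod rho k.+1)); exact: measurable_centered.
  by move=> p; rewrite lee_fin mulr_ge0// tail_prod_ge0.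
have -> : (\int[mu]_x fubini_F (pow_measure mu k) (fun p => (rescaled rho p)%:E) x =
  \int[mu]_x G (tscale rho x))%E by [].
rewrite int_lebP_scale// muleA -EFinM -exprMn divff ?gt_eqF// expr1n mul1e.
by apply: eq_integral => x _; apply: eq_integral => ys _; rewrite Kphi.
Qed.

Let w (b : R) (x : P) : R := \1_`[1%R, +oo[%classic (enorm x) * enorm x `^ (- b).

Let mw b : measurable_fun setT (w b).
Proof.
apply: measurable_funM.
  apply: (measurableT_comp (measurable_indic (measurable_itv _))).
  exact: measurable_enorm.
by apply: (measurableT_comp (measurable_powR _)); exact: measurable_enorm.
Qed.

Let w0 b x : 0 <= w b x.
Proof. by rewrite mulr_ge0 ?powR_ge0// indicE ler0n. Qed.

Let int_wphi b : d%:R < b ->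
  (\int[m2]_p (w b p.1 * phi p.2)%:E =
   (@surf R d / (b - d%:R))%:E * \int[pow_measure mu k]_ys (phi ys)%:E)%E.
Proof.
move=> db; rewrite (fubini_tonelli1 (fun p => (w b p.1 * phi p.2)%:E)); first last.
- by move=> p; rewrite lee_fin mulr_ge0.
- apply/measurable_EFinP; apply: measurable_funM.
    by apply: (measurableT_comp (mw b)).
  by apply: (measurableT_comp mphi).
rewrite /fubini_F/=.
under eq_integral => x _.
  under eq_integral do rewrite EFinM.
  rewrite ge0_integralZl//; [|exact/measurable_EFinP|by move=> y _; rewrite lee_fin|by rewrite lee_fin].
  over.
rewrite ge0_integralZr//; last 3 first.
- exact/measurable_EFinP.
- by move=> x _; rewrite lee_fin.
- by apply: integral_ge0 => y _; rewrite lee_fin.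
by rewrite int_radial_power.
Qed.

Section bounds.
Variables (r0 C b : R).
Hypothesis r00 : 0 < r0.
Hypothesis C0 : 0 < C.
Hypothesis db : d%:R < b.
Hypothesis fr_gt0 : forall r, r0 <= r -> 0 < fr r.
Hypothesis fr_le : forall r t, r0 <= r -> 1 <= t -> fr (r * t) / fr r <= C * t `^ (- b).

Let tail_density_scaled_le rho (x : P) : r0 <= rho ->
  tail_density rho (tscale rho x) <= C * fr rho * w b x.
Proof.
move=> rr; have rp : 0 < rho by exact: lt_le_trans rr.
rewrite /tail_density /w enorm_tscale ?(ltW rp)// !indic_itv_ge ler_pMr//.
have [x1|_] := leP 1 (enorm x); last by rewrite !mul0r mulr0.
rewrite !mul1r mulrAC.
by rewrite -ler_pdivrMr ?fr_gt0// fr_le.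
Qed.

Lemma tail_density_bound rho (z : P) : r0 <= rho -> tail_density rho z <= C * fr rho.
Proof.
move=> rr; have rp : 0 < rho by exact: lt_le_trans rr.
pose z' := tscale rho^-1 z; have -> : z = tscale rho z'.
  by apply: eq_from_tnth => i; rewrite !tnth_mktuple mulrA divff ?mul1r// gt_eqF.
apply: (le_trans (tail_density_scaled_le _ rr)).
rewrite ler_piMr ?mulr_ge0 ?(ltW C0) ?(ltW (fr_gt0 rr))// /w indic_itv_ge.
have [x1|_] := leP 1 (enorm z'); last by rewrite mul0r ler01.
rewrite mul1r powRN.
have x0 := lt_le_trans ltr01 x1.
rewrite invf_le1 ?powR_gt0//; apply: (@le_trans _ _ (1 `^ b)); first by rewrite powR1.
by rewrite ge0_ler_powR ?nnegrE ?(ltW x0)// (le_trans _ (ltW db)).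
Qed.

(** The decay |x|^-b is spent on the first point only. The other densities are replaced by their
    maximal bound C fr (rho), since [phi] already controls the positions of those points. *)
Let rescaled_le rho p : r0 <= rho ->
  rescaled rho p <= (C * fr rho) ^+ k.+1 * (w b p.1 * phi p.2).
Proof.
move=> rr; rewrite /rescaled mulrC mulrA ler_wpM2r// /tail_prod big_ord_recl.
rewrite exprS [leRHS]mulrAC; apply: ler_pM.
- exact: tail_density_ge0.
- by rewrite prodr_ge0// => i _; exact: tail_density_ge0.
- by rewrite (_ : tnth _ _ = tscale rho p.1)//; exact: tail_density_scaled_le.
- rewrite -[in leRHS](card_ord k) -prodr_const; apply: ler_prod => i _.
  by rewrite tail_density_ge0/=; exact: tail_density_bound.
Qed.

Lemma tail_integral_le rho : r0 <= rho ->
  (\int[pow_measure mu k.+1]_z (K z * tail_prod rho z)%:E <=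
   (rho ^+ d * (C * fr rho) ^+ k.+1 * (@surf R d / (b - d%:R)))%:E *
     \int[pow_measure mu k]_ys (phi ys)%:E)%E.
Proof.
move=> rr; have rp : 0 < rho by exact: lt_le_trans rr.
rewrite int_rescaled// -mulrA EFinM -!muleA; apply: lee_wpmul2l.
  by rewrite lee_fin exprn_ge0// ltW.
rewrite EFinM -muleA -int_wphi// -ge0_integralZl//; last 3 first.
- apply/measurable_EFinP; apply: measurable_funM.
    by apply: (measurableT_comp (mw b)).
  by apply: (measurableT_comp mphi).
- by move=> p _; rewrite lee_fin mulr_ge0.
- by rewrite lee_fin exprn_ge0// mulr_ge0 ?(ltW C0) ?(ltW (fr_gt0 rr)).
apply: ge0_le_integral => //.
- by move=> p _; rewrite lee_fin rescaled_ge0.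
- by apply/measurable_EFinP; exact: measurable_rescaled.
- apply/measurable_EFinP; apply: measurable_funM => //; apply: measurable_funM.
    by apply: (measurableT_comp (mw b)).
  by apply: (measurableT_comp mphi).
- by move=> p _; rewrite -EFinM lee_fin rescaled_le.
Qed.

Let cvg_enorm (u_ : nat -> P) (u : P) :
  (forall i, tnth (u_ n) i @[n --> \oo] --> tnth u i) ->
  enorm (u_ n) @[n --> \oo] --> enorm u.
Proof.
move=> h; rewrite /enorm.
have c : \sum_(i < d) tnth (u_ n) i ^+ 2 @[n --> \oo] --> \sum_(i < d) tnth u i ^+ 2.
  apply: cvg_big; first exact: add_continuous.
  by move=> i _; rewrite expr2; under eq_fun do rewrite expr2; exact: cvgM.
by apply: (continuous_cvg _ _ c); exact: sqrt_continuous.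
Qed.

(** Write rho x + y = rho (x + y / rho): the norm in parentheses tends to |x|, so the indicator
    converges off the unit sphere and the ratio of densities converges by regular variation along a
    moving argument. *)
Let tail_density_cvg (rho_ : nat -> R) (x y : P) : rho_ n @[n --> \oo] --> +oo ->
  enorm x != 1 ->
  tail_density (rho_ n) (tadd (tscale (rho_ n) x) y) / fr (rho_ n) @[n --> \oo] -->
  w alpha x.
Proof.
move=> roo x1.
pose t_ n := enorm (tadd x (tscale (rho_ n)^-1 y)).
have rgt : \forall n \near \oo, 0 < rho_ n.
  apply: filterS (cvgry_near_ge roo 1) => n; exact: lt_le_trans.
have ct : t_ n @[n --> \oo] --> enorm x.
  apply: cvg_enorm => i.
  rewrite (_ : (fun n => tnth _ i) = fun n => tnth x i + (rho_ n)^-1 * tnth y i); last first.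
    by apply/funext => n; rewrite !tnth_mktuple.
  rewrite -[X in _ --> X]addr0; apply: cvgD; first exact: cvg_cst.
  rewrite -[X in _ --> X](mul0r (tnth y i)); apply: cvgM; last exact: cvg_cst.
  by apply/gtr0_cvgV0.
have E n : 0 < rho_ n -> tail_density (rho_ n) (tadd (tscale (rho_ n) x) y) / fr (rho_ n) =
    (1 <= t_ n)%R%:R * (fr (rho_ n * t_ n) / fr (rho_ n)).
  move=> rn.
  have -> : tadd (tscale (rho_ n) x) y = tscale (rho_ n) (tadd x (tscale (rho_ n)^-1 y)).
    by apply: eq_from_tnth => i; rewrite !tnth_mktuple mulrDr mulrA divff ?mul1r// gt_eqF.
  by rewrite /tail_density enorm_tscale ?(ltW rn)// indic_itv_ge ler_pMr// mulrA.
have {E} E : \forall n \near \oo, (1 <= t_ n)%R%:R * (fr (rho_ n * t_ n) / fr (rho_ n)) =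
   tail_density (rho_ n) (tadd (tscale (rho_ n) x) y) / fr (rho_ n).
  by apply: filterS rgt => n rn; rewrite E.
apply: cvg_trans (near_eq_cvg E) _.
rewrite /w indic_itv_ge; have [xlt|xgt] := ltP (enorm x) 1.
  rewrite mul0r; apply: cvg_near_cst; apply: filterS (cvgr_lt _ ct _ xlt) => n tn.
  by rewrite leNgt tn/= mul0r.
have x1' : 1 < enorm x by rewrite lt_neqAle eq_sym x1.
rewrite mul1r.
have h : \forall n \near \oo, fr (rho_ n * t_ n) / fr (rho_ n) =
    (1 <= t_ n)%R%:R * (fr (rho_ n * t_ n) / fr (rho_ n)).
  by apply: filterS (cvgr_gt _ ct _ x1') => n tn; rewrite ltW// mul1r.
apply: cvg_trans (near_eq_cvg h) _.
by apply: rv_ratio_cvg => //; exact: lt_trans x1'.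
Qed.

Let w_expr (a : R) (m : nat) (x : P) : w a x ^+ m.+1 = w (a * m.+1%:R) x.
Proof.
rewrite /w !indic_itv_ge; case: leP => _; last by rewrite !mul0r expr0n.
by rewrite !mul1r -powR_mulrn ?powR_ge0// -powRrM mulNr.
Qed.

Let ae_off_sphere : {ae m2, forall p, enorm p.1 != 1}.
Proof.
exists ([set x : P | enorm x = 1] `*` setT); split.
- by apply: measurableX => //; exact: (@measurable_radial R d [set 1]).
- transitivity (mu [set x : P | enorm x = 1%R] * pow_measure mu k setT)%E.
    by apply: product_measure1E => //; exact: (@measurable_radial R d [set 1]).
  by rewrite sphere_null mul0e.
- by move=> [x ys] /= /negP; rewrite negbK => /eqP.
Qed.

(** Dominated convergence with the bound C^(k+1) w_b (x) phi (ys). All k + 1 points sit at rho x up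
    to a bounded shift, so the limit weight is w_alpha (x)^(k+1), that is [w] with exponent alpha (k
    + 1); its integral is the source of the denominator alpha (k + 1) - d. *)
Lemma tail_integral_cvg (rho_ : nat -> R) : b < alpha ->
  rho_ n @[n --> \oo] --> +oo ->
  (\int[pow_measure mu k]_ys (phi ys)%:E < +oo)%E ->
  fine (\int[pow_measure mu k.+1]_z (K z * tail_prod (rho_ n) z)%:E)%E
    / (rho_ n ^+ d * fr (rho_ n) ^+ k.+1) @[n --> \oo] -->
  @surf R d / (alpha * k.+1%:R - d%:R) * fine (\int[pow_measure mu k]_ys (phi ys)%:E)%E.
Proof.
move=> ba roo phioo.
have ak : d%:R < alpha * k.+1%:R.
  by rewrite (lt_le_trans alphad)// ler_peMr ?ler1n// (le_trans _ (ltW alphad)).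
(* The value 0 below [r0] makes the domination valid for all n, not only eventually. *)
pose f_ n p := if r0 <= rho_ n then rescaled (rho_ n) p / fr (rho_ n) ^+ k.+1 else 0.
pose f p := w (alpha * k.+1%:R) p.1 * phi p.2.
pose g p := C ^+ k.+1 * (w b p.1 * phi p.2).
have mwphi a : measurable_fun setT (fun p : P * k.-tuple P => w a p.1 * phi p.2).
  apply: measurable_funM; first by apply: (measurableT_comp (mw a)).
  by apply: (measurableT_comp mphi).
have mf_ n : measurable_fun setT (f_ n).
  rewrite /f_; case: (r0 <= rho_ n); last exact: measurable_cst.
  by apply: measurable_funM => //; exact: measurable_rescaled.
have mg : measurable_fun setT g by exact: measurable_funM.
have phifin : (\int[pow_measure mu k]_ys (phi ys)%:E)%E \is a fin_num.
  by apply: ge0_integral_fin => // ys; rewrite lee_fin.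
have goo : (\int[m2]_p (g p)%:E < +oo)%E.
  under eq_integral do rewrite /g EFinM.
  rewrite ge0_integralZl//; last 3 first.
  - exact/measurable_EFinP.
  - by move=> p _; rewrite lee_fin mulr_ge0.
  - by rewrite lee_fin exprn_ge0// ltW.
  by rewrite int_wphi// -(fineK phifin) -!EFinM ltry.
have f_g n p : 0 <= f_ n p <= g p.
  rewrite /f_ /g; case: ifP => [rr|_]; last first.
    by rewrite lexx mulr_ge0 ?exprn_ge0 ?(ltW C0)// mulr_ge0.
  have fp : 0 < fr (rho_ n) ^+ k.+1 by rewrite exprn_gt0 ?fr_gt0.
  rewrite divr_ge0 ?rescaled_ge0 ?(ltW fp)//= ler_pdivrMr// mulrAC -exprMn.
  exact: rescaled_le.
have rr : \forall n \near \oo, r0 <= rho_ n by exact: cvgry_near_ge.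
have f_f : {ae m2, forall p, f_ n p @[n --> \oo] --> f p}.
  apply: filterS ae_off_sphere => p p1.
  have c : phi p.2 * \prod_(i < k.+1) (tail_density (rho_ n)
      (tnth (centered (tscale (rho_ n) p.1) p.2) i) / fr (rho_ n)) @[n --> \oo] -->
      phi p.2 * \prod_(i < k.+1) w alpha p.1.
    apply: cvgM; first exact: cvg_cst.
    apply: cvg_big; first exact: mul_continuous.
    move=> i _; case: (unliftP ord0 i) => [j|] ->.
      have := tail_density_cvg (tnth p.2 j) roo p1.
      apply: cvg_trans; apply: near_eq_cvg; apply: nearW => n.
      by rewrite /centered tnth_cons_lift tnth_mktuple.
    (* The first vertex is the case of a zero shift, written [tscale 0 p.1]. *)
    have := tail_density_cvg (tscale 0 p.1) roo p1.
    apply: cvg_trans; apply: near_eq_cvg; apply: nearW => n.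
    have -> : tnth (centered (tscale (rho_ n) p.1) p.2) ord0 = tscale (rho_ n) p.1 by [].
    congr (tail_density _ _ / _); apply: eq_from_tnth => j.
    by rewrite !tnth_mktuple mul0r addr0.
  rewrite prodr_const card_ord w_expr mulrC in c.
  apply: cvg_trans c; apply: near_eq_cvg; apply: filterS rr => n rn.
  rewrite /f_ rn /rescaled -mulrA; congr (_ * _).
  by rewrite big_split/= prodr_const card_ord exprVn.
have [_] := ge0_dominated_cvg mf_ (mwphi _) mg goo f_g f_f.
rewrite /f int_wphi// fineM//= => c.
apply: cvg_trans c; apply: near_eq_cvg; apply: filterS rr => n rn.
have rp : 0 < rho_ n by exact: lt_le_trans rn.
have fp := fr_gt0 rn.
have rfin : (\int[m2]_p (rescaled (rho_ n) p)%:E)%E \is a fin_num.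
  rewrite ge0_fin_numE; last by apply: integral_ge0 => p _; rewrite lee_fin rescaled_ge0.
  apply: (@le_lt_trans _ _ (\int[m2]_p ((fr (rho_ n) ^+ k.+1)%:E * (g p)%:E))%E).
    apply: ge0_le_integral => //.
    - by move=> p _; rewrite lee_fin rescaled_ge0.
    - by apply/measurable_EFinP; exact: measurable_rescaled.
    - by apply: emeasurable_funM => //; exact/measurable_EFinP.
    - move=> p _; rewrite -EFinM lee_fin.
      have -> : fr (rho_ n) ^+ k.+1 * g p = (C * fr (rho_ n)) ^+ k.+1 * (w b p.1 * phi p.2).
        by rewrite /g exprMn; ring.
      exact: rescaled_le.
  rewrite ge0_integralZl//; last 3 first.
  - exact/measurable_EFinP.
  - by move=> p _; rewrite lee_fin; have /andP[a c] := f_g n p; exact: le_trans c.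
  - by rewrite lee_fin exprn_ge0// ltW.
  by apply: lte_mul_pinfty => //; rewrite lee_fin exprn_ge0// ltW.
rewrite int_rescaled// fineM//.
rewrite /f_ rn.
have -> : (\int[m2]_p (rescaled (rho_ n) p / fr (rho_ n) ^+ k.+1)%:E =
   (fr (rho_ n) ^+ k.+1)^-1%:E * \int[m2]_p (rescaled (rho_ n) p)%:E)%E.
  rewrite -ge0_integralZl//.
  - by apply: eq_integral => p _; rewrite -EFinM mulrC.
  - by apply/measurable_EFinP; exact: measurable_rescaled.
  - by move=> p _; rewrite lee_fin rescaled_ge0.
  - by rewrite lee_fin invr_ge0 exprn_ge0// ltW.
rewrite fineM//=.
by field; rewrite !expf_neq0// gt_eqF.
Qed.

End bounds.
End kernel.
End tail_integrals.

(** * Point sets of tuples and vector operations *)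

Section tuple_points.
Context (T : Type).

Lemma tuple_pts_cons n (y : T) (ys : n.-tuple T) :
  tuple_pts [tuple of y :: ys] = [set y] `|` tuple_pts ys.
Proof.
apply/seteqP; split=> z.
  move=> [i ->]; case: (unliftP ord0 i) => [j|] ->; last by left.
  by right; exists j; rewrite tnth_cons_lift.
case=> [->|[j ->]]; first by exists ord0.
by exists (lift ord0 j); rewrite tnth_cons_lift.
Qed.

Lemma tuple_pts_map (U : Type) n (f : T -> U) (x : n.-tuple T) :
  f @` tuple_pts x = tuple_pts [tuple f (tnth x i) | i < n].
Proof.
apply/seteqP; split=> z.
  by move=> [_ [i ->] <-]; exists i; rewrite tnth_mktuple.
by move=> [i ->]; exists (tnth x i); [exists i|rewrite tnth_mktuple].
Qed.

Lemma finite_tuple_pts n (x : n.-tuple T) : finite_set (tuple_pts x).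
Proof.
have -> : tuple_pts x = (tnth x) @` [set: 'I_n].
  by apply/seteqP; split=> z [i]; [move=> ->|move=> _ <-]; exists i.
by apply: finite_image; exact: finite_finset.
Qed.

Lemma tuple_pts_neq0 n (x : n.+1.-tuple T) : tuple_pts x !=set0.
Proof. by exists (tnth x ord0); exists ord0. Qed.

End tuple_points.

Section tuple_space.
Context (R : realType) (d : nat).
Local Notation P := (d.-tuple R).
Implicit Types x y : P.

Lemma tscaleDr a x y : tscale a (tadd x y) = tadd (tscale a x) (tscale a y).
Proof. by apply: eq_from_tnth => i; rewrite !tnth_mktuple mulrDr. Qed.

Lemma tadd0r x : tadd x (tzero : P) = x.
Proof. by apply: eq_from_tnth => i; rewrite !tnth_mktuple addr0. Qed.

Lemma tscale0r a : tscale a (tzero : P) = tzero.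
Proof. by apply: eq_from_tnth => i; rewrite !tnth_mktuple mulr0. Qed.

Lemma tscaleA a b x : tscale a (tscale b x) = tscale (a * b) x.
Proof. by apply: eq_from_tnth => i; rewrite !tnth_mktuple mulrA. Qed.

Lemma tscale1r x : tscale 1 x = x.
Proof. by apply: eq_from_tnth => i; rewrite !tnth_mktuple mul1r. Qed.

End tuple_space.

(** * The indicator of a complex at scale t *)

Lemma natr_bool_eq1 (R : realType) (b : bool) : b%:R = 1 :> R -> b.
Proof. by case: b => // H; exfalso; move: H => /=; lra. Qed.

Section complex_indicator.
Context (R : realType) (d : nat).
Local Notation P := (d.-tuple R).
Local Notation mu := (lebP R d).
Variable h : set P -> bool.
Hypothesis d_gt0 : (0 < d)%N.
Hypothesis h1 : forall x : P, h [set x].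
Hypothesis hshift : forall (Xs : set P) (y : P), finite_set Xs -> Xs !=set0 ->
  h ((fun x => tadd x y) @` Xs) = h Xs.
Variable c : R.
Hypothesis c_gt0 : 0 < c.
Hypothesis hdiam : forall Xs : set P, finite_set Xs -> Xs !=set0 ->
  (exists x y, Xs x /\ Xs y /\ c < enorm (tadd x (tscale (-1) y))) -> h Xs = false.
Hypothesis hmono : forall (Xs : set P) (s t : R), finite_set Xs -> Xs !=set0 ->
  0 < s -> s <= t -> ht h s Xs -> ht h t Xs.
Hypothesis mh : forall m : nat, measurable_fun setT
  (fun x : m.-tuple P => (h (tuple_pts x))%:R : R).

Lemma ht_gt0 t Xs : 0 < t -> ht h t Xs = h (tscale t^-1 @` Xs).
Proof. by move=> t0; rewrite /ht gt_eqF. Qed.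

(** At scale 0 [ht] is the conjunction over all positive scales, so monotonicity extends to s =
    0. *)
Lemma ht_le (Xs : set P) (s t : R) : finite_set Xs -> Xs !=set0 ->
  0 <= s -> s <= t -> ht h s Xs -> ht h t Xs.
Proof.
move=> fX X0; rewrite le_eqVlt => /predU1P[<- st|s0 st]; last exact: hmono.
move: st; rewrite le_eqVlt => /predU1P[<-//|t0].
by rewrite {1}/ht eqxx => /asboolP/(_ _ t0); rewrite ht_gt0.
Qed.

Lemma ht_shift t (Xs : set P) (y : P) : finite_set Xs -> Xs !=set0 ->
  ht h t ((tadd y) @` Xs) = ht h t Xs.
Proof.
move=> fX X0.
have E s : h (tscale s^-1 @` ((tadd y) @` Xs)) = h (tscale s^-1 @` Xs).
  rewrite -[RHS](@hshift _ (tscale s^-1 y)).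
  - congr h; rewrite !image_comp; apply: eq_imagel => x _ /=.
    by rewrite tscaleDr; apply: eq_from_tnth => i; rewrite !tnth_mktuple addrC.
  - exact: finite_image.
  - by case: X0 => x Xx; exists (tscale s^-1 x); exists x.
rewrite /ht E; case: ifP => // _; congr asbool; apply/propext.
by split=> H s s0; have := H s s0; rewrite E.
Qed.

(** The radius has t + 1 instead of t in order to cover t = 0, where [ht] is not a rescaling of [h]:
    monotonicity first passes to the positive scale t + 1. *)
Lemma ht_diam t (Xs : set P) (x y : P) : finite_set Xs -> Xs !=set0 -> 0 <= t ->
  ht h t Xs -> Xs x -> Xs y -> enorm (tadd x (tscale (-1) y)) <= c * (t + 1).
Proof.
move=> fX X0 t0 hX Xx Xy.
have t1 : 0 < t + 1 by rewrite ltr_wpDl.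
have : ht h (t + 1) Xs by apply: ht_le hX => //; rewrite lerDl.
rewrite ht_gt0// leNgt => hh; apply/negP => clt; move: hh.
rewrite hdiam//; first exact: finite_image.
  by case: X0 => z Xz; exists (tscale (t + 1)^-1 z); exists z.
exists (tscale (t + 1)^-1 x), (tscale (t + 1)^-1 y); split; first by exists x.
split; first by exists y.
have -> : tadd (tscale (t + 1)^-1 x) (tscale (-1) (tscale (t + 1)^-1 y)) =
    tscale (t + 1)^-1 (tadd x (tscale (-1) y)).
  by rewrite tscaleDr !tscaleA mulrC.
by rewrite enorm_tscale ?invr_ge0 ?(ltW t1)// ltr_pdivlMl// mulrC.
Qed.

Definition ht_ind t m (z : m.-tuple P) : R := (ht h t (tuple_pts z))%:R.

Lemma ht_ind_ge0 t m z : 0 <= @ht_ind t m z. Proof. exact: ler0n. Qed.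

Lemma measurable_tuple_map m (f : P -> P) : measurable_fun setT f ->
  measurable_fun setT (fun z : m.-tuple P => [tuple f (tnth z i) | i < m]).
Proof.
move=> mf; apply/measurable_fun_tnthP => i.
rewrite (_ : _ \o _ = f \o (@tnth _ P ^~ i)).
  by apply: measurableT_comp => //; exact: measurable_tnth.
by apply/funext => x /=; rewrite tnth_mktuple.
Qed.

Lemma measurable_ht_ind t m : 0 <= t -> measurable_fun setT (@ht_ind t m.+1).
Proof.
have pos s : 0 < s -> measurable_fun setT (@ht_ind s m.+1).
  move=> s0; rewrite (_ : @ht_ind s m.+1 = (fun x : m.+1.-tuple P => (h (tuple_pts x))%:R : R) \o
     (fun z : m.+1.-tuple P => [tuple tscale s^-1 (tnth z i) | i < m.+1])).
    apply: measurableT_comp; first exact: mh.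
    by apply: measurable_tuple_map; exact: measurable_tscale.
  by apply/funext => z /=; rewrite /ht_ind ht_gt0// tuple_pts_map.
rewrite le_eqVlt => /predU1P[<-|/pos//].
have e0 n : 0 < n.+1%:R^-1 :> R by rewrite invr_gt0.
(* At t = 0 monotonicity reduces the uncountable conjunction over s > 0 to the scales 1 / (n +
   1). *)
rewrite (_ : @ht_ind 0 m.+1 = fun z => \1_(\bigcap_n [set z | @ht_ind n.+1%:R^-1 m.+1 z = 1]) z).
  apply: measurable_indic; apply: bigcapT_measurable => n.
  rewrite -[X in measurable X]setTI.
  exact: (pos _ (e0 n) measurableT [set 1]).
apply/funext => z; rewrite /ht_ind indicE; congr (nat_of_bool _)%:R.
have fz := finite_tuple_pts z; have z0 := tuple_pts_neq0 z.
apply/idP/idP => [hz|/set_mem/= hz].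
  apply/mem_set => n _ /=; rewrite (_ : ht _ _ _ = true)//.
  by apply: ht_le hz => //; exact: ltW.
rewrite /ht eqxx; apply/asboolP => s s0.
have [n ns] : exists n : nat, n.+1%:R^-1 <= s.
  exists (Num.truncn s^-1); rewrite invf_ple ?posrE//.
  by rewrite ltW// truncnS_gt.
rewrite -ht_gt0//; apply: (hmono fz z0 (e0 n) ns).
exact: natr_bool_eq1 (hz n I).
Qed.

Definition ht_ind0 t k (ys : k.-tuple P) : R := ht_ind t [tuple of tzero :: ys].

Lemma ht_ind0E t k (ys : k.-tuple P) :
  ht_ind0 t ys = (ht h t ([set tzero] `|` tuple_pts ys))%:R.
Proof. by rewrite /ht_ind0 /ht_ind tuple_pts_cons. Qed.

Lemma measurable_ht_ind0 t k : 0 <= t -> measurable_fun setT (@ht_ind0 t k).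
Proof.
move=> t0; apply: (measurableT_comp (@measurable_ht_ind t k t0)).
exact: measurable_tuple_cons1.
Qed.

Lemma ht_ind0_ge0 t k ys : 0 <= @ht_ind0 t k ys. Proof. exact: ler0n. Qed.

Lemma ht_ind_centered t k (x : P) (ys : k.-tuple P) :
  ht_ind t (centered x ys) = ht_ind0 t ys.
Proof.
rewrite /ht_ind0 /ht_ind; congr (nat_of_bool _)%:R.
rewrite -(@ht_shift t (tuple_pts [tuple of tzero :: ys]) x).
- congr ht; rewrite tuple_pts_map; congr tuple_pts.
  apply: eq_from_tnth => i; rewrite tnth_mktuple.
  case: (unliftP ord0 i) => [j|] ->; first by rewrite !tnth_cons_lift tnth_mktuple.
  by rewrite !tnth0 tadd0r.
- exact: finite_tuple_pts.
- exact: tuple_pts_neq0.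
Qed.

Lemma int_ht_ind0 t k : 0 <= t ->
  int_ht h k t = (\int[pow_measure mu k]_ys (ht_ind0 t ys)%:E)%E.
Proof.
move=> t0; rewrite /int_ht iter_int_lebP.
- by congr iter_int; apply/funext => ys; rewrite ht_ind0E.
- by apply/measurable_EFinP; exact: measurable_ht_ind0.
- by move=> ys; rewrite lee_fin ht_ind0_ge0.
Qed.

(** A majorant of the simplex indicator that factors over the vertices other than the first, so that
    its reduced integral is a power of a ball volume. It also dominates two simplices glued at the
    first vertex. *)
Definition star_ind (r : R) k (z : k.+1.-tuple P) : R :=
  \prod_(i < k) (enorm (tadd (tnth z (lift ord0 i)) (tscale (-1) (thead z))) <= r)%R%:R.

Definition ball_ind (r : R) k (ys : k.-tuple P) : R :=
  \prod_(i < k) (enorm (tnth ys i) <= r)%R%:R.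

Lemma ball_indicE r (y : P) : (enorm y <= r)%R%:R = \1_[set y : P | enorm y <= r] y :> R.
Proof.
rewrite indicE; congr (nat_of_bool _)%:R.
by apply/idP/idP => [hy|/set_mem//]; exact/mem_set.
Qed.

Lemma measurable_cball r : measurable [set y : P | enorm y <= r].
Proof.
have -> : [set y : P | enorm y <= r] = [set y : P | `]-oo, r]%classic (enorm y)].
  by apply/seteqP; split=> y /=; rewrite in_itv.
exact: measurable_radial.
Qed.

Lemma measurable_ball_fun r : measurable_fun setT (fun y : P => (enorm y <= r)%R%:R : R).
Proof.
rewrite (_ : (fun _ => _) = \1_[set y : P | enorm y <= r]).
  by apply: measurable_indic; exact: measurable_cball.
by apply/funext => y; exact: ball_indicE.
Qed.

Lemma measurable_ball_ind r k : measurable_fun setT (@ball_ind r k).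
Proof.
apply: (@measurable_prod_tnth _ _ _ _ (fun=> fun y => (enorm y <= r)%R%:R)) => _.
exact: measurable_ball_fun.
Qed.

Lemma ball_ind_ge0 r k ys : 0 <= @ball_ind r k ys.
Proof. by rewrite prodr_ge0. Qed.

Definition ball_vol (r : R) : R := fine (mu [set y : P | enorm y <= r]).

Lemma int_ball_ind r k :
  (\int[pow_measure mu k]_ys (ball_ind r ys)%:E = (ball_vol r ^+ k)%:E)%E.
Proof.
rewrite (@int_pow_prod _ _ _ mu k (fun=> fun y => (enorm y <= r)%R%:R))//; last first.
  by move=> i; exact: measurable_ball_fun.
rewrite (eq_bigr (fun=> (ball_vol r)%:E)).
  by rewrite prodEFin prodr_const card_ord.
move=> i _; under eq_integral do rewrite ball_indicE.
rewrite int_lebP_indic; last exact: measurable_cball.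
by rewrite fineK// ge0_fin_numE// ball_fin.
Qed.

Lemma star_ind_centered r k (x : P) (ys : k.-tuple P) :
  star_ind r (centered x ys) = ball_ind r ys.
Proof.
apply: eq_bigr => i _; rewrite /centered tnth_cons_lift tnth_mktuple.
have -> : thead [tuple of x :: [tuple tadd x (tnth ys i0) | i0 < k]] = x by [].
have -> // : tadd (tadd x (tnth ys i)) (tscale (-1) x) = tnth ys i.
by apply: eq_from_tnth => j; rewrite !tnth_mktuple; ring.
Qed.

Lemma star_ind_ge0 r k z : 0 <= @star_ind r k z.
Proof. by rewrite prodr_ge0. Qed.

Lemma measurable_star_ind r k : measurable_fun setT (@star_ind r k).
Proof.
apply: measurable_prod => i _.
apply: (measurableT_comp (measurable_ball_fun r)).
apply/measurable_fun_tnthP => j.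
rewrite (_ : _ \o _ = fun z : k.+1.-tuple P =>
    tnth (tnth z (lift ord0 i)) j + -1 * tnth (tnth z ord0) j).
  apply: measurable_funD.
    apply: (measurableT_comp (@measurable_tnth _ _ _ j)).
    exact: measurable_tnth.
  apply: measurable_funM => //.
  apply: (measurableT_comp (@measurable_tnth _ _ _ j)).
  exact: measurable_tnth.
by apply/funext => z /=; rewrite !tnth_mktuple.
Qed.

Lemma ht_ind_le_star t k (z : k.+1.-tuple P) : 0 <= t ->
  ht_ind t z <= star_ind (c * (t + 1)) z.
Proof.
move=> t0; rewrite /ht_ind; case hz: (ht h t _) => /=; last exact: star_ind_ge0.
rewrite /star_ind big1// => i _.
rewrite (@ht_diam t (tuple_pts z))//.
- exact: finite_tuple_pts.
- exact: tuple_pts_neq0.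
- by exists (lift ord0 i).
- by exists ord0.
Qed.

Lemma ht_ind0_le_ball t k (ys : k.-tuple P) : 0 <= t ->
  ht_ind0 t ys <= ball_ind (c * (t + 1)) ys.
Proof.
move=> t0; rewrite -(ht_ind_centered t tzero) -(star_ind_centered _ tzero).
exact: ht_ind_le_star.
Qed.

Lemma int_ht_le t k : 0 <= t -> (int_ht h k t <= (ball_vol (c * (t + 1)) ^+ k)%:E)%E.
Proof.
move=> t0; rewrite int_ht_ind0// -int_ball_ind; apply: ge0_le_integral => //.
- by move=> ys _; rewrite lee_fin ht_ind0_ge0.
- by apply/measurable_EFinP; exact: measurable_ht_ind0.
- by apply/measurable_EFinP; exact: measurable_ball_ind.
- by move=> ys _; rewrite lee_fin ht_ind0_le_ball.
Qed.

Lemma int_ht_ge0 t k : 0 <= t -> (0 <= int_ht h k t)%E.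
Proof.
by move=> t0; rewrite int_ht_ind0//; apply: integral_ge0 => ys _; rewrite lee_fin ht_ind0_ge0.
Qed.

Lemma int_ht_fin t k : 0 <= t -> int_ht h k t \is a fin_num.
Proof.
move=> t0; rewrite ge0_fin_numE ?int_ht_ge0//.
by apply: (le_lt_trans (int_ht_le k t0)); rewrite ltry.
Qed.

Lemma int_ht_scale_gt0 t k : 0 < t ->
  int_ht h k t = ((t ^+ (d * k))%:E * int_ht h k 1)%E.
Proof.
move=> t0; rewrite !int_ht_ind0//; last exact: ltW.
have ti0 : 0 < t^-1 by rewrite invr_gt0.
rewrite -[in RHS](invrK t) -(@int_lebPk_scale _ _ _ _ (fun ys => (ht_ind0 1 ys)%:E) ti0).
- apply: eq_integral => ys _; rewrite /ht_ind0 /ht_ind !ht_gt0// invr1; congr ((h _)%:R%:E).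
  rewrite !tuple_pts_map; congr tuple_pts; apply: eq_from_tnth => i.
  rewrite !tnth_mktuple tscale1r; case: (unliftP ord0 i) => [j|] ->.
    by rewrite !tnth_cons_lift tnth_mktuple.
  by rewrite !tnth0 tscale0r.
- by apply/measurable_EFinP; exact: measurable_ht_ind0.
- by move=> ys; rewrite lee_fin ht_ind0_ge0.
Qed.

Lemma int_ht0 t : 0 <= t -> int_ht h 0 t = 1%E.
Proof.
move=> t0; rewrite /int_ht/= (_ : [set tzero] `|` _ = [set tzero]).
  have E a : h (tscale a @` [set tzero]) by rewrite image_set1.
  by rewrite /ht; case: ifP => _; rewrite ?E// asboolT.
by apply/seteqP; split=> z; [case=> // -[[]]|left].
Qed.

(** For t > 0 this is a dilation. For t = 0 and k > 0, the value v at scale 0 is at most s^(dk) W <=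
    s W for every s in (0, 1], hence vanishes. *)
Lemma fine_int_ht t k : 0 <= t ->
  fine (int_ht h k t) = t ^+ (d * k) * fine (int_ht h k 1).
Proof.
rewrite le_eqVlt => /predU1P[<-|t0]; last first.
  by rewrite int_ht_scale_gt0// fineM// int_ht_fin.
case: k => [|k]; first by rewrite muln0 expr0 mul1r !int_ht0.
rewrite expr0n muln_eq0 -leqn0 leqNgt d_gt0/= mul0r.
set v := fine _; have v0 : 0 <= v by rewrite fine_ge0 ?int_ht_ge0.
pose W := fine (int_ht h k.+1 1).
have W0 : 0 <= W by rewrite fine_ge0 ?int_ht_ge0.
have le s : 0 < s -> s <= 1 -> v <= s * W.
  move=> s0 s1; apply: (@le_trans _ _ (fine (int_ht h k.+1 s))).
    rewrite fine_le ?int_ht_fin ?(ltW s0)// !int_ht_ind0 ?(ltW s0)//.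
    apply: ge0_le_integral => //.
    - by move=> ys _; rewrite lee_fin ht_ind0_ge0.
    - by apply/measurable_EFinP; exact: measurable_ht_ind0.
    - by apply/measurable_EFinP; apply: measurable_ht_ind0; exact: ltW.
    - move=> ys _; rewrite lee_fin /ht_ind0 /ht_ind ler_nat.
      case H: (ht h 0 _) => //; rewrite (_ : ht h s _ = true)//.
      apply: ht_le H => //; [exact: finite_tuple_pts|exact: tuple_pts_neq0|exact: ltW].
  rewrite int_ht_scale_gt0// fineM ?int_ht_fin//= ler_wpM2r//.
  by rewrite -[leRHS]expr1 ler_wiXn2l ?(ltW s0)// muln_gt0 d_gt0.
apply/eqP; rewrite eq_le v0 andbT leNgt; apply/negP => vp.
(* The scale s = v / (2 (W + v)) would give v <= v W / (2 (W + v)) < v. *)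
have den : 0 < 2 * (W + v) by rewrite mulr_gt0// ltr_wpDl.
have := le (v / (2 * (W + v))) (divr_gt0 vp den).
rewrite ler_pdivrMr// mul1r mulrAC ler_pdivlMr//.
have Wv : 0 <= W * v by exact: mulr_ge0.
have vv : 0 < v * v by exact: mulr_gt0.
by move=> /(_ ltac:(lra)); nra.
Qed.

End complex_indicator.

(** * Tannery's theorem, binomial coefficients and power differences *)

Section real_sequences.
Context (R : realType).

Lemma series_le_lim (u : R^nat) n : (forall k, 0 <= u k) -> cvgn (series u) ->
  series u n <= limn (series u).
Proof.
move=> u0 cu; apply: nondecreasing_cvgn_le => //.
by apply/nondecreasing_series => k _ _.
Qed.

(** Dominated convergence for sums whose number of terms varies with j. The tails beyond [M] are
    below e / 3 uniformly thanks to [g], and the head converges as a finite sum. *)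
Lemma tannery (a_ : nat -> R^nat) (a g : R^nat) (N_ : nat -> nat) :
  (forall j m, 0 <= a_ j m) -> (\forall j \near \oo, forall m, a_ j m <= g m) ->
  (forall m, a_ j m @[j --> \oo] --> a m) -> cvgn (series g) ->
  (forall M, \forall j \near \oo, (M <= N_ j)%N) ->
  cvgn (series a) /\ series (a_ j) (N_ j) @[j --> \oo] --> limn (series a).
Proof.
move=> a_0 a_g a_a cg Noo.
have a0 m : 0 <= a m by apply: (cvgr_to_ge (a_a m)); exact: nearW.
have ag m : a m <= g m.
  by apply: (cvgr_to_le (a_a m)); apply: filterS a_g => j.
have g0 m : 0 <= g m by exact: le_trans (ag m).
have ca : cvgn (series a) by exact: (series_le_cvg a0 g0 ag).
split=> //; apply/cvgrPdist_le => e e0.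
have e3 : 0 < e / 3 by rewrite divr_gt0.
have [M _ HM] := cvgr_near_dist cg e3.
have {}HM n : (M <= n)%N -> `|series g n - limn (series g)| <= e / 3 by exact: HM.
have tail (u : R^nat) n : (forall m, 0 <= u m) -> (forall m, u m <= g m) -> (M <= n)%N ->
    series u M <= series u n <= series u M + e / 3.
  move=> u0 ug Mn.
  have E (v : R^nat) : series v n = series v M + \sum_(M <= i < n) v i.
    by rewrite /series/= (big_cat_nat (leq0n M) Mn).
  rewrite E lerDl sumr_ge0//= lerD2l.
  apply: (@le_trans _ _ (\sum_(M <= i < n) g i)); first exact: ler_sum.
  have h1 := series_le_lim n g0 cg; have := HM M (leqnn M).
  by rewrite ler_norml => /andP[h2 _]; move: h1 h2; rewrite E; lra.
have cM : series (a_ j) M @[j --> \oo] --> series a M.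
  by rewrite /series/=; apply: cvg_big; [exact: add_continuous|move=> i _].
have la : series a M <= limn (series a) <= series a M + e / 3.
  rewrite series_le_lim//=; apply: (cvgr_to_le ca); near=> n.
  have Mn : (M <= n)%N by near: n; exact: nbhs_infty_ge.
  by have /andP[] := tail a n a0 ag Mn.
near=> j.
have h1 : `|series (a_ j) M - series a M| <= e / 3.
  by near: j; exact: cvgr_near_dist cM _ e3.
have h2 : (M <= N_ j)%N by near: j.
have h3 : forall m, a_ j m <= g m by near: j.
have /andP[h4 h5] := tail (a_ j) (N_ j) (a_0 j) h3 h2.
move: h1; rewrite !ler_norml => /andP[k1 k2].
by move: la => /andP[l1 l2]; apply/andP; split; lra.
Unshelve. all: by end_near.
Qed.

(** The falling factorial has m factors N - i, and (N - i) y -> xi for each i because y -> 0. *)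
Lemma ffact_cvg (N_ : nat -> nat) (y : R^nat) (xi : R) :
  (N_ j)%:R * y j @[j --> \oo] --> xi -> y j @[j --> \oo] --> (0 : R) ->
  (forall M, \forall j \near \oo, (M <= N_ j)%N) ->
  forall m, (N_ j ^_ m)%:R * y j ^+ m @[j --> \oo] --> xi ^+ m.
Proof.
move=> cN cy Noo; elim=> [|m IH].
  rewrite expr0 (_ : (fun j => _) = cst 1); first exact: cvg_cst.
  by apply/funext => j; rewrite ffactn0 expr0 mulr1.
rewrite exprSr.
have c1 : (N_ j)%:R * y j - m%:R * y j @[j --> \oo] --> xi.
  rewrite -[X in _ --> X](subr0 xi) -(mulr0 m%:R); apply: cvgB => //.
  by apply: cvgM => //; exact: cvg_cst.
have c2 : (N_ j ^_ m)%:R * y j ^+ m * ((N_ j)%:R * y j - m%:R * y j) @[j --> \oo]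
    --> xi ^+ m * xi by exact: cvgM.
apply: cvg_trans c2; apply: near_eq_cvg.
apply: filterS (Noo m) => j mN.
by rewrite /= ffactnSr natrM natrB// exprSr; ring.
Qed.

Lemma bin_cvg (N_ : nat -> nat) (y : R^nat) (xi : R) :
  (N_ j)%:R * y j @[j --> \oo] --> xi -> y j @[j --> \oo] --> (0 : R) ->
  (forall M, \forall j \near \oo, (M <= N_ j)%N) ->
  forall m, 'C(N_ j, m)%:R * y j ^+ m @[j --> \oo] --> xi ^+ m / m`!%:R.
Proof.
move=> cN cy Noo m.
have c2 : (N_ j ^_ m)%:R * y j ^+ m * m`!%:R^-1 @[j --> \oo] --> xi ^+ m / m`!%:R.
  by apply: cvgM; [exact: ffact_cvg|exact: cvg_cst].
apply: cvg_trans c2; apply: near_eq_cvg; apply: nearW => j /=.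
by rewrite -bin_ffact natrM; field; rewrite pnatr_eq0 -lt0n fact_gt0.
Qed.

Lemma bin_le (n m : nat) : 'C(n, m)%:R <= n%:R ^+ m / m`!%:R :> R.
Proof.
rewrite ler_pdivlMr ?ltr0n ?fact_gt0// -natrM bin_ffact -natrX ler_nat.
elim: m => [|m IH]; first by rewrite ffactn0 expn0.
by rewrite ffactnSr expnSr leq_mul// leq_subr.
Qed.

Lemma cvg_series_exp (A B : R) : cvgn (series (fun m => A * (B ^+ m / m`!%:R))).
Proof. exact: (@is_cvg_seriesZ _ _ A (is_cvg_series_exp_coeff B)). Qed.

(** The factor p of the mean value bound p (t' - t) T^(p-1) is absorbed into 2^p. What remains is
    the same monomial at 2T, so that summation over powers needs no new series. *)
Lemma powr_diff_le (T t t' : R) (p : nat) : 0 < T -> 0 <= t -> t <= t' -> t' <= T ->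
  t' ^+ p - t ^+ p <= (t' - t) / T * (2 * T) ^+ p.
Proof.
move=> T0 t0 tt' t'T; have t'0 : 0 <= t' by exact: le_trans tt'.
have d0 : 0 <= t' - t by rewrite subr_ge0.
have TT0 : 0 <= 2 * T by rewrite mulr_ge0// ltW.
elim: p => [|p IH].
  by rewrite !expr0 subrr mulr1 divr_ge0// ltW.
have E : t' ^+ p.+1 - t ^+ p.+1 = t' * (t' ^+ p - t ^+ p) + (t' - t) * t ^+ p.
  by rewrite !exprS; ring.
rewrite E.
set Q := (t' - t) / T * (2 * T) ^+ p.
have Q0 : 0 <= Q by rewrite mulr_ge0 ?exprn_ge0// divr_ge0// ltW.
have h1 : t' * (t' ^+ p - t ^+ p) <= T * Q.
  apply: (@le_trans _ _ (t' * Q)); first by rewrite ler_wpM2l.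
  by rewrite ler_wpM2r.
have h2 : (t' - t) * t ^+ p <= T * Q.
  have -> : T * Q = (t' - t) * (2 * T) ^+ p by rewrite /Q; field; rewrite gt_eqF.
  rewrite ler_wpM2l// lerXn2r ?nnegrE//.
  by apply: (le_trans tt'); apply: (le_trans t'T); lra.
have -> : (t' - t) / T * (2 * T) ^+ p.+1 = T * Q + T * Q by rewrite /Q exprS; ring.
exact: lerD.
Qed.

End real_sequences.

(** * Variance of sums of indicators and sums over index sets *)

Section indicator_sums.
Context dO (Omega : measurableType dO) (R : realType) (Pr : probability Omega R).
Context (J : Type) (l : seq J) (E : J -> set Omega).
Hypothesis mE : forall i, measurable (E i).

Let A w : R := \sum_(i <- l) \1_(E i) w.
Let p i := fine (Pr (E i)).

Let pE i : Pr (E i) = (p i)%:E.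
Proof. by rewrite fineK// fin_num_measure. Qed.

Let A0 w : 0 <= A w.
Proof. by rewrite sumr_ge0// => i _; rewrite indicE ler0n. Qed.

Let mA : measurable_fun setT A.
Proof. by apply: measurable_sum => i; exact: measurable_indic. Qed.

Lemma int_indicator_sum : (\int[Pr]_w (A w)%:E = (\sum_(i <- l) p i)%:E)%E.
Proof.
under eq_integral do rewrite /A -sumEFin.
rewrite ge0_integral_sum//; last by move=> i; apply/measurable_EFinP; exact: measurable_indic.
rewrite -sumEFin; apply: eq_bigr => i _.
by rewrite integralT_indic//; exact: pE.
Qed.

Lemma variance_indicator_sum :
  (\int[Pr]_w ((A w - \sum_(i <- l) p i) ^+ 2)%:E =
   (\sum_(i <- l) \sum_(j <- l) (fine (Pr (E i `&` E j)) - p i * p j))%:E)%E.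
Proof.
set a := \sum_(i <- l) p i.
have a0 : 0 <= a by rewrite sumr_ge0// => i _; exact: fine_ge0.
have sq : (\int[Pr]_w (A w ^+ 2)%:E =
    (\sum_(i <- l) \sum_(j <- l) fine (Pr (E i `&` E j)))%:E)%E.
  have EA w : (A w ^+ 2)%:E = (\sum_(i <- l) \sum_(j <- l) (\1_(E i `&` E j) w)%:E)%E.
    rewrite expr2 /A mulr_suml -sumEFin; apply: eq_bigr => i _.
    by rewrite mulr_sumr -sumEFin; apply: eq_bigr => j _; rewrite indicI.
  under eq_integral do rewrite EA.
  have mI i j : measurable (E i `&` E j) by exact: measurableI.
  rewrite ge0_integral_sum//.
  - rewrite -sumEFin; apply: eq_bigr => i _; rewrite ge0_integral_sum//.
      rewrite -sumEFin; apply: eq_bigr => j _.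
      by rewrite integralT_indic// fineK// fin_num_measure.
    by move=> j; apply/measurable_EFinP; exact: measurable_indic.
  - by move=> i; apply: emeasurable_sum => j; apply/measurable_EFinP; exact: measurable_indic.
  - by move=> i w _; apply: sume_ge0 => j _; rewrite lee_fin indicE ler0n.
(* The cross term stays on the left, so that only nonnegative functions are integrated. *)
have lhs : (\int[Pr]_w ((A w - a) ^+ 2)%:E + (2 * a * a)%:E =
    \int[Pr]_w (A w ^+ 2)%:E + (a ^+ 2)%:E)%E.
  have -> : ((2 * a * a)%:E = \int[Pr]_w ((2 * a)%:E * (A w)%:E))%E.
    rewrite ge0_integralZl//; last 3 first.
    - exact/measurable_EFinP.
    - by move=> w _; rewrite lee_fin.
    - by rewrite lee_fin mulr_ge0.
    by rewrite int_indicator_sum -EFinM.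
  have -> : ((a ^+ 2)%:E = \int[Pr]_w (a ^+ 2)%:E)%E.
    rewrite integral_cst// -[LHS]mule1; congr (_ * _)%E.
    exact/esym/probability_setT.
  rewrite -!ge0_integralD//.
  - by apply: eq_integral => w _; rewrite -EFinM -!EFinD; congr EFin; ring.
  - by move=> w _; rewrite lee_fin sqr_ge0.
  - by apply/measurable_EFinP; exact: measurable_funX.
  - by move=> w _; rewrite lee_fin sqr_ge0.
  - by move=> w _; rewrite lee_fin sqr_ge0.
  - by apply/measurable_EFinP; apply: measurable_funX; exact: measurable_funB.
  - by move=> w _; rewrite -EFinM lee_fin !mulr_ge0.
  - by apply: emeasurable_funM => //; exact/measurable_EFinP.
have h : (\int[Pr]_w ((A w - a) ^+ 2)%:E =
    \int[Pr]_w (A w ^+ 2)%:E + (a ^+ 2)%:E - (2 * a * a)%:E)%E.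
  by rewrite -lhs addeK.
rewrite h sq.
change (((\sum_(i <- l) \sum_(j <- l) fine (Pr (E i `&` E j))) + a ^+ 2 - 2 * a * a)%:E =
  (\sum_(i <- l) \sum_(j <- l) (fine (Pr (E i `&` E j)) - p i * p j))%:E).
congr EFin.
under [in RHS]eq_bigr do rewrite sumrB -mulr_sumr.
rewrite sumrB -mulr_suml -/a; ring.
Qed.

End indicator_sums.

Section set_sums.
Context (R : realType) (n : nat).

Lemma sum_sets_by_card (Q : pred nat) (F : nat -> R) :
  \sum_(I : {set 'I_n} | Q #|I|) F #|I| = \sum_(u < n.+1 | Q u) 'C(n, u)%:R * F u.
Proof.
have lt (I : {set 'I_n}) : (#|I| < n.+1)%N by rewrite ltnS -[n in (_ <= n)%N]card_ord max_card.
rewrite (partition_big (fun I => Ordinal (lt I)) (fun u : 'I_n.+1 => Q u))//=.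
apply: eq_bigr => u Qu.
rewrite (eq_bigr (fun=> F u)); last by move=> I /andP[_ /eqP <-].
rewrite sumr_const -[LHS]mulr_natl; congr (_%:R * _).
have := card_draws 'I_n u; rewrite card_ord => <-; apply: eq_card => I.
rewrite !inE unfold_in; apply/andP/eqP => [[_ /eqP <-]//|Iu].
by split; [rewrite Iu|apply/eqP/val_inj].
Qed.

(** Pairs are grouped by their union U. Both members are subsets of U, so there are at most 4^|U| of
    them, and U is nonempty because they meet. *)
Lemma sum_pairs_union_le (F : nat -> R) : (forall u, 0 <= F u) ->
  \sum_(I : {set 'I_n}) \sum_(J : {set 'I_n} | ~~ [disjoint I & J]) F #|I :|: J| <=
  \sum_(u < n.+1 | (0 < u)%N) 'C(n, u)%:R * (4 ^+ u * F u).
Proof.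
move=> F0; rewrite pair_big_dep/=.
rewrite (partition_big (fun p : {set 'I_n} * {set 'I_n} => p.1 :|: p.2)
  (fun U => (0 < #|U|)%N))/=; last first.
  move=> [I J] /=; rewrite card_gt0; apply: contra => /eqP U0.
  have := finset.subsetUl I J; rewrite U0 finset.subset0 => /eqP ->.
  by rewrite -setI_eq0 finset.set0I.
rewrite -(sum_sets_by_card (fun u => (0 < u)%N) (fun u => 4 ^+ u * F u)).
apply: ler_sum => U _.
rewrite (eq_bigr (fun=> F #|U|)); last by move=> p /andP[_ /eqP <-].
rewrite sumr_const -[leLHS]mulr_natl ler_wpM2r//.
have -> : 4 ^+ #|U| = #|finset.setX (powerset U) (powerset U)|%:R :> R.
  by rewrite cardsX !card_powerset -expnMn natrX.
rewrite ler_nat; apply: subset_leq_card; apply/fintype.subsetP => -[I J].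
rewrite unfold_in/= => /andP[_ /eqP <-].
by rewrite !inE/= finset.subsetUl finset.subsetUr.
Qed.

End set_sums.

Lemma prod_nat_bool (R : realType) n (F : 'I_n -> bool) :
  \prod_(i < n) (F i)%:R = [forall i, F i]%:R :> R.
Proof.
have [/forallP h|/forallPn[i /negbTE Fi]] := boolP [forall i, F i].
  by rewrite big1// => i _; rewrite h.
by rewrite (bigD1 i)//= Fi mul0r.
Qed.

(** * Simplices outside a ball: probabilities, independence, overlaps *)

Section tail_events.
Context (R : realType) (d : nat).
Context dO (Omega : measurableType dO) (Pr : probability Omega R).
Variables (X : nat -> Omega -> d.-tuple R) (fr : R -> R) (h : set (d.-tuple R) -> bool).
Local Notation P := (d.-tuple R).
Local Notation mu := (lebP R d).
Hypothesis mX : forall i, measurable_fun setT (X i).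
Hypothesis indep : forall (I : seq nat) (A : nat -> set P),
  uniq I -> (forall i, measurable (A i)) ->
  Pr (\bigcap_(i in [set` I]) (X i @^-1` A i)) =
  (\prod_(i <- I) Pr (X i @^-1` A i))%E.
Hypothesis mfr : measurable_fun setT fr.
Hypothesis fr_ge0 : forall r, 0 <= r -> 0 <= fr r.
Hypothesis law : forall i (A : set P), measurable A ->
  Pr (X i @^-1` A) = (\int[mu]_x (\1_A x * fr (enorm x))%:E)%E.
Hypothesis hshift : forall (Xs : set P) (y : P), finite_set Xs -> Xs !=set0 ->
  h ((fun x => tadd x y) @` Xs) = h Xs.
Variable c : R.
Hypothesis c_gt0 : 0 < c.
Hypothesis hdiam : forall Xs : set P, finite_set Xs -> Xs !=set0 ->
  (exists x y, Xs x /\ Xs y /\ c < enorm (tadd x (tscale (-1) y))) -> h Xs = false.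
Hypothesis hmono : forall (Xs : set P) (s t : R), finite_set Xs -> Xs !=set0 ->
  0 < s -> s <= t -> ht h s Xs -> ht h t Xs.
Hypothesis mh : forall m : nat, measurable_fun setT
  (fun x : m.-tuple P => (h (tuple_pts x))%:R : R).

Let mfre : measurable_fun setT (fun x : P => fr (enorm x)).
Proof. by apply: (measurableT_comp mfr); exact: measurable_enorm. Qed.

Let fre_ge0 (x : P) : 0 <= fr (enorm x).
Proof. by rewrite fr_ge0 ?enorm_ge0. Qed.

Definition tail_set (rho : R) m (kap : m.-tuple P -> bool) : set (m.-tuple P) :=
  [set z | kap z && [forall i, rho <= enorm (tnth z i)]].

Lemma indic_tail_set rho m (kap : m.-tuple P -> bool) z :
  \1_(tail_set rho kap) z =
  (kap z)%:R * \prod_(i < m) \1_`[rho, +oo[%classic (enorm (tnth z i)) :> R.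
Proof.
under eq_bigr do rewrite indic_itv_ge.
rewrite prod_nat_bool -natrM mulnb indicE; congr (nat_of_bool _)%:R.
by apply/idP/idP => [/set_mem//|hz]; exact/mem_set.
Qed.

Lemma measurable_tail_set rho m (kap : m.-tuple P -> bool) :
  measurable_fun setT (fun z => (kap z)%:R : R) -> measurable (tail_set rho kap).
Proof.
move=> mk; apply/(measurable_indicP R).
rewrite (_ : \1_(tail_set rho kap) = fun z => (kap z)%:R *
   \prod_(i < m) \1_`[rho, +oo[%classic (enorm (tnth z i)) :> R).
  apply: measurable_funM => //.
  apply: (@measurable_prod_tnth _ _ _ _ (fun=> fun x => \1_`[rho, +oo[%classic (enorm x))) => _.
  apply: (measurableT_comp (measurable_indic (measurable_itv _))).
  exact: measurable_enorm.
by apply/funext => z; exact: indic_tail_set.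
Qed.

Lemma prob_tail_set s rho (kap : (size s).-tuple P -> bool) : uniq s ->
  measurable_fun setT (fun z => (kap z)%:R : R) ->
  Pr (block X s @^-1` tail_set rho kap) =
  (\int[pow_measure mu (size s)]_z ((kap z)%:R * tail_prod fr rho z)%:E)%E.
Proof.
move=> us mk; rewrite (block_law mX indep mfre fre_ge0 law us); last first.
  exact: measurable_tail_set.
rewrite integral_mkcond; apply: eq_integral => z _.
have := indic_tail_set rho kap z; rewrite patchE indicE /tail_prod big_split/= mulrA => <-.
by case: (_ \in _); rewrite ?mul1r ?mul0r.
Qed.

Lemma tuple_pts_block s w : tuple_pts (block X s w) = [set z | exists2 j, j \in s & z = X j w].
Proof.
apply/seteqP; split=> z.
  by move=> [j ->]; exists (tnth (in_tuple s) j); [exact: mem_tnth|rewrite tnth_block].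
move=> [j js ->]; have jlt : (index j s < size s)%N by rewrite index_mem.
exists (Ordinal jlt); rewrite tnth_block (tnth_nth 0%N)/= nth_index//.
Qed.

Lemma block_forall s w (q : P -> bool) :
  [forall i, q (tnth (block X s w) i)] = all (fun j => q (X j w)) s.
Proof.
apply/forallP/allP => H j.
  move=> js; have jlt : (index j s < size s)%N by rewrite index_mem.
  by have := H (Ordinal jlt); rewrite tnth_block (tnth_nth 0%N)/= nth_index.
by rewrite tnth_block; apply: H; exact: mem_tnth.
Qed.

Definition set_seq n (I : {set 'I_n}) : seq nat := [seq val i | i <- enum I].

Lemma size_set_seq n (I : {set 'I_n}) : size (set_seq I) = #|I|.
Proof. by rewrite size_map -cardE. Qed.

Lemma uniq_set_seq n (I : {set 'I_n}) : uniq (set_seq I).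
Proof. by rewrite map_inj_uniq ?enum_uniq//; exact: val_inj. Qed.

Lemma mem_set_seq n (I : {set 'I_n}) j :
  reflect (exists2 i, i \in I & j = val i) (j \in set_seq I).
Proof.
apply: (iffP mapP) => -[i iI ->]; exists i => //; first by rewrite mem_enum in iI.
by rewrite mem_enum.
Qed.

Definition simplex_event n (rho t : R) (I : {set 'I_n}) (w : Omega) : bool :=
  ht h t (pts_of I (fun i : 'I_n => X i w)) && [forall i in I, rho <= enorm (X i w)].

Lemma simplex_eventE n rho t (I : {set 'I_n}) :
  [set w | simplex_event rho t I w] =
  block X (set_seq I) @^-1` tail_set rho (fun z => ht h t (tuple_pts z)).
Proof.
apply/seteqP; split=> w; rewrite /= /tail_set/= /simplex_event.
all: have -> : pts_of I (fun i : 'I_n => X i w) = tuple_pts (block X (set_seq I) w)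
  by (rewrite tuple_pts_block; apply/seteqP; split=> z [i];
   [move=> [iI ->]; exists (val i) => //; apply/mem_set_seq; exists i
   |move=> /mem_set_seq[j jI ->] ->; exists j]).
all: rewrite (block_forall _ _ (fun y => rho <= enorm y)).
all: have -> : all (fun j => rho <= enorm (X j w)) (set_seq I) =
     [forall i in I, rho <= enorm (X i w)] by
  (apply/allP/forall_inP => H j; [move=> jI; apply: H; apply/mem_set_seq; exists j
    |move=> /mem_set_seq[i iI ->]; exact: H]).
all: by [].
Qed.

Definition simplex_prob (rho t : R) m : R :=
  fine (\int[pow_measure mu m]_z (ht_ind h t z * tail_prod fr rho z)%:E)%E.

Let ht_meas t m : 0 <= t -> (0 < m)%N ->
  measurable_fun setT (fun z : m.-tuple P => (ht h t (tuple_pts z))%:R : R).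
Proof. by case: m => // m t0 _; exact: (measurable_ht_ind hmono mh). Qed.

Lemma measurable_simplex_event n rho t (I : {set 'I_n}) : 0 <= t -> I != finset.set0 ->
  measurable [set w | simplex_event rho t I w].
Proof.
move=> t0 I0; rewrite simplex_eventE -[X in measurable X]setTI.
apply: (measurable_block mX) => //; apply: measurable_tail_set; apply: ht_meas => //.
by rewrite size_set_seq card_gt0.
Qed.

Lemma prob_simplex_event n rho t (I : {set 'I_n}) : 0 <= t -> I != finset.set0 ->
  fine (Pr [set w | simplex_event rho t I w]) = simplex_prob rho t #|I|.
Proof.
move=> t0 I0; rewrite simplex_eventE prob_tail_set; last 2 first.
- exact: uniq_set_seq.
- by apply: ht_meas => //; rewrite size_set_seq card_gt0.
by rewrite -size_set_seq.
Qed.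

Lemma simplex_event_indep n rho t (I J : {set 'I_n}) : 0 <= t ->
  I != finset.set0 -> J != finset.set0 -> I :&: J = finset.set0 ->
  fine (Pr ([set w | simplex_event rho t I w] `&` [set w | simplex_event rho t J w])) =
  fine (Pr [set w | simplex_event rho t I w]) * fine (Pr [set w | simplex_event rho t J w]).
Proof.
move=> t0 I0 J0 dIJ.
have mI := measurable_simplex_event rho t0 I0.
have mJ := measurable_simplex_event rho t0 J0.
rewrite -fineM ?fin_num_measure//; congr fine.
rewrite !simplex_eventE (block_indep mX indep)//.
- rewrite cat_uniq !uniq_set_seq andbT/=; apply/hasPn => j /mem_set_seq[i iJ ->].
  apply/negP => /mem_set_seq[i' iI /val_inj ii'].
  by have := finset.in_set0 i; rewrite -dIJ inE iJ ii' iI.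
- by apply: measurable_tail_set; apply: ht_meas => //; rewrite size_set_seq card_gt0.
- by apply: measurable_tail_set; apply: ht_meas => //; rewrite size_set_seq card_gt0.
Qed.

Section star_bound.
Variables (r0 C b : R).
Hypothesis r00 : 0 < r0.
Hypothesis C0 : 0 < C.
Hypothesis db : d%:R < b.
Hypothesis fr_gt0 : forall r, r0 <= r -> 0 < fr r.
Hypothesis fr_le : forall r t, r0 <= r -> 1 <= t -> fr (r * t) / fr r <= C * t `^ (- b).

(** The bound of [tail_integral_le] for the star kernel: the centre brings the volume factor rho^d,
    and each of the m - 1 other vertices the volume of a ball around the centre. *)
Definition star_bound (rho t : R) (m : nat) : R :=
  rho ^+ d * (C * fr rho) ^+ m * (@surf R d / (b - d%:R)) * ball_vol d (c * (t + 1)) ^+ m.-1.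

Let coef_ge0 rho m : r0 <= rho ->
  0 <= rho ^+ d * (C * fr rho) ^+ m * (@surf R d / (b - d%:R)).
Proof.
move=> rr; apply: mulr_ge0; last by rewrite divr_ge0 ?surf_ge0// subr_ge0 ltW.
apply: mulr_ge0; rewrite exprn_ge0//; first by rewrite ltW// (lt_le_trans r00).
by rewrite mulr_ge0 ?(ltW C0)// ltW// fr_gt0.
Qed.

Lemma star_bound_ge0 rho t m : r0 <= rho -> 0 <= star_bound rho t m.
Proof.
move=> rr; apply: mulr_ge0; first exact: coef_ge0.
by rewrite exprn_ge0// fine_ge0.
Qed.

Lemma simplex_prob_le rho t m : 0 <= t -> r0 <= rho ->
  simplex_prob rho t m.+1 <= star_bound rho t m.+1.
Proof.
move=> t0 rr.
have le : (\int[pow_measure mu m.+1]_z (ht_ind h t z * tail_prod fr rho z)%:E <=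
    (star_bound rho t m.+1)%:E)%E.
  apply: (le_trans (@tail_integral_le R d fr mfr fr_ge0 m
    (@ht_ind R d h t m.+1) (@ht_ind0 R d h t m) _ _ _ _ _ r0 C b r00 C0 db fr_gt0 fr_le rho rr)).
  - exact: (measurable_ht_ind hmono mh).
  - exact: (measurable_ht_ind0 hmono mh).
  - by move=> ys; exact: ht_ind0_ge0.
  - by move=> z; exact: ht_ind_ge0.
  - by move=> x ys; exact: (ht_ind_centered hshift).
  rewrite -(int_ht_ind0 hmono mh)// /star_bound [leRHS]EFinM; apply: lee_wpmul2l.
    by rewrite lee_fin coef_ge0.
  exact: int_ht_le.
rewrite -lee_fin fineK// ge0_fin_numE; first by apply: (le_lt_trans le); rewrite ltry.
by apply: integral_ge0 => z _; rewrite lee_fin mulr_ge0 ?ht_ind_ge0// tail_prod_ge0.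
Qed.

Lemma simplex_prob_ge0 rho t m : 0 <= simplex_prob rho t m.
Proof.
apply: fine_ge0; apply: integral_ge0 => z _.
by rewrite lee_fin mulr_ge0 ?ht_ind_ge0// tail_prod_ge0.
Qed.

(** If both simplices contain the vertex [i0], all vertices of the union lie within c (t + 1) of it:
    the joint event is contained in a star event on |U| points. *)
Lemma simplex_event_meet n rho t (I J : {set 'I_n}) : 0 <= t -> r0 <= rho ->
  I :&: J != finset.set0 ->
  fine (Pr ([set w | simplex_event rho t I w] `&` [set w | simplex_event rho t J w])) <=
  star_bound rho t #|I :|: J|.
Proof.
move=> t0 rr /finset.set0Pn[i0]; rewrite inE => /andP[iI iJ].
set U := I :|: J; have iU : i0 \in U by rewrite inE iI.
(* The common vertex comes first, as the centre of the star. *)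
pose s := val i0 :: set_seq (U :\ i0).
have us : uniq s.
  rewrite /= uniq_set_seq andbT; apply/mem_set_seq => -[i iU' /val_inj ii].
  by move: iU'; rewrite !inE -ii eqxx.
have ss : size s = #|U| by rewrite /= size_set_seq (cardsD1 i0 U) iU.
pose kap (z : (size s).-tuple P) : bool := [forall i : 'I_(size (set_seq (U :\ i0))),
  (enorm (tadd (tnth z (lift ord0 i)) (tscale (-1) (thead z))) <= c * (t + 1))%R].
have kapE z : (kap z)%:R = star_ind (c * (t + 1)) z by rewrite -prod_nat_bool.
have mk : measurable_fun setT (fun z => (kap z)%:R : R).
  apply: (eq_measurable_fun (@star_ind R d (c * (t + 1)) _)) => //.
  exact: measurable_star_ind.
have P1 := prob_tail_set rho us mk.
have le : (Pr (block X s @^-1` tail_set rho kap) <= (star_bound rho t #|U|)%:E)%E.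
  rewrite P1 -ss /star_bound [leRHS]EFinM -int_ball_ind.
  under eq_integral do rewrite kapE.
  pose k := size (set_seq (U :\ i0)).
  exact: (@tail_integral_le R d fr mfr fr_ge0 k
    (@star_ind R d (c * (t + 1)) k) (@ball_ind R d (c * (t + 1)) k)
    (@measurable_star_ind R d _ k) (@measurable_ball_ind R d _ k)
    (@ball_ind_ge0 R d _ k) (@star_ind_ge0 R d _ k) (@star_ind_centered R d _ k)
    r0 C b r00 C0 db fr_gt0 fr_le rho rr).
have mE : measurable (block X s @^-1` tail_set rho kap).
  rewrite -[X in measurable X]setTI; apply: (measurable_block mX) => //.
  exact: measurable_tail_set.
have I0 : I != finset.set0 by apply/finset.set0Pn; exists i0.
have J0 : J != finset.set0 by apply/finset.set0Pn; exists i0.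
have mI := measurable_simplex_event rho t0 I0.
have mJ := measurable_simplex_event rho t0 J0.
rewrite -lee_fin fineK; last by rewrite fin_num_measure//; exact: measurableI.
apply: (le_trans _ le); apply: le_measure; rewrite ?inE//; first exact: measurableI.
move=> w [/= /andP[hI /forall_inP rI] /andP[hJ /forall_inP rJ]].
have fin_pts (K : {set 'I_n}) : finite_set (pts_of K (fun i : 'I_n => X i w)).
  apply: (@sub_finite_set _ _ ((fun i : 'I_n => X i w) @` [set: 'I_n])).
    by move=> z [i [_ ->]]; exists i.
  by apply: finite_image; exact: finite_finset.
have close (K : {set 'I_n}) i : i0 \in K -> i \in K ->
    ht h t (pts_of K (fun i : 'I_n => X i w)) ->
    enorm (tadd (X i w) (tscale (-1) (X i0 w))) <= c * (t + 1).
  move=> i0K iK hK; apply: (ht_diam hdiam hmono (fin_pts K)) hK _ _ => //.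
  - by exists (X i0 w); exists i0.
  - by exists i.
  - by exists i0.
rewrite /tail_set/=; apply/andP; split.
  apply/forallP => i; rewrite tnth_block.
  have -> : thead (block X s w) = X i0 w by [].
  have /mem_set_seq[j] : tnth (in_tuple s) (lift ord0 i) \in set_seq (U :\ i0).
    by rewrite (tnth_nth 0%N) lift0 /= mem_nth.
  rewrite !inE => /andP[_ /orP[jI|jJ]] ->; first exact: close hI.
  exact: close hJ.
rewrite (block_forall s w (fun y => rho <= enorm y)); apply/allP => j.
rewrite inE => /predU1P[->|]; first exact: rI.
by move=> /mem_set_seq[i] + ->; rewrite !inE => /andP[_ /orP[/rI|/rJ]].
Qed.

End star_bound.
End tail_events.

(** * Means, variances and almost sure limits of the parity counts *)

Section parity_counts.
Context (R : realType) (d : nat).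
Context dO (Omega : measurableType dO) (Pr : probability Omega R).
Variables (X : nat -> Omega -> d.-tuple R) (fr : R -> R) (h : set (d.-tuple R) -> bool).
Variables (alpha xi : R).
Local Notation P := (d.-tuple R).
Local Notation mu := (lebP R d).
Hypothesis d_gt0 : (0 < d)%N.
Hypothesis mX : forall i, measurable_fun setT (X i).
Hypothesis indep : forall (I : seq nat) (A : nat -> set P),
  uniq I -> (forall i, measurable (A i)) ->
  Pr (\bigcap_(i in [set` I]) (X i @^-1` A i)) =
  (\prod_(i <- I) Pr (X i @^-1` A i))%E.
Hypothesis mfr : measurable_fun setT fr.
Hypothesis fr_ge0 : forall r, 0 <= r -> 0 <= fr r.
Hypothesis law : forall i (A : set P), measurable A ->
  Pr (X i @^-1` A) = (\int[mu]_x (\1_A x * fr (enorm x))%:E)%E.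
Hypothesis alphad : d%:R < alpha.
Hypothesis fr_rv : forall t, 0 < t ->
  (fun r => fr (r * t) / fr r) r @[r --> +oo] --> t `^ (- alpha).
Hypothesis xi_gt0 : 0 < xi.
Hypothesis h1 : forall x : P, h [set x].
Hypothesis hshift : forall (Xs : set P) (y : P), finite_set Xs -> Xs !=set0 ->
  h ((fun x => tadd x y) @` Xs) = h Xs.
Variable c : R.
Hypothesis c_gt0 : 0 < c.
Hypothesis hdiam : forall Xs : set P, finite_set Xs -> Xs !=set0 ->
  (exists x y, Xs x /\ Xs y /\ c < enorm (tadd x (tscale (-1) y))) -> h Xs = false.
Hypothesis hmono : forall (Xs : set P) (s t : R), finite_set Xs -> Xs !=set0 ->
  0 < s -> s <= t -> ht h s Xs -> ht h t Xs.
Hypothesis mh : forall m : nat, measurable_fun setT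
  (fun x : m.-tuple P => (h (tuple_pts x))%:R : R).

Definition parity_count (q : bool) n (rho t : R) (w : Omega) : R :=
  \sum_(I : {set 'I_n} | (0 < #|I|)%N && (odd #|I| == q))
    (simplex_event X h rho t I w)%:R.

Definition parity_mean (q : bool) n (rho t : R) : R :=
  series (fun k => (odd k.+1 == q)%:R * ('C(n, k.+1)%:R * simplex_prob fr h rho t k.+1)) n.

Let dlaw := law.

(** The guard on [#|I|] makes the event measurable for every index set, the empty one included, as
    [variance_indicator_sum] requires of the whole family. *)
Let ev n rho t (I : {set 'I_n}) : set Omega :=
  [set w | (0 < #|I|)%N && simplex_event X h rho t I w].

Let evE n rho t (I : {set 'I_n}) : (0 < #|I|)%N ->
  ev rho t I = [set w | simplex_event X h rho t I w].
Proof. by move=> I0; apply/seteqP; split=> w; rewrite /ev/= I0. Qed.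

Let mev n rho t (I : {set 'I_n}) : 0 <= t -> measurable (ev rho t I).
Proof.
move=> t0; have [I0|I0] := boolP (0 < #|I|)%N.
  by rewrite evE//; apply: (measurable_simplex_event mX hmono mh); rewrite -?card_gt0.
by rewrite (_ : ev _ _ _ = set0)//; apply/seteqP; split=> w; rewrite /ev/= (negbTE I0).
Qed.

Let idx n (q : bool) : seq {set 'I_n} :=
  [seq I : {set 'I_n} <- index_enum {set 'I_n} | (0 < #|I|)%N && (odd #|I| == q)].

Let parity_countE q n rho t w : parity_count q n rho t w =
  \sum_(I <- idx n q) \1_(ev rho t I) w.
Proof.
rewrite /parity_count /idx big_filter; apply: eq_bigr => I /andP[I0 _].
rewrite indicE evE//; congr (nat_of_bool _)%:R.
by apply/idP/idP => [hz|/set_mem//]; exact/mem_set.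
Qed.

Lemma sum_card_gt0 q n (F : nat -> R) :
  \sum_(I : {set 'I_n} | (0 < #|I|)%N && (odd #|I| == q)) F #|I| =
  series (fun k => (odd k.+1 == q)%:R * ('C(n, k.+1)%:R * F k.+1)) n.
Proof.
rewrite (sum_sets_by_card n (fun u => (0 < u)%N && (odd u == q))) big_mkcond/= big_ord_recl/= add0r.
rewrite /series/= big_mkord; apply: eq_bigr => k _.
by rewrite /bump leq0n add1n /=; case: (_ == q); rewrite ?mul1r ?mul0r.
Qed.

Lemma prob_sum_mean q n rho t : 0 <= t ->
  \sum_(I <- idx n q) fine (Pr (ev rho t I)) = parity_mean q n rho t.
Proof.
move=> t0; rewrite /idx big_filter /parity_mean -(sum_card_gt0 q n (simplex_prob fr h rho t)).
apply: eq_bigr => I /andP[I0 _]; rewrite evE//.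
by apply: (prob_simplex_event mX indep mfr fr_ge0 dlaw hmono mh) => //; rewrite -card_gt0.
Qed.

Section bounds.
Variables (r0 C b : R).
Hypothesis r00 : 0 < r0.
Hypothesis C0 : 0 < C.
Hypothesis db : d%:R < b.
Hypothesis fr_gt0 : forall r, r0 <= r -> 0 < fr r.
Hypothesis fr_le : forall r t, r0 <= r -> 1 <= t -> fr (r * t) / fr r <= C * t `^ (- b).

(** The summand 1 ensures V^(m-1) <= V^m, which aligns the exponent with that of the exponential
    series. *)
Let V t : R := ball_vol d (c * (t + 1)) + 1.
Let S : R := @surf R d / (b - d%:R).

Let V_ge1 t : 1 <= V t.
Proof. by rewrite /V lerDr fine_ge0. Qed.

Let S_ge0 : 0 <= S.
Proof. by rewrite divr_ge0 ?surf_ge0// subr_ge0 ltW. Qed.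

(** The binomial coefficient is at most n^m / m!, and its n^m joins fr (rho)^m to give at most B^m:
    what is left is a term of an exponential series. *)
Let star_bound_le B n rho t m : r0 <= rho -> n%:R * fr rho <= B ->
  'C(n, m)%:R * (4 ^+ m * star_bound d fr c C b rho t m) <=
  rho ^+ d * (S * ((4 * C * B * V t) ^+ m / m`!%:R)).
Proof.
move=> rr nB; have rp : 0 < rho by exact: lt_le_trans rr.
have fp := fr_gt0 rr.
have B0 : 0 <= B by apply: le_trans nB; rewrite mulr_ge0// ltW.
have V0 : 0 <= ball_vol d (c * (t + 1)) by exact: fine_ge0.
have Vm : ball_vol d (c * (t + 1)) ^+ m.-1 <= V t ^+ m.
  apply: (@le_trans _ _ (V t ^+ m.-1)).
    by rewrite lerXn2r ?nnegrE// /V ?lerDl// addr_ge0.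
  by rewrite ler_weXn2l// leq_pred.
rewrite /star_bound.
have -> : 'C(n, m)%:R * (4 ^+ m * (rho ^+ d * (C * fr rho) ^+ m * (@surf R d / (b - d%:R)) *
    ball_vol d (c * (t + 1)) ^+ m.-1)) =
  (rho ^+ d * S) * (('C(n, m)%:R * (fr rho) ^+ m) * (4 ^+ m * C ^+ m * ball_vol d (c * (t + 1)) ^+ m.-1)).
  by rewrite /S exprMn; ring.
have -> : rho ^+ d * (S * ((4 * C * B * V t) ^+ m / m`!%:R)) =
  (rho ^+ d * S) * ((B ^+ m / m`!%:R) * (4 ^+ m * C ^+ m * V t ^+ m)).
  by rewrite !exprMn; ring.
apply: ler_wpM2l; first by rewrite mulr_ge0// exprn_ge0// ltW.
apply: ler_pM.
- by rewrite mulr_ge0// exprn_ge0// ltW.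
- by rewrite !mulr_ge0 ?exprn_ge0// ltW.
- apply: (@le_trans _ _ ((n%:R ^+ m / m`!%:R) * fr rho ^+ m)).
    by rewrite ler_wpM2r ?bin_le// exprn_ge0// ltW.
  rewrite mulrAC -exprMn ler_wpM2r ?invr_ge0//.
  by rewrite lerXn2r ?nnegrE// mulr_ge0// ltW.
- by rewrite ler_wpM2l// mulr_ge0// exprn_ge0// ltW.
Qed.

(** Disjoint index sets have zero covariance; for meeting ones the covariance is at most the joint
    probability, bounded through the union. Grouping by unions yields the exponential. *)
Lemma variance_parity_count B q n rho t : 0 <= t -> r0 <= rho -> n%:R * fr rho <= B ->
  (\int[Pr]_w ((parity_count q n rho t w - parity_mean q n rho t) ^+ 2)%:E <=
   (rho ^+ d * (S * expR (4 * C * B * V t)))%:E)%E.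
Proof.
move=> t0 rr nB; have rp : 0 < rho by exact: lt_le_trans rr.
have fp := fr_gt0 rr.
have B0 : 0 <= B by apply: le_trans nB; rewrite mulr_ge0// ltW.
under eq_integral do rewrite parity_countE.
rewrite -prob_sum_mean// variance_indicator_sum; last by move=> I; exact: mev.
have F0 u : 0 <= star_bound d fr c C b rho t u by exact: (star_bound_ge0 c r00 C0 db fr_gt0).
rewrite lee_fin.
apply: (@le_trans _ _ (\sum_(I : {set 'I_n}) \sum_(J : {set 'I_n} | ~~ [disjoint I & J])
    star_bound d fr c C b rho t #|I :|: J|)).
  rewrite /idx big_filter big_mkcond/=; apply: ler_sum => I _.
  case: ifP => [/andP[I0 _]|_]; last exact: sumr_ge0.
  rewrite big_filter big_mkcond/= [leRHS]big_mkcond/=; apply: ler_sum => J _.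
  have [J0|J0] := boolP (0 < #|J|)%N; last first.
    by rewrite /=; case: ifP.
  apply: (@le_trans _ _ (if odd #|J| == q then
     fine (Pr (ev rho t I `&` ev rho t J)) - fine (Pr (ev rho t I)) * fine (Pr (ev rho t J)) else 0)) => //.
  have I0' : I != finset.set0 by rewrite -card_gt0.
  have J0' : J != finset.set0 by rewrite -card_gt0.
  rewrite !evE//; case: ifP => _; last by case: ifP.
  rewrite -setI_eq0; case: (eqVneq (I :&: J) finset.set0) => IJ /=.
    by rewrite (simplex_event_indep mX indep hmono mh)// subrr.
  rewrite lerBlDr; apply: (@le_trans _ _ (star_bound d fr c C b rho t #|I :|: J|)).
    exact: (simplex_event_meet mX indep mfr fr_ge0 dlaw hdiam hmono mh r00 C0 db fr_gt0 fr_le).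
  by rewrite lerDl mulr_ge0// fine_ge0.
apply: (le_trans (sum_pairs_union_le n F0)).
apply: (@le_trans _ _ (\sum_(u < n.+1 | (0 < u)%N) rho ^+ d * (S * ((4 * C * B * V t) ^+ u / u`!%:R)))).
  by apply: ler_sum => u _; exact: star_bound_le.
rewrite -mulr_sumr ler_wpM2l ?exprn_ge0 ?(ltW rp)// -mulr_sumr ler_wpM2l//.
have e0 k : 0 <= exp_coeff (4 * C * B * V t) k.
  rewrite /exp_coeff/= divr_ge0// exprn_ge0// !mulr_ge0// ?(ltW C0)//.
  exact: le_trans (V_ge1 t).
apply: (le_trans _ (series_le_lim n.+1 e0 (is_cvg_series_exp_coeff _))).
rewrite /series/= big_mkord big_mkcond/=; apply: ler_sum => u _.
by case: ifP.
Qed.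

Lemma mean_term_le B n rho t m : 0 <= t -> r0 <= rho -> n%:R * fr rho <= B ->
  'C(n, m.+1)%:R * simplex_prob fr h rho t m.+1 / rho ^+ d <=
  S * ((4 * C * B * V t) ^+ m.+1 / m.+1`!%:R).
Proof.
move=> t0 rr nB; have rp : 0 < rho by exact: lt_le_trans rr.
rewrite ler_pdivrMr ?exprn_gt0// [leRHS]mulrC.
apply: (le_trans _ (star_bound_le t m.+1 rr nB)); rewrite ler_wpM2l//.
apply: (@le_trans _ _ (star_bound d fr c C b rho t m.+1)).
  exact: (simplex_prob_le mfr fr_ge0 hshift hdiam hmono mh r00 C0 db fr_gt0 fr_le).
by rewrite ler_peMl ?(star_bound_ge0 c r00 C0 db fr_gt0)// exprn_ege1// ler1n.
Qed.

Definition parity_limit (q : bool) (t : R) : R :=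
  limn (series (fun k => (odd k.+1 == q)%:R * s_k h alpha xi k t)).

Section along_sequence.
Hypothesis balpha : b < alpha.
Variables (N_ : nat -> nat) (rho_ : nat -> R).
Hypothesis Noo : forall M, \forall j \near \oo, (M <= N_ j)%N.
Hypothesis rhooo : rho_ j @[j --> \oo] --> +oo.
Hypothesis Nxi : (N_ j)%:R * fr (rho_ j) @[j --> \oo] --> xi.

Let rho_ge : \forall j \near \oo, r0 <= rho_ j.
Proof. exact: cvgry_near_ge. Qed.

Let B := xi + 1.

Let N_le : \forall j \near \oo, (N_ j)%:R * fr (rho_ j) <= B.
Proof.
have : \forall j \near \oo, (N_ j)%:R * fr (rho_ j) < B.
  by apply: (cvgr_lt xi) => //; rewrite /B ltrDl.
by apply: filterS => j /ltW.
Qed.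

Let fr_rho0 : fr (rho_ j) @[j --> \oo] --> (0 : R).
Proof.
have Nr : (N_ j)%:R @[j --> \oo] --> (+oo : set_system R).
  apply/cvgryPge => A; apply: filterS (Noo (Num.truncn A).+1) => j Nj.
  by rewrite (le_trans (ltW (truncnS_gt A)))// ler_nat.
have Ni : (N_ j)%:R^-1 @[j --> \oo] --> (0 : R).
  by apply/gtr0_cvgV0 => //; apply: filterS (Noo 1%N) => j; rewrite ltr0n.
have c2 : (N_ j)%:R^-1 * ((N_ j)%:R * fr (rho_ j)) @[j --> \oo] --> 0 * xi by exact: cvgM.
rewrite mul0r in c2; apply: cvg_trans c2; apply: near_eq_cvg.
apply: filterS (Noo 1%N) => j Nj.
by rewrite mulrA mulVf ?mul1r// pnatr_eq0 -lt0n.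
Qed.

(** The factor fr (rho)^(k+1) is shared out: it turns the binomial coefficient into xi^(k+1) /
    (k+1)! and normalises the tail integral. *)
Lemma mean_term_cvg t k : 0 <= t ->
  'C(N_ j, k.+1)%:R * simplex_prob fr h (rho_ j) t k.+1 / rho_ j ^+ d @[j --> \oo] -->
  s_k h alpha xi k t.
Proof.
move=> t0.
have c1 : 'C(N_ j, k.+1)%:R * fr (rho_ j) ^+ k.+1 @[j --> \oo] -->
  xi ^+ k.+1 / k.+1`!%:R by exact: bin_cvg.
have phioo : (\int[pow_measure mu k]_ys (ht_ind0 h t ys)%:E < +oo)%E.
  rewrite -(int_ht_ind0 hmono mh)//.
  by apply: (le_lt_trans (int_ht_le hshift hdiam hmono mh k t0)); rewrite ltry.
have c2 := @tail_integral_cvg R d fr alpha mfr fr_ge0 fr_rv alphad k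
  (@ht_ind R d h t k.+1) (@ht_ind0 R d h t k) (measurable_ht_ind hmono mh t0)
  (measurable_ht_ind0 hmono mh t0) (@ht_ind0_ge0 R d h t k)
  (@ht_ind_ge0 R d h t k.+1) (@ht_ind_centered R d h hshift t k) r0 C b r00 C0 db fr_gt0 fr_le
  rho_ balpha rhooo phioo.
have E : s_k h alpha xi k t = xi ^+ k.+1 / k.+1`!%:R *
    (@surf R d / (alpha * k.+1%:R - d%:R) * fine (\int[pow_measure mu k]_ys (ht_ind0 h t ys)%:E)%E).
  rewrite -(int_ht_ind0 hmono mh)//; case: k {c1 phioo c2} => [|k].
    by rewrite (int_ht0 h1)// factS fact0 muln1 divr1 expr1 !mulr1 /=; ring.
  by rewrite /s_k invfM; ring.
have c3 : 'C(N_ j, k.+1)%:R * fr (rho_ j) ^+ k.+1 *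
    (simplex_prob fr h (rho_ j) t k.+1 / (rho_ j ^+ d * fr (rho_ j) ^+ k.+1))
    @[j --> \oo] --> s_k h alpha xi k t by rewrite E; exact: cvgM.
apply: cvg_trans c3; apply: near_eq_cvg; apply: filterS rho_ge => j rj.
have rp : 0 < rho_ j by exact: lt_le_trans rj.
have fp := fr_gt0 rj.
by rewrite /= /simplex_prob; field; rewrite !expf_neq0// gt_eqF.
Qed.

Let a_ t j k : R := if r0 <= rho_ j then
  'C(N_ j, k.+1)%:R * simplex_prob fr h (rho_ j) t k.+1 / rho_ j ^+ d else 0.

Lemma parity_mean_cvg q t : 0 <= t ->
  cvgn (series (fun k => (odd k.+1 == q)%:R * s_k h alpha xi k t)) /\
  parity_mean q (N_ j) (rho_ j) t / rho_ j ^+ d @[j --> \oo] --> parity_limit q t.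
Proof.
move=> t0.
pose y := 4 * C * B * V t.
(* The bound S y^(k+1) / (k+1)! is enlarged to S y times y^k / k!, which avoids shifting the
   exponential series. *)
pose g k := S * y * (y ^+ k / k`!%:R).
have B0 : 0 <= B by rewrite addr_ge0// ltW.
have V0 : 0 <= V t by exact: le_trans (V_ge1 t).
have y0 : 0 <= y by rewrite !mulr_ge0// ltW.
have g0 k : 0 <= g k.
  by apply: mulr_ge0; [exact: mulr_ge0|rewrite divr_ge0// exprn_ge0].
have cg : cvgn (series g) by exact: cvg_series_exp.
have a0 j k : 0 <= (odd k.+1 == q)%:R * a_ t j k.
  rewrite mulr_ge0// /a_; case: ifP => // rj.
  rewrite divr_ge0 ?exprn_ge0 ?mulr_ge0 ?simplex_prob_ge0//.
  by rewrite ltW// (lt_le_trans r00).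
have ag : \forall j \near \oo, forall k, (odd k.+1 == q)%:R * a_ t j k <= g k.
  near=> j; move=> k.
  have rj : r0 <= rho_ j by near: j.
  have Nj : (N_ j)%:R * fr (rho_ j) <= B by near: j.
  rewrite /a_ rj; apply: (@le_trans _ _ (S * (y ^+ k.+1 / k.+1`!%:R))).
    apply: (le_trans _ (mean_term_le k t0 rj Nj)).
    rewrite ler_piMl// ?lern1 ?leq_b1//.
    rewrite divr_ge0 ?exprn_ge0 ?mulr_ge0 ?simplex_prob_ge0//.
    by rewrite ltW// (lt_le_trans r00).
  rewrite /g -mulrA ler_wpM2l// exprS -mulrA ler_wpM2l// ler_wpM2l ?exprn_ge0//.
  by rewrite lef_pV2 ?posrE ?ltr0n ?fact_gt0// ler_nat factS leq_pmull.
have aa k : (odd k.+1 == q)%:R * a_ t j k @[j --> \oo] -->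
    (odd k.+1 == q)%:R * s_k h alpha xi k t.
  apply: cvgM; first exact: cvg_cst.
  have cm := @mean_term_cvg t k t0; apply: cvg_trans cm; apply: near_eq_cvg.
  by apply: filterS rho_ge => j rj; rewrite /a_ rj.
have [cs cl] := tannery a0 ag aa cg Noo.
split=> //; apply: cvg_trans cl; apply: near_eq_cvg; apply: filterS rho_ge => j rj.
rewrite /parity_mean /series/= mulr_suml; apply: eq_bigr => k _.
by rewrite /a_ rj !mulrA.
Unshelve. all: by end_near.
Qed.

(** The sum of the squared normalised deviations has expectation at most K times the given series.
    It is therefore almost surely finite, and its terms tend to 0. *)
Lemma parity_count_ae q t : 0 <= t -> cvgn (series (fun j => `|rho_ j|^-1 ^+ d)) ->
  {ae Pr, forall w, parity_count q (N_ j) (rho_ j) t w / rho_ j ^+ d @[j --> \oo] -->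
    parity_limit q t}.
Proof.
move=> t0 cr; have [_ cm] := parity_mean_cvg q t0.
(* Where the variance bound may fail, at finitely many j, [Z] is set to 0, so that its integral is
   bounded for every j. *)
pose good j := (r0 <= rho_ j) && ((N_ j)%:R * fr (rho_ j) <= B).
pose D j w := parity_count q (N_ j) (rho_ j) t w / rho_ j ^+ d -
              parity_mean q (N_ j) (rho_ j) t / rho_ j ^+ d.
pose Z j w : R := if good j then D j w ^+ 2 else 0.
pose K := S * expR (4 * C * B * V t).
have K0 : 0 <= K by rewrite mulr_ge0// expR_ge0.
have mA j : measurable_fun setT (parity_count q (N_ j) (rho_ j) t).
  rewrite (_ : parity_count _ _ _ _ = fun w => \sum_(I <- idx (N_ j) q) \1_(ev (rho_ j) t I) w).
    by apply: measurable_sum => I; apply: measurable_indic; exact: mev.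
  by apply/funext => w; exact: parity_countE.
have mZ j : measurable_fun setT (Z j).
  rewrite /Z; case: (good j); last exact: measurable_cst.
  apply: measurable_funX; apply: measurable_funB => //.
  exact: measurable_funM.
have Z0 j w : 0 <= Z j w by rewrite /Z; case: ifP => // _; exact: sqr_ge0.
have intZ j : (\int[Pr]_w (Z j w)%:E <= (K * `|rho_ j|^-1 ^+ d)%:E)%E.
  rewrite /Z; case: (boolP (good j)) => [/andP[rj Nj]|_]; last first.
    by rewrite integral0 lee_fin mulr_ge0// exprn_ge0// invr_ge0.
  have rp : 0 < rho_ j by exact: lt_le_trans rj.
  have rd : 0 < rho_ j ^+ d by exact: exprn_gt0.
  have E w : (D j w ^+ 2)%:E = (((rho_ j ^+ d) ^- 2)%:E *
      ((parity_count q (N_ j) (rho_ j) t w - parity_mean q (N_ j) (rho_ j) t) ^+ 2)%:E)%E.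
    by rewrite -EFinM /D -mulrBl exprMn exprVn mulrC.
  under eq_integral do rewrite E.
  rewrite ge0_integralZl//; last 3 first.
  - by apply/measurable_EFinP; apply: measurable_funX; exact: measurable_funB.
  - by move=> w _; rewrite lee_fin sqr_ge0.
  - by rewrite lee_fin invr_ge0 exprn_ge0// ltW.
  apply: (@le_trans _ _ (((rho_ j ^+ d) ^- 2)%:E * (rho_ j ^+ d * K)%:E)%E).
    apply: lee_wpmul2l; first by rewrite lee_fin invr_ge0 exprn_ge0// ltW.
    exact: variance_parity_count.
  rewrite -EFinM lee_fin gtr0_norm// exprVn le_eqVlt; apply/orP; left; apply/eqP.
  by field; rewrite expf_neq0// gt_eqF.
pose F w := (\sum_(0 <= j <oo) (Z j w)%:E)%E.
have mF : measurable_fun setT F.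
  by apply: ge0_emeasurable_sum => [k w _ _|k _]; [rewrite lee_fin|exact/measurable_EFinP].
have F0 w : (0 <= F w)%E by apply: nneseries_ge0 => k _ _; rewrite lee_fin.
have Foo : (\int[Pr]_w F w < +oo)%E.
  rewrite /F integral_nneseries//; last 2 first.
  - by move=> n; exact/measurable_EFinP.
  - by move=> n w _; rewrite lee_fin.
  apply: (@le_lt_trans _ _ (K * limn (series (fun j => `|rho_ j|^-1 ^+ d)))%:E); last by rewrite ltry.
  apply: lime_le.
    by apply: is_cvg_nneseries => n _ _; apply: integral_ge0 => w _; rewrite lee_fin.
  apply: nearW => n.
  apply: (@le_trans _ _ (\sum_(0 <= j < n) (K * `|rho_ j|^-1 ^+ d)%:E)%E).
    by apply: lee_sum => j _; exact: intZ.
  rewrite sumEFin lee_fin -mulr_sumr ler_wpM2l//.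
  by apply: (series_le_lim n _ cr) => k; rewrite exprn_ge0// invr_ge0.
have iF : Pr.-integrable setT F.
  apply/integrableP; split => //.
  by under eq_integral do rewrite gee0_abs//.
have aeF := integrable_ae measurableT iF.
have goodnear : \forall j \near \oo, good j.
  by near=> j; apply/andP; split; near: j.
apply: filterS aeF => w /(_ I) Fw.
have cZ : cvgn (series (fun j => Z j w)).
  apply: nondecreasing_is_cvgn.
    by apply/nondecreasing_series => k _ _.
  exists (fine (F w)) => _ [n _ <-].
  rewrite -lee_fin fineK// /series/= -sumEFin.
  by apply: nneseries_lim_ge => k _ _; rewrite lee_fin.
have Zw := cvg_series_cvg_0 cZ.
have D0 : D j w @[j --> \oo] --> (0 : R).
  apply/cvgrPdist_le => e e0; near=> j.
  have gj : good j by near: j.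
  have : `|Z j w - 0| <= e ^+ 2 by near: j; apply: (cvgr_near_dist Zw); exact: exprn_gt0.
  rewrite subr0 /Z gj sub0r normrN ger0_norm ?sqr_ge0// -real_normK ?num_real//.
  by rewrite ler_pXn2r ?nnegrE ?(ltW e0).
have cD : D j w + parity_mean q (N_ j) (rho_ j) t / rho_ j ^+ d @[j --> \oo] -->
    0 + parity_limit q t by exact: cvgD.
rewrite add0r in cD; apply: cvg_trans cD; apply: near_eq_cvg; apply: nearW => j.
by rewrite /D subrK.
Unshelve. all: by end_near.
Qed.

End along_sequence.
End bounds.
End parity_counts.

(** * From pointwise to uniform convergence of monotone functions *)

Section monotone_limits.
Context (R : realType).

Lemma near_forall_ltn (p : nat -> nat -> Prop) (K : nat) :
  (forall i, \forall n \near \oo, p i n) ->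
  \forall n \near \oo, forall i, (i < K)%N -> p i n.
Proof.
move=> h; elim: K => [|K IH]; first by apply: nearW.
apply: filterS2 IH (h K) => n IH hK i; rewrite ltnS leq_eqVlt => /predU1P[->//|].
exact: IH.
Qed.

(* Polya: pointwise convergence of monotone functions on a fine grid is uniform
   on compacts as soon as the limit is Lipschitz. *)
Lemma polya_grid (F : nat -> R -> R) (L : R -> R) (T K : R) :
  (\forall n \near \oo, forall s t, 0 <= s -> s <= t -> F n s <= F n t) ->
  (forall s t, 0 <= s -> s <= t -> t <= T + 1 -> L s <= L t <= L s + (t - s) * K) ->
  (forall i M : nat, F n (i%:R / M.+1%:R) @[n --> \oo] --> L (i%:R / M.+1%:R)) ->
  forall e, 0 < e -> \forall n \near \oo, forall t, 0 <= t <= T -> `|F n t - L t| <= e.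
Proof.
move=> mF mL cF e e0.
have K'0 : 0 < `|K| + 1 by rewrite ltr_wpDl.
(* The mesh 1 / (M + 1) is so small that the limit varies by at most e / 2 over one cell. *)
pose M := Num.truncn ((`|K| + 1) / (e / 2)).
have M0 : 0 < M.+1%:R :> R by rewrite ltr0n.
have dM : M.+1%:R^-1 * K <= e / 2.
  apply: (@le_trans _ _ (M.+1%:R^-1 * (`|K| + 1))).
    by rewrite ler_wpM2l ?invr_ge0//; have := ler_norm K; lra.
  rewrite mulrC ler_pdivrMr// mulrC -ler_pdivrMr ?divr_gt0//.
  by rewrite ltW// truncnS_gt.
(* Two extra grid points: the cell of t has left index at most [truncn (T * M.+1)], and its right
   end, which may exceed T by at most 1, must be in the list too. *)
pose N := (Num.truncn (T * M.+1%:R)).+2.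
have e20 : 0 < e / 2 by rewrite divr_gt0.
have grid : \forall n \near \oo, forall i, (i < N)%N ->
    `|F n (i%:R / M.+1%:R) - L (i%:R / M.+1%:R)| <= e / 2.
  by apply: near_forall_ltn => i; exact: cvgr_near_dist (cF i M) _ e20.
apply: filterS2 mF grid => n mFn gn t /andP[t0 tT].
have u0 : 0 <= t * M.+1%:R by rewrite mulr_ge0.
have /andP[iu ui] := truncn_itv u0.
set i := Num.truncn (t * M.+1%:R) in iu ui.
have T0 : 0 <= T by exact: le_trans tT.
have iN : (i.+1 < N)%N.
  by rewrite /N !ltnS; apply: le_truncn; rewrite ler_wpM2r.
have s0 : 0 <= i%:R / M.+1%:R :> R by rewrite divr_ge0.
have st : i%:R / M.+1%:R <= t by rewrite ler_pdivrMr.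
have ts : t <= i.+1%:R / M.+1%:R by rewrite ler_pdivlMr// ltW.
have step : i.+1%:R / M.+1%:R - i%:R / M.+1%:R = M.+1%:R^-1 :> R.
  by rewrite -mulrBl -natrB// subSnn mul1r.
have M1 : M.+1%:R^-1 <= 1 :> R by rewrite invf_le1// ler1n.
have sT : i.+1%:R / M.+1%:R <= T + 1.
  by rewrite -(subrK (i%:R / M.+1%:R) (i.+1%:R / _)) step addrC lerD// (le_trans st).
have /andP[l1 l2] := mL _ _ s0 (le_trans st ts) sT.
have /andP[l3 _] := mL _ _ s0 st (le_trans ts sT).
have /andP[l4 _] := mL _ _ t0 ts sT.
rewrite step in l2.
have f1 := mFn _ _ s0 st; have f2 := mFn _ _ t0 ts.
have := gn i (ltnW iN); have := gn i.+1 iN.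
rewrite !ler_norml => /andP[g1 g2] /andP[g3 g4].
move: l2 l3 l4 f1 f2 g1 g2 g3 g4 dM.
move: (F n t) (F n _) (F n _) (L t) (L _) (L _) (_ * K).
by move=> Ft Fi Fj Lt Li Lj Q *; apply/andP; split; lra.
Qed.

End monotone_limits.

(** * Monotonicity of the parity counts *)

Section parity_structure.
Context (R : realType) (d : nat) dO (Omega : measurableType dO).
Variables (X : nat -> Omega -> d.-tuple R) (h : set (d.-tuple R) -> bool).
Local Notation P := (d.-tuple R).
Hypothesis hmono : forall (Xs : set P) (s t : R), finite_set Xs -> Xs !=set0 ->
  0 < s -> s <= t -> ht h s Xs -> ht h t Xs.

Lemma pts_of_widen (T : Type) m n (le_mn : (m <= n)%N) (I : {set 'I_m}) (x : nat -> T) :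
  pts_of (widen_ord le_mn @: I) (fun i : 'I_n => x i) = pts_of I (fun i : 'I_m => x i).
Proof.
apply/seteqP; split => z [i [iI ->]].
  by case/imsetP: iI => j jI ->; exists j.
by exists (widen_ord le_mn i); split => //; exact: imset_f.
Qed.

Lemma finite_pts_of (T : Type) n (I : {set 'I_n}) (x : 'I_n -> T) :
  finite_set (pts_of I x).
Proof.
apply: (@sub_finite_set _ _ (x @` setT)); first by move=> z [i [_ ->]]; exists i.
exact/finite_image/finite_finset.
Qed.

Lemma simplex_event_widen m n (le_mn : (m <= n)%N) (I : {set 'I_m}) rho rho' t t' w :
  (0 < #|I|)%N -> rho' <= rho -> 0 <= t -> t <= t' ->
  simplex_event X h rho t I w ->
  simplex_event X h rho' t' (widen_ord le_mn @: I) w.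
Proof.
move=> I0 rr t0 tt /andP[hI /forall_inP aI]; apply/andP; split.
  rewrite (pts_of_widen le_mn I (fun i => X i w)).
  apply: (ht_le hmono _ _ t0 tt hI); first exact: finite_pts_of.
  by case/card_gt0P: I0 => i iI; exists (X i w), i.
by apply/forall_inP => _ /imsetP[i iI ->]; apply: le_trans rr _; exact: aI.
Qed.

(** Widening the index range embeds the subsets of ['I_m] into those of ['I_n] without changing
    their cardinality, hence their parity; the other subsets add nonnegative terms. *)
Lemma parity_count_le q m n rho rho' t t' w :
  (m <= n)%N -> rho' <= rho -> 0 <= t -> t <= t' ->
  parity_count X h q m rho t w <= parity_count X h q n rho' t' w.
Proof.
move=> mn rr t0 tt.
have inj : injective (widen_ord mn).
  by move=> i j /(congr1 val) /= ij; exact: val_inj.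
pose img (I : {set 'I_m}) : {set 'I_n} := widen_ord mn @: I.
have injs : injective img by exact: imset_inj.
rewrite /parity_count.
pose D := [set I : {set 'I_m} | (0 < #|I|)%N && (odd #|I| == q)]%SET.
apply: (@le_trans _ _ (\sum_(J in (img @: D)%SET) (simplex_event X h rho' t' J w)%:R)).
  rewrite big_imset /=; last by move=> I J _ _; exact: injs.
  under [leRHS]eq_bigl do rewrite inE.
  apply: ler_sum => I /andP[I0 _]; rewrite ler_nat.
  have := @simplex_event_widen _ _ mn I _ _ _ _ w I0 rr t0 tt.
  by case: (simplex_event X h rho t I w) => // ->.
rewrite [leRHS](bigID (fun J => J \in (img @: D)%SET)) /=.
rewrite -[leLHS]addr0 lerD ?sumr_ge0//.
rewrite le_eqVlt; apply/orP; left; apply/eqP; apply: eq_bigl => J.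
case: (boolP (J \in _)) => [/imsetP[I]|]; rewrite ?andbF// inE => /andP[I0 oI] ->.
by rewrite card_imset// I0 oI.
Qed.

(** A k-simplex has k + 1 vertices, so an odd number of vertices goes with the sign +. *)
Lemma euler_char_parity n rho t w :
  euler_char h (fun i => X i w) rho n t =
  parity_count X h true n rho t w - parity_count X h false n rho t w.
Proof.
rewrite /euler_char /parity_count.
have E (F : {set 'I_n} -> R) (Q : pred nat) :
    \sum_(I : {set 'I_n} | (0 < #|I|)%N && Q #|I|) F I =
    \sum_(k < n | Q k.+1) \sum_(I : {set 'I_n} | #|I| == k.+1) F I.
  have le (I : {set 'I_n}) : (#|I| < n.+1)%N.
    by rewrite ltnS -[leqRHS](card_ord n) max_card.
  rewrite (partition_big (fun I : {set 'I_n} => Ordinal (le I)) (fun u => (0 < u)%N && Q u))//=.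
  rewrite big_mkcond big_ord_recl /= add0r [RHS]big_mkcond; apply: eq_bigr => k _.
  rewrite /bump /= add1n; case: ifP => // Qk; apply: eq_bigl => I.
  by rewrite -val_eqE /= /bump add1n; case: eqP => [->|]; rewrite ?andbT ?andbF.
rewrite !(E _ (fun u => odd u == _)).
rewrite (bigID (fun k : 'I_n => odd k.+1 == true)) /=; congr (_ + _).
  apply: eq_bigr => k /eqP ok; rewrite -signr_odd.
  by move: ok; rewrite /= => /negbTE ->; rewrite expr0 mul1r.
rewrite -sumrN; apply: eq_big => [k|k ok]; first by case: (odd k).
rewrite -signr_odd; move: ok; rewrite /= eqb_id negbK => ->.
by rewrite expr1 mulN1r.
Qed.

End parity_structure.

(** * Regularity of the limit in t *)

Section limit_process.
Context (R : realType) (d : nat).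
Context dO (Omega : measurableType dO) (Pr : probability Omega R).
Variables (X : nat -> Omega -> d.-tuple R) (fr : R -> R) (h : set (d.-tuple R) -> bool).
Variables (alpha xi : R).
Local Notation P := (d.-tuple R).
Local Notation mu := (lebP R d).
Hypothesis d_gt0 : (0 < d)%N.
Hypothesis mX : forall i, measurable_fun setT (X i).
Hypothesis indep : forall (I : seq nat) (A : nat -> set P),
  uniq I -> (forall i, measurable (A i)) ->
  Pr (\bigcap_(i in [set` I]) (X i @^-1` A i)) =
  (\prod_(i <- I) Pr (X i @^-1` A i))%E.
Hypothesis mfr : measurable_fun setT fr.
Hypothesis fr_ge0 : forall r, 0 <= r -> 0 <= fr r.
Hypothesis law : forall i (A : set P), measurable A ->
  Pr (X i @^-1` A) = (\int[mu]_x (\1_A x * fr (enorm x))%:E)%E.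
Hypothesis alphad : d%:R < alpha.
Hypothesis fr_rv : forall t, 0 < t ->
  (fun r => fr (r * t) / fr r) r @[r --> +oo] --> t `^ (- alpha).
Hypothesis xi_gt0 : 0 < xi.
Hypothesis h1 : forall x : P, h [set x].
Hypothesis hshift : forall (Xs : set P) (y : P), finite_set Xs -> Xs !=set0 ->
  h ((fun x => tadd x y) @` Xs) = h Xs.
Variable c : R.
Hypothesis c_gt0 : 0 < c.
Hypothesis hdiam : forall Xs : set P, finite_set Xs -> Xs !=set0 ->
  (exists x y, Xs x /\ Xs y /\ c < enorm (tadd x (tscale (-1) y))) -> h Xs = false.
Hypothesis hmono : forall (Xs : set P) (s t : R), finite_set Xs -> Xs !=set0 ->
  0 < s -> s <= t -> ht h s Xs -> ht h t Xs.
Hypothesis mh : forall m : nat, measurable_fun setT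
  (fun x : m.-tuple P => (h (tuple_pts x))%:R : R).

Lemma s_kE k t : 0 <= t -> s_k h alpha xi k t = s_k h alpha xi k 1 * t ^+ (d * k).
Proof.
move=> t0; case: k => [|k] /=; first by rewrite muln0 expr0 mulr1.
by rewrite (fine_int_ht d_gt0 h1 hshift hdiam hmono mh _ t0) -!mulrA [_ ^+ (d * _) * _]mulrC.
Qed.

Lemma s_k_ge0 k t : 0 <= t -> 0 <= s_k h alpha xi k t.
Proof.
move=> t0.
have den m : 0 < alpha * m.+1%:R - d%:R.
  by rewrite subr_gt0 (lt_le_trans alphad)// ler_peMr ?ler1n// ltW// (le_lt_trans _ alphad).
case: k => [|k] /=.
  by rewrite divr_ge0 ?subr_ge0 ?(ltW alphad)// mulr_ge0 ?surf_ge0 ?(ltW xi_gt0).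
rewrite mulr_ge0 ?fine_ge0 ?(int_ht_ge0 hmono mh)// divr_ge0//.
  by rewrite mulr_ge0 ?surf_ge0 ?exprn_ge0 ?(ltW xi_gt0).
by rewrite mulr_ge0// ltW.
Qed.

Hypothesis summable_s_k : forall (q : bool) t, 0 <= t ->
  cvgn (series (fun k => (odd k.+1 == q)%:R * s_k h alpha xi k t)).

(** Each term is a constant times t^(dk), and [powr_diff_le] bounds its increment by (t - s) / T
    times its value at 2T. The Lipschitz constant on [0, T] is thus the limit itself at 2T, divided
    by T. *)
Lemma parity_limit_lipschitz q (T s t : R) : 0 < T -> 0 <= s -> s <= t -> t <= T ->
  parity_limit h alpha xi q s <= parity_limit h alpha xi q t
    <= parity_limit h alpha xi q s + (t - s) * (T^-1 * parity_limit h alpha xi q (2 * T)).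
Proof.
move=> T0 s0 st tT; have t0 := le_trans s0 st; have TT : 0 <= 2 * T by rewrite mulr_ge0 ?(ltW T0).
have cs := @summable_s_k q _ s0; have ct := @summable_s_k q _ t0.
have cT := @summable_s_k q _ TT.
apply/andP; split.
  apply: lim_series_le => // k; rewrite ler_wpM2l// (s_kE _ s0) (s_kE _ t0).
  by rewrite ler_wpM2l ?s_k_ge0// lerXn2r ?nnegrE.
have lZ : (t - s) / T * parity_limit h alpha xi q (2 * T) = limn (series _) :=
  esym (lim_seriesZ ((t - s) / T) cT).
rewrite mulrA lZ -lim_seriesD//; last exact: is_cvg_seriesZ.
apply: lim_series_le => //; first by apply: is_cvg_seriesD => //; exact: is_cvg_seriesZ.
move=> k; rewrite -lerBlDl -mulrBr.
rewrite [leRHS](_ : _ = (odd k.+1 == q)%:R * ((t - s) / T * s_k h alpha xi k (2 * T)));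
  last exact: mulrCA.
rewrite ler_wpM2l//.
rewrite (s_kE _ s0) (s_kE _ t0) (s_kE _ TT) -mulrBr mulrCA ler_wpM2l ?s_k_ge0//.
exact: powr_diff_le.
Qed.

Lemma euler_limit_parity t : 0 <= t ->
  euler_limit h alpha xi t = parity_limit h alpha xi true t - parity_limit h alpha xi false t.
Proof.
move=> t0; rewrite /parity_limit -(lim_seriesB (@summable_s_k true _ t0) (@summable_s_k false _ t0)).
rewrite /euler_limit; congr (limn _); apply/funext => N.
rewrite /series /= big_mkord; apply: eq_bigr => k _.
rewrite -signr_odd [RHS](_ : _ = (odd k.+1 == true)%:R * s_k h alpha xi k t
  - (odd k.+1 == false)%:R * s_k h alpha xi k t)// -mulrBl; congr (_ * _).
by rewrite /=; case: (odd k); rewrite ?mulr1n ?mulr0n ?expr0 ?expr1 ?subr0 ?sub0r.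
Qed.

End limit_process.

(** * Polynomial blocks of indices *)

Section polynomial_blocks.
Context (R : realType).

(** The right-hand side telescopes: 1 / x^2 <= 2 / x - 2 / (x + 1) for x >= 1. *)
Lemma sum_inv_sqr_le n :
  \sum_(0 <= j < n) (j.+1%:R ^+ 2)^-1 <= 2 - 2 / n.+1%:R :> R.
Proof.
elim: n => [|n IH]; first by rewrite big_nil divr1 subrr.
rewrite big_nat_recr//=; apply: (le_trans (lerD IH (lexx _))).
have x1 : 1 <= n.+1%:R :> R by rewrite ler1n.
rewrite -[n.+2%:R]/(1 + n.+1%:R); move: n.+1%:R x1 => x x1.
rewrite -addrA lerD2l -subr_ge0.
have -> : - (2 / (1 + x)) - (- (2 / x) + (x ^+ 2)^-1) = (x - 1) / (x ^+ 2 * (1 + x)).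
  by field; apply/andP; split; lra.
by rewrite divr_ge0 ?mulr_ge0 ?exprn_ge0//; lra.
Qed.

Lemma cvg_series_inv_sqr : cvgn (series (fun j => (j.+1%:R ^+ 2)^-1 : R)).
Proof.
apply: nondecreasing_is_cvgn.
  by apply: nondecreasing_series => j _ _; rewrite invr_ge0 exprn_ge0.
exists 2 => _ [n _ <-]; apply: (le_trans (sum_inv_sqr_le n)).
by rewrite gerBl divr_ge0.
Qed.

Variables (J q : nat).
Hypotheses (J_gt0 : (0 < J)%N) (q_gt0 : (0 < q)%N).
(** The offset [J] discards the initial indices, where the radius may still be small, so that the
    growth bounds hold on every block and not only eventually. *)
Definition power_block j := ((j + J) ^ q)%N.

Lemma block_gt0 j : (0 < power_block j)%N.
Proof. by rewrite expn_gt0 addn_gt0 J_gt0 orbT. Qed.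

Lemma block_geq j : (j + J <= power_block j)%N.
Proof. by rewrite /power_block -{1}(expn1 (j + J)) leq_pexp2l// addn_gt0 J_gt0 orbT. Qed.

Lemma block_mono : {mono power_block : i j / (i <= j)%N}.
Proof. by move=> i j; rewrite /power_block leq_exp2r// leq_add2r. Qed.

(** The existential is outside the implication so that a block number can be chosen for every n, an
    arbitrary one before the first block. *)
Lemma block_index_ex n : exists j, (power_block 0 <= n)%N -> (power_block j <= n < power_block j.+1)%N.
Proof.
have [b0|b0] := leqP (power_block 0) n; last by exists 0%N.
have ub j : (power_block j <= n)%N -> (j <= n)%N.
  by apply: leq_trans; apply: leq_trans (block_geq j); exact: leq_addr.
have ex : exists j, (power_block j <= n)%N by exists 0%N.
case: (ex_maxnP ex ub) => j jn jmax; exists j => _; rewrite jn ltnNge /=.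
by apply/negP => /jmax; rewrite ltnn.
Qed.

Definition block_index n := sval (cid (block_index_ex n)).

Lemma block_indexP n : (power_block 0 <= n)%N ->
  (power_block (block_index n) <= n < power_block (block_index n).+1)%N.
Proof. exact: (svalP (cid (block_index_ex n))). Qed.

Lemma block_index_geq j n : (power_block j <= n)%N -> (j <= block_index n)%N.
Proof.
move=> jn; have b0 : (power_block 0 <= n)%N by apply: leq_trans jn; rewrite block_mono.
have /andP[_ nb] := block_indexP b0.
by rewrite -ltnS ltnNge -block_mono -ltnNge (leq_ltn_trans jn).
Qed.

Lemma block_index_cvg M : \forall n \near \oo, (M <= block_index n)%N.
Proof. by exists (power_block M) => // n /= /block_index_geq. Qed.

(** The reason for polynomial blocks: geometric ones would leave a constant factor between their
    ends, and the two monotone bounds would not meet. *)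
Lemma block_ratio_cvg : (power_block j.+1)%:R / (power_block j)%:R @[j --> \oo] --> (1 : R).
Proof.
have c1 : 1 + (j + J)%:R^-1 @[j --> \oo] --> (1 : R).
  rewrite -[X in _ --> X]addr0; apply: cvgD; first exact: cvg_cst.
  apply/gtr0_cvgV0; first by apply: nearW => j; rewrite ltr0n addn_gt0 J_gt0 orbT.
  apply/cvgryPge => A; exists (Num.truncn A).+1 => // j /= Aj.
  by rewrite (le_trans (ltW (truncnS_gt A)))// ler_nat (leq_trans Aj)// leq_addr.
have c2 : (1 + (j + J)%:R^-1) ^+ q @[j --> \oo] --> (1 ^+ q : R).
  by apply: (cvg_comp _ (fun x => x ^+ q) c1); exact: exprn_continuous.
rewrite expr1n in c2; apply: cvg_trans c2; apply: near_eq_cvg; apply: nearW => j.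
rewrite /power_block !natrX -expr_div_n; congr (_ ^+ _).
have x0 : (j + J)%:R != 0 :> R by rewrite pnatr_eq0 -lt0n addn_gt0 J_gt0 orbT.
by rewrite addSn -natr1 mulrDl divff// mul1r.
Qed.

(** For a and b in [u, U], |b - a| / b <= (U - u) / u, which tends to 0 along the blocks. *)
Lemma same_block_ratio_cvg (k a b : nat -> nat) :
  (forall M, \forall n \near \oo, (M <= k n)%N) ->
  (\forall n \near \oo, (power_block (k n) <= a n <= power_block (k n).+1)%N) ->
  (\forall n \near \oo, (power_block (k n) <= b n <= power_block (k n).+1)%N) ->
  (a n)%:R / (b n)%:R @[n --> \oo] --> (1 : R).
Proof.
move=> koo an bn; apply/cvgrPdist_le => e e0.
have : \forall j \near \oo, `|1 - (power_block j.+1)%:R / (power_block j)%:R| <= e :> R.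
  by move/cvgrPdist_le : block_ratio_cvg; apply.
move=> [M _ MP]; apply: filterS3 (koo M) an bn => n Mk.
move=> /andP[ua aU] /andP[ub bU]; have /= MPk := MP (k n) Mk; apply: le_trans MPk.
have u0 : 0 < (power_block (k n))%:R :> R by rewrite ltr0n block_gt0.
move: ua aU ub bU; rewrite -!(ler_nat R).
move: (power_block (k n))%:R (power_block (k n).+1)%:R (a n)%:R (b n)%:R u0 => u U a' b' u0 ua aU ub bU.
have b0 : 0 < b' by exact: lt_le_trans u0 ub.
have uU : u <= U by exact: le_trans ua aU.
rewrite -[X in `|X - a' / b'|](divff (lt0r_neq0 b0)) -[X in `|X - U / u|](divff (lt0r_neq0 u0)).
rewrite -!mulrBl !normrM !normfV (gtr0_norm b0) (gtr0_norm u0) (distrC u) (@ger0_norm _ (U - u)) ?subr_ge0//.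
apply: ler_pM; rewrite ?invr_ge0 ?(ltW b0)//; last by rewrite lef_pV2.
by rewrite ler_norml; apply/andP; split; lra.
Qed.

End polynomial_blocks.

(** [k] need not be increasing: a block number repeats over its whole block. *)
Lemma cvg_subseq (T : Type) (u : nat -> T) (F : set_system T) (k : nat -> nat) :
  (forall M, \forall n \near \oo, (M <= k n)%N) -> u j @[j --> \oo] --> F ->
  u (k n) @[n --> \oo] --> F.
Proof. by move=> koo uF A /uF[M _ MA]; apply: filterS (koo M) => n; exact: MA. Qed.

(** * Radii along the blocks *)

Section block_radii.
Context (R : realType).
Variables (fr : R -> R) (alpha xi : R) (R_ : nat -> R).
Hypothesis mfr : measurable_fun setT fr.
Hypothesis fr_ge0 : forall r, 0 <= r -> 0 <= fr r.
Hypothesis fr_rv : forall t, 0 < t ->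
  (fun r => fr (r * t) / fr r) r @[r --> +oo] --> t `^ (- alpha).
Hypothesis alpha_gt0 : 0 < alpha.
Hypothesis xi_gt0 : 0 < xi.
Hypothesis Roo : R_ n @[n --> \oo] --> +oo.
Hypothesis nfr_cvg : n%:R * fr (R_ n) @[n --> \oo] --> xi.

(** From C <= fr (R_n) R_n^p and n fr (R_n) <= xi + 1 follows n C <= (xi + 1) R_n^p. The variable x
    with x^p <= n stands for n^(1/p), so that no root is taken. *)
Lemma radius_growth (p : nat) : alpha < p%:R -> exists2 c : R, 0 < c &
  \forall n \near \oo, 1 <= R_ n /\ forall x, 0 <= x -> x ^+ p <= n%:R -> c * x <= R_ n.
Proof.
move=> ap; have p_gt0 : (0 < p)%N by rewrite -(ltr0n R) (lt_trans alpha_gt0).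
have [r0 [C [r00 C0 Cfr]]] := rv_lower_bound mfr fr_ge0 fr_rv ap.
have x1 : 0 < xi + 1 by rewrite addr_gt0.
(* As c <= 1, c^p <= c <= C / (xi + 1); this again avoids a p-th root. *)
pose c := Num.min 1 (C / (xi + 1)).
have c0 : 0 < c by rewrite lt_min ltr01 divr_gt0.
exists c => //.
have near_xi : \forall n \near \oo, n%:R * fr (R_ n) <= xi + 1.
  apply: filterS (cvgr_near_dist nfr_cvg ltr01) => n.
  by rewrite ler_norml => /andP[_]; rewrite lerBlDl.
apply: filterS3 near_xi (cvgry_near_ge Roo r0) (cvgry_near_ge Roo 1) => n nx nr n1.
split=> // x x_ge0 xn; have Rn0 : 0 <= R_ n by exact: le_trans n1.
have cx : 0 <= c * x by rewrite mulr_ge0// ltW.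
rewrite -(ler_pXn2r p_gt0) ?nnegrE// exprMn.
apply: (@le_trans _ _ (C / (xi + 1) * n%:R)).
  apply: ler_pM; rewrite ?exprn_ge0 ?(ltW c0)//.
  by rewrite (le_trans (ler_iXnr p_gt0 (ltW c0) _)) ?ge_min ?lexx ?orbT.
rewrite mulrAC ler_pdivrMr// [C * _]mulrC [leRHS]mulrC.
apply: (le_trans (ler_wpM2l (ler0n R n) (Cfr _ nr))).
by rewrite powR_mulrn// mulrA ler_wpM2r ?exprn_ge0.
Qed.

Definition decay_exponent := (Num.truncn alpha).+1.

Lemma alpha_lt_decay : alpha < decay_exponent%:R.
Proof. exact: truncnS_gt. Qed.

Lemma decay_gt0 : (0 < 2 * decay_exponent)%N.
Proof. by rewrite muln_gt0. Qed.

Lemma radius_growth_shift : exists c J, [/\ 0 < c, (0 < J)%N &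
  forall n, (J <= n)%N -> 1 <= R_ n /\
    forall x, 0 <= x -> x ^+ decay_exponent <= n%:R -> c * x <= R_ n].
Proof.
have [c c0 [M _ MP]] := radius_growth alpha_lt_decay.
by exists c, M.+1; split=> // n Mn; apply: MP; exact: ltnW.
Qed.

Section choice_in_blocks.
Variables (c : R) (J : nat).
Hypotheses (c_gt0 : 0 < c) (J_gt0 : (0 < J)%N).
Hypothesis growth : forall n, (J <= n)%N -> 1 <= R_ n /\
  forall x, 0 <= x -> x ^+ decay_exponent <= n%:R -> c * x <= R_ n.
Local Notation v := (power_block J (2 * decay_exponent)).
Local Notation k := (block_index J_gt0 decay_gt0).

Variable m : nat -> nat.
Hypothesis m_block : forall j, (v j <= m j <= v j.+1)%N.

Lemma choice_large M : \forall j \near \oo, (M <= m j)%N.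
Proof.
exists M => // j /= Mj; have /andP[vm _] := m_block j.
apply: leq_trans vm; apply: leq_trans (block_geq J_gt0 decay_gt0 j) => //.
by rewrite (leq_trans Mj)// leq_addr.
Qed.

Lemma choice_radius_cvg : R_ (m j) @[j --> \oo] --> +oo.
Proof. exact: (@cvg_subseq _ R_ _ m choice_large Roo). Qed.

(** [N j] and [m j] share a block, so their ratio tends to 1 and one may replace the other in n fr
    (R_n) -> xi. *)
Lemma choice_mass_cvg (N : nat -> nat) : (forall j, (v j <= N j <= v j.+1)%N) ->
  (N j)%:R * fr (R_ (m j)) @[j --> \oo] --> xi.
Proof.
move=> Nb.
have c1 : (N j)%:R / (m j)%:R @[j --> \oo] --> (1 : R).
  apply: (@same_block_ratio_cvg R J (2 * decay_exponent) J_gt0 id) => //.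
  - by move=> M; exists M.
  - exact: nearW.
  - exact: nearW.
have c2 := @cvg_subseq _ (fun n => n%:R * fr (R_ n)) _ m choice_large nfr_cvg.
have c3 : (N j)%:R / (m j)%:R * ((m j)%:R * fr (R_ (m j))) @[j --> \oo] --> 1 * xi.
  by exact: cvgM.
rewrite mul1r in c3; apply: cvg_trans c3; apply: near_eq_cvg.
apply: filterS (choice_large 1) => j m0.
by rewrite mulrA divfK// pnatr_eq0 -lt0n.
Qed.

(** Both n fr (R_n) and its value at the chosen index tend to xi, and the two indices share a block.
    The densities therefore have ratio tending to 1, which [rv_ratio_inj] transfers to the radii. *)
Lemma choice_ratio_cvg : R_ (m (k n)) / R_ n @[n --> \oo] --> (1 : R).
Proof.
have koo := block_index_cvg J_gt0 decay_gt0.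
apply: (rv_ratio_inj mfr fr_ge0 fr_rv alpha_gt0) => //.
  exact: (@cvg_subseq _ (fun j => R_ (m j)) _ k koo choice_radius_cvg).
have c1 : n%:R / (m (k n))%:R @[n --> \oo] --> (1 : R).
  apply: (@same_block_ratio_cvg R J (2 * decay_exponent) J_gt0 k) => //.
  - exists (v 0) => // n /= vn; have /andP[-> /ltnW ->] // := block_indexP J_gt0 decay_gt0 vn.
  - exact: nearW.
have mk M : \forall n \near \oo, (M <= m (k n))%N.
  by have [K _ MK] := choice_large M; apply: filterS (koo K) => n; exact: MK.
have c2 := @cvg_subseq _ (fun n => n%:R * fr (R_ n)) _ (m \o k) mk nfr_cvg.
have c3 : ((m (k n))%:R * fr (R_ (m (k n)))) / (n%:R * fr (R_ n)) @[n --> \oo] --> xi / xi.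
  by apply: cvgM c2 _; apply: cvgV => //; exact: lt0r_neq0.
have c4 : n%:R / (m (k n))%:R *
    ((m (k n))%:R * fr (R_ (m (k n))) / (n%:R * fr (R_ n))) @[n --> \oo] --> 1 * (xi / xi).
  by exact: cvgM.
rewrite divff ?lt0r_neq0// mulr1 in c4; apply: cvg_trans c4; apply: near_eq_cvg; apply: filterS2 (mk 1%N) (nbhs_infty_ge 1) => n m0 n0.
move: m0 n0; rewrite !lt0n -!(pnatr_eq0 R) invfM.
move: _%:R _%:R (fr _) (fr _)^-1 => a b x y a0 b0.
by field; rewrite a0 b0.
Qed.

(** The block starts at (j + J)^(2p) >= ((j + 1)^2)^p, so the growth bound gives R >= c (j + 1)^2;
    since R >= 1, the power d only helps. *)
Lemma choice_summable d : (0 < d)%N -> cvgn (series (fun j => `|R_ (m j)|^-1 ^+ d)).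
Proof.
move=> d0; apply: (@series_le_cvg _ _ (fun j => c^-1 * (j.+1%:R ^+ 2)^-1)).
- by move=> j; rewrite exprn_ge0.
- by move=> j; rewrite mulr_ge0 ?invr_ge0 ?exprn_ge0 ?(ltW c_gt0).
- move=> j; have /andP[vm _] := m_block j.
  have Jm : (J <= m j)%N.
    by apply: leq_trans vm; apply: leq_trans (block_geq J_gt0 decay_gt0 j); rewrite ?leq_addl.
  have [R1 gR] := growth Jm; have R0 : 0 <= R_ (m j) by exact: le_trans R1.
  rewrite ger0_norm// (le_trans (ler_iXnr d0 _ _)) ?invr_ge0 ?invf_le1 ?(lt_le_trans _ R1)//.
  rewrite -invfM lef_pV2 ?posrE ?(lt_le_trans _ R1)// ?mulr_gt0 ?exprn_gt0//.
  apply: gR; first exact: exprn_ge0.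
  rewrite -exprM -natrX ler_nat; apply: leq_trans vm.
  by rewrite /power_block leq_exp2r// addnC -add1n leq_add.
- exact/is_cvg_seriesZ/cvg_series_inv_sqr.
Qed.

End choice_in_blocks.

End block_radii.

(** No monotonicity of [R_] is available, but each block is finite, so its extrema are attained. *)
Lemma block_extrema (R : realType) (R_ : nat -> R) (v : nat -> nat) :
  (forall j, (v j <= v j.+1)%N) -> exists lo hi : nat -> nat,
  [/\ forall j, (v j <= lo j <= v j.+1)%N, forall j, (v j <= hi j <= v j.+1)%N &
      forall j n, (v j <= n <= v j.+1)%N -> R_ (lo j) <= R_ n <= R_ (hi j)].
Proof.
move=> mv.
have ex j : exists lohi : nat * nat, [/\ (v j <= lohi.1 <= v j.+1)%N,
    (v j <= lohi.2 <= v j.+1)%N &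
    forall n, (v j <= n <= v j.+1)%N -> R_ lohi.1 <= R_ n <= R_ lohi.2].
  pose i0 : 'I_(v j.+1).+1 := ord_max.
  have P0 : (v j <= i0)%N by exact: mv.
  have := @arg_minP _ R _ i0 (fun i => (v j <= i)%N) (fun i => R_ i) P0.
  case=> lo /= vlo lomin.
  have := @arg_maxP _ R _ i0 (fun i => (v j <= i)%N) (fun i => R_ i) P0.
  case=> hi /= vhi himax.
  exists (nat_of_ord lo, nat_of_ord hi); split; [by rewrite vlo -ltnS ltn_ord|by rewrite vhi -ltnS ltn_ord|].
  move=> n /andP[vn nv]; have nv' : (n < (v j.+1).+1)%N by rewrite ltnS.
  by have := lomin (Ordinal nv') vn; have := himax (Ordinal nv') vn => /= -> ->.
have [f fP] := choice ex.
by exists (fun j => (f j).1), (fun j => (f j).2); split=> j; have [] := fP j.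
Qed.

(** * From the blocks to the full sequence *)

Section almost_sure_limits.
Context (R : realType) (d : nat).
Context dO (Omega : measurableType dO) (Pr : probability Omega R).
Variables (X : nat -> Omega -> d.-tuple R) (fr : R -> R) (h : set (d.-tuple R) -> bool).
Variables (alpha xi : R).
Local Notation P := (d.-tuple R).
Local Notation mu := (lebP R d).
Hypothesis d_gt0 : (0 < d)%N.
Hypothesis mX : forall i, measurable_fun setT (X i).
Hypothesis indep : forall (I : seq nat) (A : nat -> set P),
  uniq I -> (forall i, measurable (A i)) ->
  Pr (\bigcap_(i in [set` I]) (X i @^-1` A i)) =
  (\prod_(i <- I) Pr (X i @^-1` A i))%E.
Hypothesis mfr : measurable_fun setT fr.
Hypothesis fr_ge0 : forall r, 0 <= r -> 0 <= fr r.
Hypothesis law : forall i (A : set P), measurable A ->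
  Pr (X i @^-1` A) = (\int[mu]_x (\1_A x * fr (enorm x))%:E)%E.
Hypothesis alphad : d%:R < alpha.
Hypothesis fr_rv : forall t, 0 < t ->
  (fun r => fr (r * t) / fr r) r @[r --> +oo] --> t `^ (- alpha).
Hypothesis xi_gt0 : 0 < xi.
Hypothesis h1 : forall x : P, h [set x].
Hypothesis hshift : forall (Xs : set P) (y : P), finite_set Xs -> Xs !=set0 ->
  h ((fun x => tadd x y) @` Xs) = h Xs.
Variable c : R.
Hypothesis c_gt0 : 0 < c.
Hypothesis hdiam : forall Xs : set P, finite_set Xs -> Xs !=set0 ->
  (exists x y, Xs x /\ Xs y /\ c < enorm (tadd x (tscale (-1) y))) -> h Xs = false.
Hypothesis hmono : forall (Xs : set P) (s t : R), finite_set Xs -> Xs !=set0 ->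
  0 < s -> s <= t -> ht h s Xs -> ht h t Xs.
Hypothesis mh : forall m : nat, measurable_fun setT
  (fun x : m.-tuple P => (h (tuple_pts x))%:R : R).
Variable R_ : nat -> R.
Hypothesis Roo : R_ n @[n --> \oo] --> +oo.
Hypothesis nfr_cvg : n%:R * fr (R_ n) @[n --> \oo] --> xi.
Variables (r0 C b : R).
Hypotheses (r00 : 0 < r0) (C0 : 0 < C) (db : d%:R < b).
Hypothesis fr_gt0 : forall r, r0 <= r -> 0 < fr r.
Hypothesis fr_le : forall r t, r0 <= r -> 1 <= t -> fr (r * t) / fr r <= C * t `^ (- b).
Hypothesis balpha : b < alpha.

Lemma parity_count_cvg_ae q (t_ : nat -> R) : (forall i, 0 <= t_ i) ->
  {ae Pr, forall w, forall i, parity_count X h q n (R_ n) (t_ i) w / R_ n ^+ d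
    @[n --> \oo] --> parity_limit h alpha xi q (t_ i)}.
Proof.
move=> t0; apply: ae_foralln => i.
have alpha_gt0 : 0 < alpha by rewrite (le_lt_trans _ alphad).
have [c1 [J [c10 J0 grow]]] :=
  radius_growth_shift mfr fr_ge0 fr_rv alpha_gt0 xi_gt0 Roo nfr_cvg.
pose v := power_block J (2 * decay_exponent alpha).
pose k := block_index J0 (decay_gt0 alpha).
have mv j : (v j <= v j.+1)%N by rewrite block_mono ?decay_gt0.
have [lo [hi [vlo vhi ext]]] := block_extrema R_ mv.
have koo : forall M, \forall n \near \oo, (M <= k n)%N by exact: block_index_cvg.
have vid j : (v j <= v j <= v j.+1)%N by rewrite leqnn mv.
have vS j : (v j <= v j.+1 <= v j.+1)%N by rewrite leqnn mv.
(* Convergence along the blocks is normalised by the chosen radius; the ratio of that radius to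
   [R_ n] tends to 1, which allows the normalisation by R_n^d. *)
have cvg_along N m : (forall j, (v j <= N j <= v j.+1)%N) ->
    (forall j, (v j <= m j <= v j.+1)%N) ->
    {ae Pr, forall w, parity_count X h q (N (k n)) (R_ (m (k n))) (t_ i) w / R_ n ^+ d
      @[n --> \oo] --> parity_limit h alpha xi q (t_ i)}.
  move=> vN vm.
  have := @parity_count_ae _ _ _ _ Pr X fr h alpha xi mX indep mfr fr_ge0 law alphad
    fr_rv xi_gt0 h1 hshift c hdiam hmono mh r0 C b r00 C0 db fr_gt0 fr_le balpha N
    (R_ \o m) (choice_large J0 vN) (choice_radius_cvg Roo J0 vm)
    (choice_mass_cvg nfr_cvg J0 vm vN) q _ (t0 i) (choice_summable c10 J0 grow vm d_gt0).
  apply: filterS => w cw.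
  have cr := choice_ratio_cvg mfr fr_ge0 fr_rv alpha_gt0 xi_gt0 Roo nfr_cvg J0 vm.
  have ck := @cvg_subseq _ (fun j => parity_count X h q (N j) (R_ (m j)) (t_ i) w /
    R_ (m j) ^+ d) _ k koo cw.
  have crd : (R_ (m (k n)) / R_ n) ^+ d @[n --> \oo] --> (1 ^+ d : R).
    by apply: (cvg_comp _ (fun x => x ^+ d) cr); exact: exprn_continuous.
  have cp : parity_count X h q (N (k n)) (R_ (m (k n))) (t_ i) w / R_ (m (k n)) ^+ d *
      (R_ (m (k n)) / R_ n) ^+ d @[n --> \oo] --> parity_limit h alpha xi q (t_ i) * 1 ^+ d.
    exact: cvgM.
  rewrite expr1n mulr1 in cp; apply: cvg_trans cp; apply: near_eq_cvg.
  have Rk : \forall n \near \oo, 1 <= R_ (m (k n)).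
    have [M _ MP] := cvgry_near_ge (choice_radius_cvg Roo J0 vm) 1.
    by apply: filterS (koo M) => n; exact: MP.
  apply: filterS Rk => n R1; have R0 : R_ (m (k n)) ^+ d != 0.
    by rewrite expf_neq0// gt_eqF// (lt_le_trans _ R1).
  by rewrite expr_div_n mulrA divfK.
(* The lower bound takes the fewest points and the largest radius of the block, the upper bound the
   most points and the smallest radius. *)
apply: filterS2 (cvg_along v hi vid vhi) (cvg_along (v \o S) lo vS vlo) => w clo chi.
apply: squeeze_cvgr clo chi.
apply: filterS2 (cvgry_near_ge Roo 1) (nbhs_infty_ge (v 0)) => n R1 vn.
have /andP[kn nk] := block_indexP J0 (decay_gt0 alpha) vn.
have Rn0 : 0 <= (R_ n ^+ d)^-1 by rewrite invr_ge0 exprn_ge0// (le_trans _ R1).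
have /andP[loR Rhi] : R_ (lo (k n)) <= R_ n <= R_ (hi (k n)).
  by apply: ext; rewrite kn ltnW.
apply/andP; split; apply: ler_wpM2r => //.
  exact: (@parity_count_le _ _ _ _ X h hmono q _ _ _ _ _ _ w kn Rhi (t0 i) (lexx _)).
exact: (@parity_count_le _ _ _ _ X h hmono q _ _ _ _ _ _ w (ltnW nk) loR (t0 i) (lexx _)).
Qed.

End almost_sure_limits.

(** * Uniform almost sure convergence of the Euler characteristic *)

Theorem theorem3p1
  (R : realType) (d : nat)
  (dO : measure_display) (Omega : measurableType dO) (Pr : probability Omega R)
  (X : nat -> Omega -> d.-tuple R)
  (fr : R -> R) (alpha xi : R) (R_ : nat -> R)
  (h : set (d.-tuple R) -> bool) :
  (* dimension *)
  (2 <= d)%N ->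
  (* the X_i are random points of R^d *)
  (forall i, measurable_fun setT (X i)) ->
  (* mutual independence *)
  (forall (I : seq nat) (A : nat -> set (d.-tuple R)),
      uniq I -> (forall i, measurable (A i)) ->
      Pr (\bigcap_(i in [set` I]) (X i @^-1` A i)) =
      (\prod_(i <- I) Pr (X i @^-1` A i))%E) ->
  (* spherically symmetric density  f(x) = fr(|x|) *)
  measurable_fun setT fr ->
  (forall r, 0 <= r -> 0 <= fr r) ->
  (forall i (A : set (d.-tuple R)), measurable A ->
      Pr (X i @^-1` A) = leb_int (fun x => (\1_A x * fr (enorm x))%:E)) ->
  (* regular variation of the radial density *)
  (d%:R < alpha) ->
  (forall t, 0 < t ->
      (fun r => fr (r * t) / fr r) r @[r --> +oo] --> t `^ (- alpha)) ->
  (* the radii R_n *)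
  R_ n @[n --> \oo] --> +oo ->
  0 < xi ->
  (fun n => n%:R * fr (R_ n)) n @[n --> \oo] --> xi ->
  (* conditions on h (on non-empty finite subsets of R^d) *)
  (forall x : d.-tuple R, h [set x]) ->
  (forall Xs Ys : set (d.-tuple R), finite_set Xs -> Ys !=set0 -> Ys `<=` Xs ->
      h Xs -> h Ys) ->                                                  (* H1 *)
  (forall (Xs : set (d.-tuple R)) (y : d.-tuple R), finite_set Xs -> Xs !=set0 ->
      h ((fun x => tadd x y) @` Xs) = h Xs) ->                          (* H2 *)
  (exists c : R, 0 < c /\
      forall Xs : set (d.-tuple R), finite_set Xs -> Xs !=set0 ->
        (exists x y, Xs x /\ Xs y /\ c < enorm (tadd x (tscale (-1) y))) ->
        h Xs = false) ->                                                (* H3 *)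
  (forall (Xs : set (d.-tuple R)) (s t : R), finite_set Xs -> Xs !=set0 ->
      0 < s -> s <= t -> ht h s Xs -> ht h t Xs) ->                     (* H4 *)
  (* implicit measurability of h *)
  (forall m : nat, measurable_fun setT
      (fun x : m.-tuple (d.-tuple R) => (h (tuple_pts x))%:R : R)) ->
  (* conclusion: a.s. uniform convergence on compacts of chi_n / R_n^d *)
  {ae Pr, forall w, forall T : R, 0 < T -> forall eps : R, 0 < eps ->
      \forall n \near \oo, forall t : R, 0 <= t <= T ->
        `| euler_char h (fun i => X i w) (R_ n) n t / R_ n ^+ d
           - euler_limit h alpha xi t | <= eps}.
Proof.
move=> d2 mX indep mfr fr_ge0 law alphad fr_rv Roo xi_gt0 nfr_cvg h1 _ hshift
  [c [_ hdiam]] hmono mh.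
have d_gt0 : (0 < d)%N by exact: ltnW.
have law' i (A : set (d.-tuple R)) : measurable A ->
    Pr (X i @^-1` A) = (\int[lebP R d]_x (\1_A x * fr (enorm x))%:E)%E.
  move=> mA; rewrite law// int_lebP//.
    apply/measurable_EFinP; apply: measurable_funM; first exact: measurable_indic.
    exact: measurableT_comp mfr (@measurable_enorm R d).
  by move=> x; rewrite lee_fin mulr_ge0// fr_ge0// sqrtr_ge0.
(* Any exponent strictly between d and alpha would do. *)
pose b := (alpha + d%:R) / 2.
have db : d%:R < b by rewrite /b; lra.
have ba : b < alpha by rewrite /b; lra.
have [r0 [C [r00 C0 fr_gt0 fr_le]]] := rv_upper_bound mfr fr_ge0 fr_rv ba.
(* Summability is a by-product of the convergence of the means, applied here to n points and the
   given radii. *)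
have summable q t (t0 : 0 <= t) :=
  (parity_mean_cvg mfr fr_ge0 alphad fr_rv xi_gt0 h1 hshift hdiam hmono mh
    r00 C0 db fr_gt0 fr_le ba nbhs_infty_ge Roo nfr_cvg q t0).1.
(* Only the countably many times i / (M + 1) enter, so the exceptional null sets can be united. *)
have grid q : {ae Pr, forall w, forall M i,
    parity_count X h q n (R_ n) (i%:R / M.+1%:R) w / R_ n ^+ d @[n --> \oo] -->
    parity_limit h alpha xi q (i%:R / M.+1%:R)}.
  apply: ae_foralln => M.
  exact: (parity_count_cvg_ae d_gt0 mX indep mfr fr_ge0 law' alphad fr_rv xi_gt0 h1 hshift
    hdiam hmono mh Roo nfr_cvg r00 C0 db fr_gt0 fr_le ba).
have polya q w T : 0 < T -> (forall M i,
    parity_count X h q n (R_ n) (i%:R / M.+1%:R) w / R_ n ^+ d @[n --> \oo] -->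
    parity_limit h alpha xi q (i%:R / M.+1%:R)) ->
  forall e, 0 < e -> \forall n \near \oo, forall t, 0 <= t <= T ->
    `|parity_count X h q n (R_ n) t w / R_ n ^+ d - parity_limit h alpha xi q t| <= e.
  move=> T0 cv; have T1 : 0 < T + 1 by rewrite addr_gt0.
  apply: (@polya_grid R (fun n t => parity_count X h q n (R_ n) t w / R_ n ^+ d)).
  - apply: filterS (cvgry_near_ge Roo 0) => n Rn s t s0 st.
    rewrite ler_wpM2r ?invr_ge0 ?exprn_ge0//.
    exact: (@parity_count_le _ _ _ _ X h hmono q n n _ _ _ _ w (leqnn n) (lexx _) s0 st).
  - move=> s t s0 st tT.
    exact: (parity_limit_lipschitz d_gt0 alphad xi_gt0 h1 hshift hdiam hmono mh summable
      q T1 s0 st tT).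
  - by move=> i M; exact: cv.
apply: filterS2 (grid true) (grid false) => w gt gf T T0 eps eps0.
have e20 : 0 < eps / 2 by rewrite divr_gt0.
apply: filterS2 (polya true w T T0 gt _ e20) (polya false w T T0 gf _ e20) => n pt pf t tT.
have /andP[t0 _] := tT.
rewrite euler_char_parity (euler_limit_parity summable t0) mulrBl.
have := pt _ tT; have := pf _ tT.
set y := _ / _; set x := (parity_count _ _ true _ _ _ _) / _ => yf xt.
 rewrite [leRHS]splitr.
have -> : x - y - (parity_limit h alpha xi true t - parity_limit h alpha xi false t) =
  (x - parity_limit h alpha xi true t) - (y - parity_limit h alpha xi false t) by ring.
by rewrite (le_trans (ler_normB _ _))// lerD.
Qed.
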